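(* Let $q\ge 0$ be real and let $X$, $Y$ be finite alphabets of nonnegative real numbers with $\max\{1,q\}\,xy<1$ for all $x\in X$, $y\in Y$. Let $(\mu,\lambda)$ be a random pair of strict partitions with law $$\mathbb P_q^{X,Y}(\mu,\lambda)=\frac{Q_\mu(qX)Q_{\lambda/\mu}(X)P_\lambda(Y)}{\mathsf H(qX;Y)\mathsf H(X;Y)}\quad\text{if }\mu\subseteq\lambda$$ and $0$ otherwise, and let $$\mathfrak X(\mu,\lambda)=\{(k,1):k\in\mu\}\cup\{(k,2):k\in\lambda\}\subset\mathbb Z_{>0}\times\{1,2\},$$ where $k\in\mu$ means that $k$ is a part of $\mu$. Let $S=\{(x_1,t_1),\dots,(x_n,t_n)\}\subset\mathbb Z_{>0}\times\{1,2\}$ be a set of $n$ points and $\rho(S)=\mathbb P_q^{X,Y}\{S\subseteq\mathfrak X(\mu,\lambda)\}$. Define a $2n\times2n$ skew-symmetric matrix $M_S$ by specifying the entries above the diagonal: $$(M_S)_{ij}=\begin{cases}K_{x_i,x_j}(t_i,t_j),&1\le i<j\le n,\\ (-1)^{x_{2n-j+1}}K_{x_i,-x_{2n-j+1}}(t_i,t_{2n-j+1}),&1\le i\le n<j\le2n,\\ (-1)^{x_{2n-i+1}+x_{2n-j+1}}K_{-x_{2n-i+1},-x_{2n-j+1}}(t_{2n-i+1},t_{2n-j+1}),&n<i<j\le2n.\end{cases}$$ Here, for $a,b\in\{1,2\}$ and $u,v\in\mathbb Z$, $K_{u,v}(a,b)$ is the coefficient of $z^uw^v$ in $$\frac{z-w}{2(z+w)}J_a(z)J_b(w),$$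 expanded in the region $|z|>|w|$ if $a\ge b$ and $|z|<|w|$ if $a<b$, with $$J_1(z)=F_Y(z)F_{qX}(z^{-1}),\qquad J_2(z)=F_Y(z)F_{qX}(z^{-1})F_X(z^{-1}).$$ Then $$\rho(S)=\operatorname{Pf}(M_S).$$
   Context: A strict partition is a partition with distinct positive parts. $\mu\subseteq\lambda$ means $\mu_i\le\lambda_i$ for all $i$ after appending zeros. For an alphabet $A$, $p_n(A)$ is the $n$-th power sum and $F_A(z)=\prod_{a\in A}\frac{1+az}{1-az}=\exp\big(2\sum_{n\ge1,\ n\text{ odd}}\frac{p_n(A)}{n}z^n\big)$. $A+B$ denotes the union of alphabets, so $p_n(A+B)=p_n(A)+p_n(B)$; $qX$ is the alphabet of the $qx$, $x\in X$. Schur $Q$- and $P$-functions are the standard ones (Macdonald, Ch. III.8): with $\sum_{r\ge0}q_r(A)z^r=F_A(z)$, one has $Q_{(r)}=q_r$, $Q_{(r,s)}=q_rq_s+2\sum_{i\ge1}(-1)^iq_{r+i}q_{s-i}$ for $r>s\ge0$, and $Q_\lambda$ is the Pfaffian of the skew-symmetric matrix with upper entries $Q_{(\lambda_i,\lambda_j)}$, $i<j$ (a zero part is appended to $\lambda$ if its length is odd); $P_\lambda=2^{-\ell(\lambda)}Q_\lambda$, where $\ell(\lambda)$ is the number of parts. Skew $Q$-functions are determined by $Q_\lambda(A+B)=\sum_{\mu\subseteq\lambda}Q_{\lambda/\mu}(A)Q_\mu(B)$. $\mathsf H(A;B)=\exp\Big(2\sum_{n\ge1,\ n\text{ odd}}\frac{p_n(A)p_n(B)}{n}\Big)$,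 which for finite alphabets equals $\prod_{a\in A,b\in B}\frac{1+ab}{1-ab}$. In the definition of $K_{u,v}(a,b)$, each $J_a$ is expanded as a Laurent series in an annulus where $F_Y(z)$ is expanded in nonnegative powers of $z$ and $F_{qX}(z^{-1})$, $F_X(z^{-1})$ in nonpositive powers of $z$ (i.e. $\max\{1,q\}\max X<|z|<1/\max Y$), and similarly in $w$. $\operatorname{Pf}$ denotes the Pfaffian of a skew-symmetric matrix.
   Formalization: The formal statement uses F_{qX}(-z^{-1}) and F_X(-z^{-1}) in J_1, J_2 in place of F_{qX}(z^{-1}) and F_X(z^{-1}); as printed the formula fails, e.g. q=0, X={x}, Y={y}, 0<xy<1, S={(1,2)} gives a negative Pfaffian. *)

(* Defs.v *)
From HB Require Import structures.
From mathcomp Require Import all_boot all_order all_algebra all_fingroup.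
From mathcomp Require Import all_classical all_reals all_analysis.

Set Implicit Arguments.
Unset Strict Implicit.
Unset Printing Implicit Defensive.

Import Order.TTheory GRing.Theory Num.Theory.

Local Open Scope classical_set_scope.
Local Open Scope ring_scope.

(* Pfaffian of a matrix of even order n.*2 over a field of characteristic 0:
   Pf M = 1 / (2^n n!) * sum over permutations s of
          sgn(s) * prod_(i < n) M (s (2i)) (s (2i+1)), indices starting at 0. *)

Lemma ltn_even n (i : 'I_n) : (i.*2 < n.*2)%N.
Proof. by rewrite ltn_double. Qed.

Lemma ltn_odd n (i : 'I_n) : (i.*2.+1 < n.*2)%N.
Proof. by rewrite ltn_Sdouble. Qed.

Definition pfaffian (R : numFieldType) (n : nat) (M : 'M[R]_(n.*2)) : R :=
  ((2 ^ n * n`!)%N%:R)^-1 *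
  \sum_(s : 'S_(n.*2)) (-1) ^+ s *
    \prod_(i < n) M (s (Ordinal (ltn_even i))) (s (Ordinal (ltn_odd i))).

Definition skew_mx (R : numFieldType) (m : nat) (E : nat -> nat -> R) :
    'M[R]_m :=
  \matrix_(i, j) (if (i < j)%N then E i j else
                  if (j < i)%N then - E j i else 0).

Definition strict_partition (s : seq nat) : bool :=
  sorted gtn s && (0%N \notin s).

Definition part_sub (mu lam : seq nat) : Prop :=
  forall i : nat, (nth 0 mu i <= nth 0 lam i)%N.

Section SchurQ.
Variable R : realType.
Implicit Types (A B : seq R) (lam mu : seq nat).

(* Formal power series are represented by their coefficients. *)
Definition ps_mul (f g : nat -> R) (n : nat) : R :=
  \sum_(k < n.+1) f k * g (n - k)%N.

(* coefficients of (1 + a z) / (1 - a z) = (1 + a z) * sum_n a^n z^n *)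
Definition F_factor (a : R) : nat -> R :=
  ps_mul (fun n => (1 + a *: 'X : {poly R})`_n) (fun n => a ^+ n).

(* q_r(A), the coefficient of z^r in F_A(z) *)
Definition qfun A : nat -> R :=
  foldr (fun a f => ps_mul (F_factor a) f) (fun n => (n == 0%N)%:R) A.

(* Since q_(s-i) = 0 for i > s, the sum stops at i = s.  For s = 0 this is
   q_r. *)
Definition schurQ2 A (r s : nat) : R :=
  qfun A r * qfun A s +
  2 * \sum_(1 <= i < s.+1) (-1) ^+ i * qfun A (r + i) * qfun A (s - i).

(* The default value 0 of nth appends the zero part when the length is odd. *)
Definition schurQ lam A : R :=
  pfaffian (skew_mx (uphalf (size lam)).*2
    (fun i j => schurQ2 A (nth 0%N lam i) (nth 0%N lam j))).

Definition schurP lam A : R := (2 ^+ size lam)^-1 * schurQ lam A.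

(* Q_{lam/mu}(A), mu <= lam, are the coefficients c_mu such that
   Q_lam(A + B) = sum_(mu <= lam) c_mu Q_mu(B) for every alphabet B.  They are
   unique, because the functions Q_mu of B are linearly independent; for other
   mu the value is irrelevant. *)
Definition skewQ lam mu A : R :=
  xget (fun=> 0) [set c : seq nat -> R | forall B,
    schurQ lam (A ++ B) =
    \sum_(nu \in [set nu | strict_partition nu /\ part_sub nu lam])
      c nu * schurQ nu B] mu.

Definition scale_alphabet (q : R) A : seq R := [seq q * x | x <- A].

Definition Hprod A B : R :=
  \prod_(a <- A) \prod_(b <- B) ((1 + a * b) / (1 - a * b)).

Definition pair_law (q : R) (X Y : seq R) (mu lam : seq nat) : R :=
  if `[< part_sub mu lam >] then
    schurQ mu (scale_alphabet q X) * skewQ lam mu X * schurP lam Y /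
    (Hprod (scale_alphabet q X) Y * Hprod X Y)
  else 0.

Definition pair_prob (q : R) (X Y : seq R) (E : set (seq nat * seq nat)) :
    \bar R :=
  \esum_(p in [set p | strict_partition p.1 /\ strict_partition p.2] `&` E)
    (pair_law q X Y p.1 p.2)%:E.

Definition config mu lam : set (nat * nat) :=
  [set (k, 1%N) | k in [set` mu]] `|` [set (k, 2%N) | k in [set` lam]].

Definition rho (q : R) (X Y : seq R) (S : seq (nat * nat)) : \bar R :=
  pair_prob q X Y [set p | [set` S] `<=` config p.1 p.2].

(* Sum of an absolutely summable family of real numbers. *)
Definition abs_sum (T : choiceType) (f : T -> R) : R :=
  fine (\esum_(i in [set: T]) (EFin \o f)^\+ i)%E -
  fine (\esum_(i in [set: T]) (EFin \o f)^\- i)%E.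

(* Laurent series in z, resp. in z and w, are represented by their
   coefficients; products are convolutions, which is multiplication of the
   sums in any common region of absolute convergence. *)
Definition laurent_mul (f g : int -> R) (u : int) : R :=
  abs_sum (fun k : int => f k * g (u - k)).

Definition laurent2_mul (f g : int -> int -> R) (u v : int) : R :=
  abs_sum (fun m : int * int => f m.1 m.2 * g (u - m.1) (v - m.2)).

(* f(z) and f(z^-1) for a power series f *)
Definition laurent_pos (f : nat -> R) (u : int) : R :=
  if u is Posz n then f n else 0.

Definition laurent_neg (f : nat -> R) (u : int) : R := laurent_pos f (- u).

(* f(- z) for a power series f *)
Definition ps_opp (f : nat -> R) (n : nat) : R := (-1) ^+ n * f n.

(* J_1(z) = F_Y(z) F_{qX}(-z^-1) and J_2(z) = J_1(z) F_X(-z^-1).  The sign in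
   -z^-1 (that is, F(z^-1)^-1 in place of F(z^-1)) is needed: with F(z^-1) the
   Pfaffian is the correlation of the signed weights obtained from X -> -X.
   For instance, for q = 0, X = {x}, Y = {y} and c = x y, the probability that
   1 is a part of lambda is 2 c (1 - c) / (1 + c), while the Pfaffian would be
   - 2 c (1 + c) / (1 - c). *)
Definition J1 (q : R) (X Y : seq R) : int -> R :=
  laurent_mul (laurent_pos (qfun Y))
    (laurent_neg (ps_opp (qfun (scale_alphabet q X)))).

Definition J2 (q : R) (X Y : seq R) : int -> R :=
  laurent_mul (J1 q X Y) (laurent_neg (ps_opp (qfun X))).

Definition J (q : R) (X Y : seq R) (a : nat) : int -> R :=
  if a == 1%N then J1 q X Y else J2 q X Y.

(* Expansion of 1 / (z + w): sum_(k >= 0) (-1)^k z^(-1-k) w^k if |z| > |w|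
   (zbig = true), and the same with z and w exchanged if |z| < |w|. *)
Definition inv_add_gt (m n : int) : R :=
  if n is Posz k then (if m == - 1 - k%:Z then (-1) ^+ k else 0) else 0.

Definition inv_add (zbig : bool) (m n : int) : R :=
  if zbig then inv_add_gt m n else inv_add_gt n m.

(* expansion of (z - w) / (2 (z + w)) *)
Definition kernel_factor (zbig : bool) (m n : int) : R :=
  (inv_add zbig (m - 1) n - inv_add zbig m (n - 1)) / 2.

(* K_{u,v}(a,b) *)
Definition corrK (q : R) (X Y : seq R) (a b : nat) (u v : int) : R :=
  laurent2_mul (kernel_factor (b <= a)%N)
    (fun m n => J q X Y a m * J q X Y b n) u v.

(* M_S, with rows and columns numbered from 0: the index 2n - j + 1 of the
   points becomes n.*2 - j - 1. *)
Definition corr_mx (q : R) (X Y : seq R) (n : nat) (S : n.-tuple (nat * nat)) :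
    'M[R]_(n.*2) :=
  let x i := (nth (0, 0)%N S i).1 in
  let t i := (nth (0, 0)%N S i).2 in
  let r j := (n.*2 - j - 1)%N in
  skew_mx n.*2 (fun i j =>
    if (j < n)%N then corrK q X Y (t i) (t j) (x i)%:Z (x j)%:Z
    else if (i < n)%N then
      (-1) ^+ x (r j) * corrK q X Y (t i) (t (r j)) (x i)%:Z (- (x (r j))%:Z)
    else
      (-1) ^+ (x (r i) + x (r j)) *
      corrK q X Y (t (r i)) (t (r j)) (- (x (r i))%:Z) (- (x (r j))%:Z)).

End SchurQ.

(* Main.v *)
Require Import Defs.
From HB Require Import structures.
From mathcomp Require Import all_boot all_order all_algebra all_fingroup.
From mathcomp Require Import all_classical all_reals all_analysis.
From mathcomp Require Import ring lra zify.

Set Implicit Arguments.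
Unset Strict Implicit.
Unset Printing Implicit Defensive.

Import Order.TTheory GRing.Theory Num.Theory.
Import numFieldNormedType.Exports.

Local Open Scope classical_set_scope.
Local Open Scope ring_scope.

(** The proof works in the neutral-fermion Fock space, whose basis is indexed
    by strict partitions; a vector is the function f of its coordinates.  On
    it act the modes Psi u (u an integer) of a field Psi(z) = sum_u Psi_u z^u.
    Up to a factor, Psi u creates the part u if u > 0 and removes the part
    - u if u < 0, and the modes satisfy the Clifford relations (clifford).
    A second family of operators, Gamma a, adds one variable a to the alphabet
    of a Schur function.  It is defined by a recursion on the first part,
    which is what is needed to prove
      (1 + a / z) Psi(z) Gamma_a = Gamma_a (1 - a / z) Psi(z)   (Gamma_mix).

    Write Gamma_A for the product of the Gamma_a, a in A, vac for the
    indicator of the empty partition, and <g, f> for the sum over strict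
    partitions of 2^-length * g * f.  Then Q_lambda(A) is the coordinate
    lambda of Gamma_A vac (schurQ_Gammas), and Q_(lambda/mu)(A) is the
    coordinate lambda of Gamma_A applied to the indicator of mu
    (skewQ_Gammas).  The factor 2^-length turns Q_lambda(Y) into
    P_lambda(Y), so that, with Z the normalizing constant,
      rho(S) = Z^-1 <Gamma_Y vac, 1_2 Gamma_X 1_1 Gamma_qX vac>,
    where 1_t restricts a vector to the partitions that contain the parts
    prescribed by S at time t (rho_pairing).  By the Clifford relations 1_t
    is, up to a constant, the product
    Psi_x1 .. Psi_xk Psi_(-xk) .. Psi_(-x1) (word_nested_ints).  This makes
    rho(S) a vacuum expectation of fields and operators Gamma.

    Such an expectation is computed by moving every Gamma_a to the left, out
    of the expectation.  A field that it crosses has its generating series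
    multiplied by (1 - a / z) / (1 + a / z) = F_a(- 1 / z); when Gamma_a
    reaches Gamma_Y vac, it is replaced by the number
    prod_(y in Y) (1 + a y) / (1 - a y) (Cauchy).  These numbers multiply
    to Z, and the factors acquired by the fields are those of J_1 and J_2.
    What remains is the expectation of a product of fields only, a Pfaffian by
    the Wick formula (wick_Q).

    Crossing a field is an identity between generating series: on modes it
    reads x_w + a x_(w+1) = y_w - a y_(w+1), with the unknown x and the known
    y.  The Pfaffian satisfies the same recursion, because it is linear in
    each of its points (pfl_slot).  The difference of the two sides is a
    solution of the homogeneous recursion that a growth bound forces to vanish
    (rec_decay).  The growth bounds come from the classes (tame t) of vectors
    bounded by a multiple of t^|lambda| c^length, where the alphabets of the
    operators are below t1 < t2, and Y is below r with r t2 < 1.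

    Finally K_(u,v)(a,b) is antisymmetric under the exchange of its points
    when a <> b or u + v <> 0.  In M_S the two modes x and - x of a point are
    nested inside those of the preceding points.  Such a pair of modes can be
    moved past the modes of another point without changing the Pfaffian, which
    sorts the points by decreasing time (nested_sort). *)

(** * Pfaffians of lists *)

Section PfaffianOfList.
Variables (R : comNzRingType) (T : Type).
Implicit Types (K : T -> T -> R) (F : seq T -> R) (s t : seq T) (x y : T).

(** sum_j (-1)^j K x s_j F (s without s_j): the expansion of a Pfaffian along
    the row x, as a recursion that needs no indices. *)
Fixpoint contract K x F s : R :=
  if s is y :: t then K x y * F t - contract K x (fun m => F (y :: m)) t else 0.

(** The Pfaffian of the skew-symmetric matrix whose entry (i, j), i < j, is
    K s_i s_j, for a list s of length 2 n.  Only the entries above the diagonal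
    are read, so K itself may be any function. *)
Fixpoint pfl K (n : nat) s : R :=
  match n, s with
  | 0, [::] => 1
  | n'.+1, x :: t => contract K x (pfl K n') t
  | _, _ => 0
  end.

Lemma contract_lin K x (a b : R) F F' s :
  contract K x (fun m => a * F m + b * F' m) s =
  a * contract K x F s + b * contract K x F' s.
Proof.
elim: s F F' => [|y t IH] F F' /=; first by rewrite !mulr0 addr0.
by rewrite (IH (fun m => F (y :: m)) (fun m => F' (y :: m))); ring.
Qed.

Lemma contractN K x F s :
  contract K x (fun m => - F m) s = - contract K x F s.
Proof.
elim: s F => [|y t IH] F /=; first by rewrite oppr0.
by rewrite (IH (fun m => F (y :: m))); ring.
Qed.

Lemma contract0 K x s : contract K x (fun=> 0) s = 0.
Proof. by elim: s => [|y t IH] //=; rewrite IH mulr0 subr0. Qed.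

(** In a double expansion along x and y the order of the two rows only
    matters for the sign. *)
Lemma contract_anti K x y F s :
  contract K x (contract K y F) s = - contract K y (contract K x F) s.
Proof.
elim: s F => [|z t IH] F /=; first by rewrite oppr0.
have := contract_lin K x (K y z) (-1) F (contract K y (fun m => F (z :: m))) t.
have := contract_lin K y (K x z) (-1) F (contract K x (fun m => F (z :: m))) t.
under [in contract K y (fun _ => _) t = _]eq_fun do rewrite mulN1r.
under [in contract K x (fun _ => _) t = _]eq_fun do rewrite mulN1r.
move=> -> ->; rewrite (IH (fun m => F (z :: m))); ring.
Qed.

Definition swap_anti F x y := forall s1 s2,
  F (s1 ++ x :: y :: s2) = - F (s1 ++ y :: x :: s2).

Lemma contract_swap K z F x y : swap_anti F x y -> swap_anti (contract K z F) x y.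
Proof.
move=> HF s1; elim: s1 F HF => [|w s1 IH] F HF s2 /=.
  rewrite [X in _ - (_ - X)](_ : _ = - contract K z (fun m => F (y :: x :: m)) s2).
    ring.
  by rewrite -contractN; congr contract; apply: funext => m; rewrite (HF [::]).
rewrite HF (IH (fun m => F (w :: m))); first by ring.
by move=> t1 t2; rewrite (HF (w :: t1)).
Qed.

Lemma pfl_swap K n x y : K x y = - K y x -> swap_anti (pfl K n) x y.
Proof.
move=> Kxy; elim: n => [|n IH] [|z s1] s2 /=; rewrite ?oppr0 //.
  rewrite Kxy; case: n {IH} => [|n] /=; first by rewrite !contract0; ring.
  by rewrite (contract_anti K x y); ring.
exact: contract_swap.
Qed.

Lemma pfl_move K n x s1 s2 s3 :
  (forall y, List.In y s2 -> K x y = - K y x) ->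
  pfl K n (s1 ++ x :: s2 ++ s3) = (-1) ^+ size s2 * pfl K n (s1 ++ s2 ++ x :: s3).
Proof.
elim: s2 s1 => [|y s2 IH] s1 Hs /=; first by rewrite expr0 mul1r.
rewrite pfl_swap; last by apply: Hs; left.
rewrite exprS mulN1r mulNr; congr (- _).
by rewrite -cat_rcons IH ?cat_rcons // => z Hz; apply: Hs; right.
Qed.

(** A function of lists that is linear in one slot inherits, as a function of
    that slot, every linear property that the kernel has. *)
Section Slot.
Variables (L : (T -> R) -> Prop).
Hypothesis L0 : L (fun=> 0).
Hypothesis Llin : forall a b f g, L f -> L g -> L (fun k => a * f k + b * g k).

Lemma contract_slot0 (K : T -> T -> R) (Q : pred T) x (F : T -> seq T -> R) s :
  all Q s -> (forall t, all Q t -> L (F^~ t)) -> L (fun k => contract K x (F k) s).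
Proof.
elim: s F => [|y t IH] F //= /andP[Qy Qt] HF.
have := Llin (K x y) (-1) (HF _ Qt) (IH (fun k m => F k (y :: m)) Qt _).
under eq_fun do rewrite mulN1r.
by apply => t' Qt'; apply: HF => /=; rewrite Qy.
Qed.

Lemma contract_slot (K : T -> T -> R) (P Q : pred T) x F s1 s2 :
  all P s1 -> all Q s2 -> L (K x) ->
  (forall t1 t2, all P t1 -> all Q t2 -> L (fun k => F (t1 ++ k :: t2))) ->
  L (fun k => contract K x F (s1 ++ k :: s2)).
Proof.
move=> Ps1 Qs2 LK; elim: s1 F Ps1 => [|y s1 IH] F /= Ps1 HF.
  have HL : L (fun k => contract K x (fun m => F (k :: m)) s2).
    apply: (contract_slot0 K x (F := fun k m => F (k :: m)) Qs2) => t Qt.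
    exact: (HF [::]).
  have := Llin (F s2) (-1) LK HL.
  by under eq_fun do rewrite mulN1r mulrC.
case/andP: Ps1 => Py Ps1.
have := Llin (K x y) (-1) (HF _ _ Ps1 Qs2) (IH (fun m => F (y :: m)) Ps1 _).
under eq_fun do rewrite mulN1r.
by apply => t1 t2 Pt1 Qt2; apply: (HF (y :: t1)) => //=; rewrite Py.
Qed.

(** The expansion along the first row reaches the slot k either as the row
    itself or as one of the columns, whence the two kinds of hypotheses. *)
Lemma pfl_slot (K : T -> T -> R) (P Q : pred T) n s1 s2 :
  (forall y, P y -> L (K y)) -> (forall y, Q y -> L (K^~ y)) ->
  all P s1 -> all Q s2 -> L (fun k => pfl K n (s1 ++ k :: s2)).
Proof.
move=> LP LQ; elim: n s1 s2 => [|n IH] [|x s1] s2 //= Ps1 Qs2.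
  elim: s2 Qs2 (pfl K n) {IH} => [|y s2 IH] //= /andP[Qy Qs2] F.
  have := Llin (F s2) (-1) (LQ _ Qy) (IH Qs2 (fun m => F (y :: m))).
  by under eq_fun do rewrite mulN1r mulrC.
case/andP: Ps1 => Px Ps1; apply: (contract_slot Ps1 Qs2) => //.
exact: LP.
Qed.

End Slot.

Lemma contractZl K (c : R) x F s :
  contract (fun x y => c * K x y) x F s = c * contract K x F s.
Proof. by elim: s F => [|y t IH] F /=; rewrite ?mulr0 // IH; ring. Qed.

Lemma pfl_scale K (c : R) n s :
  pfl (fun x y => c * K x y) n s = c ^+ n * pfl K n s.
Proof.
elim: n s => [|n IH] [|x s] //=; rewrite ?expr0 ?mul1r ?mulr0 //.
rewrite contractZl (_ : pfl _ n = fun m => c ^+ n * pfl K n m + 0 * 0); last first.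
  by apply: funext => m; rewrite IH; ring.
rewrite (contract_lin _ _ _ 0 _ (fun=> 0)); by rewrite mul0r addr0 exprS mulrA.
Qed.

(** Every point occurs in exactly one factor of each term. *)
Lemma pfl_conj K (c : T -> R) n s :
  pfl (fun x y => c x * c y * K x y) n s = \prod_(x <- s) c x * pfl K n s.
Proof.
have H x (F F' : seq T -> R) t : (forall m, F m = \prod_(y <- m) c y * F' m) ->
    contract (fun x y => c x * c y * K x y) x F t =
    c x * \prod_(y <- t) c y * contract K x F' t.
  elim: t F F' => [|y t IH] F F' HF /=; first by rewrite !mulr0.
  rewrite (IH _ (fun m => c y * F' (y :: m))) => [|m]; last first.
    by rewrite HF big_cons; ring.
  have -> : contract K x (fun m => c y * F' (y :: m)) t =
      c y * contract K x (fun m => F' (y :: m)) t.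
    have := contract_lin K x (c y) 0 (fun m => F' (y :: m)) (fun=> 0) t.
    by rewrite !mul0r !addr0 => <-; congr contract; apply: funext => m; ring.
  by rewrite HF big_cons; ring.
elim: n s => [|n IH] [|x s] //=; rewrite ?big_nil ?mul1r ?mulr0 //.
by rewrite (H _ _ _ _ IH) big_cons.
Qed.

End PfaffianOfList.

Lemma pfl_map (R : comNzRingType) (T T' : Type) (h : T' -> T) (K : T -> T -> R) n s :
  pfl K n (map h s) = pfl (fun x y => K (h x) (h y)) n s.
Proof.
have H x (F : seq T -> R) t :
    contract K (h x) F (map h t) =
    contract (fun x y => K (h x) (h y)) x (fun m => F (map h m)) t.
  by elim: t F => //= y t IH F; rewrite IH.
elim: n s => [|n IH] [|x s] //=; rewrite H; congr contract.
exact: funext.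
Qed.

(** Only the pairs that occur in the order of the list matter, which allows K
    to be replaced by a kernel that agrees with it for ordered times only. *)
Lemma eq_pfl (R : comNzRingType) (T : eqType) (K K' : T -> T -> R) (r : rel T) n s :
  (forall x y, r x y -> K x y = K' x y) -> pairwise r s ->
  pfl K n s = pfl K' n s.
Proof.
move=> HK.
have H x (F F' : seq T -> R) t : all (r x) t ->
    (forall m, subseq m t -> F m = F' m) -> contract K x F t = contract K' x F' t.
  elim: t F F' => [|y t IH] F F' //= /andP[rxy rxt] HF.
  have Kxy := HK _ _ rxy; have Ft := HF _ (subseq_cons t y).
  rewrite Kxy Ft; congr (_ + - _).
  by apply: IH => // m mt; apply: HF; rewrite /= eqxx.
elim: n s => [|n IH] [|x s] //=; case/andP=> rs ps.
by apply: H => // m ms; apply: IH; apply: subseq_pairwise ps.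
Qed.

Lemma eq_contract_size (R : comNzRingType) (T : Type) (K K' : T -> T -> R) x
    (F F' : seq T -> R) k s :
  K x =1 K' x -> (forall m, size m = k -> F m = F' m) -> size s = k.+1 ->
  contract K x F s = contract K' x F' s.
Proof.
move=> KK; elim: s k F F' => // y t IH k F F' FF [szt] /=.
rewrite KK FF //; case: k szt FF => [|k] szt FF.
  by move/size0nil: szt => ->; rewrite /= !subr0.
by congr (_ - _); apply: (IH k) => // m szm; apply: FF; rewrite /= szm.
Qed.

(** * The Pfaffian of a matrix as a Pfaffian of a list *)

(** The permutations that send i to j are the permutations of the
    complements of i and j. *)
Lemma sum_lift_perm (V : nmodType) n (i j : 'I_n.+1) (F : 'S_n.+1 -> V) :
  \sum_(s : 'S_n.+1 | s i == j) F s = \sum_(s : 'S_n) F (lift_perm i j s).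
Proof.
pose low (s : 'S_n.+1) k := odflt k (unlift j (s (lift i k))).
have lowK (s : 'S_n.+1) k : s i = j -> lift j (low s k) = s (lift i k).
  move=> sij; rewrite /low; case: unliftP => //= e.
  by have := neq_lift i k; rewrite -(inj_eq (@perm_inj _ s)) sij e eqxx.
have low_inj (s : 'S_n.+1) : s i = j -> injective (low s).
  by move=> sij k l /(congr1 (lift j)); rewrite !lowK // => /perm_inj /lift_inj.
pose low_perm (s : 'S_n.+1) : 'S_n :=
  if s i =P j is ReflectT e then perm (low_inj s e) else 1%g.
rewrite (reindex (lift_perm i j)) /=; last first.
  exists low_perm => [s _ | s /eqP sij].
    rewrite /low_perm; case: eqP => [e|]; last by rewrite lift_perm_id.
    by apply/permP => k; rewrite permE /low lift_perm_lift liftK.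
  rewrite /low_perm; case: eqP => // e; apply/permP => k.
  case: (unliftP i k) => [k'|] ->; rewrite ?lift_perm_id //.
  by rewrite lift_perm_lift permE lowK.
by apply: eq_bigl => s; rewrite lift_perm_id eqxx.
Qed.

Section PfaffianRow.
Variable R : numFieldType.

Definition pf_term n (M : 'M[R]_(n.*2)) (s : 'S_(n.*2)) : R :=
  (-1) ^+ s * \prod_(i < n) M (s (Ordinal (ltn_even i))) (s (Ordinal (ltn_odd i))).

Lemma pf_term_flip n (M : 'M[R]_(n.+1.*2)) (s : 'S_(n.+1.*2)) :
  (forall i j, M i j = - M j i) ->
  pf_term M (tperm (Ordinal (ltn_even (ord0 : 'I_n.+1)))
                   (Ordinal (ltn_odd (ord0 : 'I_n.+1))) * s)%g = pf_term M s.
Proof.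
move=> skewM; rewrite /pf_term odd_permM odd_tperm signr_addb.
rewrite !big_ord_recl !permM tpermL tpermR /= skewM expr1.
under eq_bigr do rewrite !permM !tpermD //.
by rewrite mulN1r !mulNr mulrN opprK.
Qed.

(** Permuting the pairs of positions is an even operation, because each pair
    moves as a whole. *)
Lemma pf_term_pair n (M : 'M[R]_(n.*2)) (s : 'S_(n.*2)) (i j : 'I_n) :
  i != j ->
  pf_term M (tperm (Ordinal (ltn_even i)) (Ordinal (ltn_even j)) *
             (tperm (Ordinal (ltn_odd i)) (Ordinal (ltn_odd j)) * s))%g
  = pf_term M s.
Proof.
move=> neq_ij.
have neq_eo (k l : 'I_n) : Ordinal (ltn_even k) == Ordinal (ltn_odd l) = false.
  by apply/negbTE; rewrite -val_eqE /=; lia.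
have eq_ee (k l : 'I_n) : (Ordinal (ltn_even k) == Ordinal (ltn_even l)) = (k == l).
  by rewrite -!val_eqE /=; apply/eqP/eqP; lia.
have eq_oo (k l : 'I_n) : (Ordinal (ltn_odd k) == Ordinal (ltn_odd l)) = (k == l).
  by rewrite -!val_eqE /=; apply/eqP/eqP; lia.
rewrite /pf_term !odd_permM !odd_tperm eq_ee eq_oo neq_ij addbA addbb.
congr (_ * _); rewrite [RHS](reindex_inj (@perm_inj _ (tperm i j))) /=.
have step (k : 'I_n) :
    tperm (Ordinal (ltn_even i)) (Ordinal (ltn_even j)) (Ordinal (ltn_even k)) =
    Ordinal (ltn_even (tperm i j k)).
  by rewrite -(inj_tperm _ _ _ (f := fun k => Ordinal (ltn_even k))) // => a b /eqP;
     rewrite eq_ee => /eqP.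
have stepo (k : 'I_n) :
    tperm (Ordinal (ltn_odd i)) (Ordinal (ltn_odd j)) (Ordinal (ltn_odd k)) =
    Ordinal (ltn_odd (tperm i j k)).
  by rewrite -(inj_tperm _ _ _ (f := fun k => Ordinal (ltn_odd k))) // => a b /eqP;
     rewrite eq_oo => /eqP.
apply: eq_bigr => k _; rewrite !permM step.
rewrite [tperm (Ordinal (ltn_even i)) _ _]tpermD ?stepo; last 2 first.
- by rewrite neq_eo.
- by rewrite neq_eo.
by rewrite [tperm (Ordinal (ltn_odd i)) _ (Ordinal (ltn_even _))]tpermD //
  eq_sym neq_eo.
Qed.

(** By the two invariances above, the index 0 contributes the same sum from
    each of the positions that it can occupy. *)
Lemma pf_sum_position n (M : 'M[R]_(n.+1.*2)) :
  (forall i j, M i j = - M j i) ->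
  \sum_s pf_term M s =
  (n.+1.*2)%:R * \sum_(s : 'S_(n.+1.*2) | s ord0 == ord0) pf_term M s.
Proof.
move=> skewM.
have pos (k : 'I_n.+1.*2) : exists t : 'S_(n.+1.*2), t k = ord0 /\
    forall s, pf_term M (t * s)%g = pf_term M s.
  pose e0 := Ordinal (ltn_even (ord0 : 'I_n.+1)).
  pose o0 := Ordinal (ltn_odd (ord0 : 'I_n.+1)).
  have e0E : e0 = ord0 by apply: val_inj.
  have half_lt : (k./2 < n.+1)%N by have := ltn_ord k; lia.
  pose i := Ordinal half_lt.
  have even_pos : exists t : 'S_(n.+1.*2), t (Ordinal (ltn_even i)) = e0 /\
      t (Ordinal (ltn_odd i)) = o0 /\
      forall s, pf_term M (t * s)%g = pf_term M s.
    have [i0|i0] := eqVneq i ord0.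
      exists 1%g; rewrite i0 !perm1; split=> //; split=> // s.
      by rewrite mul1g.
    exists (tperm (Ordinal (ltn_even i)) e0 * tperm (Ordinal (ltn_odd i)) o0)%g.
    split; last split; last by move=> s; rewrite -mulgA pf_term_pair.
      by rewrite permM tpermL tpermD.
    rewrite permM [tperm _ e0 _]tpermD ?tpermL //.
    by apply/eqP => /(congr1 val) /=; lia.
  case: even_pos => t [te [to tM]].
  have [odd_k|even_k] := boolP (odd k).
    exists (t * tperm e0 o0)%g; split; last first.
      by move=> s; rewrite -mulgA tM pf_term_flip.
    rewrite permM (_ : k = Ordinal (ltn_odd i)) ?to ?tpermR -?e0E //.
    by apply: val_inj => /=; lia.
  exists t; split=> //; rewrite -e0E -te; congr (t _).
  by apply: val_inj => /=; lia.
rewrite (partition_big (fun s : 'S_(n.+1.*2) => (s^-1 ord0)%g) predT) //=.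
rewrite (eq_bigr (fun=> \sum_(s : 'S_(n.+1.*2) | s ord0 == ord0) pf_term M s)).
  by rewrite sumr_const card_ord mulr_natl.
move=> k _; have [t [tk tM]] := pos k.
rewrite (reindex_inj (mulgI t)) /=; apply: eq_big => [s|s _]; last exact: tM.
by rewrite -(inj_eq (@perm_inj _ (t * s)%g)) permKV permM tk eq_sym.
Qed.

Definition minor0 n (M : 'M[R]_(n.+1.*2)) (j : 'I_n.*2.+1) : 'M[R]_(n.*2) :=
  \matrix_(a, b) M (lift ord0 (lift j a)) (lift ord0 (lift j b)).

(** The partner of the index 0 chooses the column, and the permutation of the
    remaining indices is one of the minor. *)
Lemma pf_sum_row n (M : 'M[R]_(n.+1.*2)) :
  \sum_(s : 'S_(n.+1.*2) | s ord0 == ord0) pf_term M s =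
  \sum_(j < n.*2.+1) (-1) ^+ j * M ord0 (lift ord0 j) *
     \sum_s pf_term (minor0 M j) s.
Proof.
rewrite (sum_lift_perm ord0 ord0) /=.
rewrite (partition_big (fun s : 'S_(n.*2.+1) => s ord0) predT) //=.
apply: eq_bigr => j _; rewrite (sum_lift_perm ord0 j) mulr_sumr.
apply: eq_bigr => s _; rewrite /pf_term big_ord_recl.
have -> : Ordinal (ltn_even (ord0 : 'I_n.+1)) = ord0 by apply: val_inj.
have -> : Ordinal (ltn_odd (ord0 : 'I_n.+1)) = lift ord0 ord0 by apply: val_inj.
rewrite lift_perm_id !lift_perm_lift lift_perm_id.
rewrite !odd_lift_perm /= signr_addb signr_odd.
rewrite -!mulrA; congr (_ * _); rewrite mulrCA; congr (_ * (_ * _)).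
apply: eq_bigr => i _; rewrite mxE.
have -> : Ordinal (ltn_even (lift ord0 i)) = lift ord0 (lift ord0 (Ordinal (ltn_even i))).
  by apply: val_inj; rewrite /= /bump /=; lia.
have -> : Ordinal (ltn_odd (lift ord0 i)) = lift ord0 (lift ord0 (Ordinal (ltn_odd i))).
  by apply: val_inj; rewrite /= /bump /=; lia.
by rewrite !lift_perm_lift.
Qed.

(** With index 0 in the first position, the factor 2 (n + 1) of
    pf_sum_position is exactly what relates the normalizing constants in sizes
    n + 1 and n. *)
Lemma pfaffian_row n (M : 'M[R]_(n.+1.*2)) :
  (forall i j, M i j = - M j i) ->
  pfaffian M = \sum_(j < n.*2.+1) (-1) ^+ j * M ord0 (lift ord0 j) *
     pfaffian (minor0 M j).
Proof.
move=> skewM; rewrite /pfaffian.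
rewrite -/(\sum_s pf_term M s) pf_sum_position // pf_sum_row.
rewrite mulrA mulr_sumr; apply: eq_bigr => j _.
rewrite [RHS]mulrCA; congr (_ * _).
rewrite expnS factS -muln2 !natrM.
have n0 : (n.+1)%:R != 0 :> R by rewrite pnatr_eq0.
have f0 : (n`!)%:R != 0 :> R by rewrite pnatr_eq0 -lt0n fact_gt0.
have e0 : (2 ^ n)%:R != 0 :> R by rewrite pnatr_eq0 -lt0n expn_gt0.
rewrite !invfM.
have regroup (a b c d e f : R) :
  a * b * (c * d) * (e * f) = b * d * (a * f) * (c * e) by ring.
by rewrite regroup !mulVf ?pnatr_eq0 // !mulr1.
Qed.

Lemma contract_sum (T : Type) (K : T -> T -> R) x F x0 (s : seq T) :
  contract K x F s =
  \sum_(j < size s) (-1) ^+ j * K x (nth x0 s j) * F (take j s ++ drop j.+1 s).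
Proof.
elim: s F => [|y t IH] F /=; first by rewrite big_ord0.
rewrite big_ord_recl /= drop0 IH expr0 mul1r -sumrN; congr (_ + _).
by apply: eq_bigr => j _; rewrite /= exprS mulN1r !mulNr.
Qed.

Theorem pfaffian_pfl (T : Type) (x0 : T) (K : T -> T -> R) n (s : seq T) :
  size s = n.*2 ->
  pfaffian (skew_mx n.*2 (fun i j => K (nth x0 s i) (nth x0 s j))) = pfl K n s.
Proof.
elim: n s => [|n IH] s sz.
  case: s sz => // _ /=; rewrite /pfaffian (big_pred1 1%g) => [|p].
    by rewrite big_ord0 odd_perm1 fact0 expn0 muln1 invr1 !mul1r.
  by apply/esym/eqP/permP; case.
case: s sz => // x t [sz]; rewrite pfaffian_row; last first.
  by move=> i j; rewrite !mxE; case: ltngtP; rewrite ?opprK ?oppr0.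
rewrite /= (contract_sum _ _ _ x0) sz; apply: eq_bigr => j _.
rewrite mxE /=; congr (_ * _ * _); rewrite -IH; last first.
  by rewrite size_cat size_take size_drop sz ltn_ord; have := ltn_ord j; lia.
congr pfaffian; apply/matrixP => a b; rewrite !mxE /=.
have nthE (c : 'I_n.*2) : nth x0 (take j t ++ drop j.+1 t) c = nth x0 t (bump j c).
  rewrite nth_cat size_take sz ltn_ord /bump; case: ltnP => cj.
    by rewrite nth_take.
  by rewrite nth_drop; congr nth; have := ltn_ord j; lia.
rewrite !nthE; have bump0 k : bump 0 k = k.+1 by [].
by rewrite !bump0 !ltnS !ltnNge !leq_bump2.
Qed.

End PfaffianRow.

(** * Strict partitions and Clifford relations *)

(** Strict partitions with all parts below N.  The bound travels with the
    list, so that inductions on the list of parts keep track of where a new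
    part may be inserted. *)
Fixpoint spart (N : nat) (l : seq nat) : bool :=
  if l is x :: t then [&& 0 < x, x < N & spart x t]%N else true.

Lemma spart_cons N x t : spart N (x :: t) = [&& 0 < x, x < N & spart x t]%N.
Proof. by []. Qed.

Lemma spart_le N M l : (N <= M)%N -> spart N l -> spart M l.
Proof. by case: l => //= x t NM /and3P[-> xN ->]; rewrite (leq_trans xN). Qed.

Lemma spart_head N M l : spart N l -> (head 0 l < M)%N -> spart M l.
Proof. by case: l => //= x t /and3P[-> _ ->] ->. Qed.

Lemma spart_strict N l : spart N l -> strict_partition l.
Proof.
rewrite /strict_partition; elim: l N => //= x t IH N /and3P[x0 _ spt].
have /andP[st t0] := IH _ spt; rewrite inE negb_or t0 andbT eq_sym -lt0n x0 andbT.
by case: t st spt {IH t0} => //= y t -> /and3P[_ ->].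
Qed.

Lemma strict_spart l : strict_partition l -> spart (head 0 l).+1 l.
Proof.
rewrite /strict_partition; elim: l => //= x t IH; rewrite inE negb_or eq_sym -lt0n.
case/andP=> pt /andP[x0 t0]; rewrite x0 leqnn /=.
apply: (@spart_head (head 0 t).+1); first by rewrite IH // t0 (path_sorted pt).
by case: t pt {IH t0} => [|y t] /=; [|case/andP].
Qed.

Section Fermions.
Variable R : comNzRingType.
Implicit Types (f g : seq nat -> R) (l m t : seq nat) (u v : int).

(** The action of a mode on a partition without parts larger than |u|. *)
Definition Psi_top u f l : R :=
  match u with
  | Posz 0 => f l
  | Posz k.+1 => if l is x :: t then if x == k.+1 then 2 * f t else 0 else 0
  | Negz k => if head 0 l == k.+1 then 0 else (-1) ^+ k.+1 * f (k.+1 :: l)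
  end.

(** The sign counts the parts larger than |u| that the mode has to pass, as for
    a wedge product.  The factor 2 sits on creation and the sign (-1)^k on
    annihilation, which is the normalization in which the coordinates below
    are Q-functions. *)
Fixpoint Psi u f l : R :=
  if l is x :: t then
    if (`|u| < x)%N then - Psi u (fun m => f (x :: m)) t else Psi_top u f l
  else Psi_top u f l.

Lemma Psi_cons x t u f : (`|u| < x)%N ->
  Psi u f (x :: t) = - Psi u (fun m => f (x :: m)) t.
Proof. by move=> /= ->. Qed.

Lemma Psi_topE u f l : spart `|u|.+1 l -> Psi u f l = Psi_top u f l.
Proof. by case: l => //= x t /and3P[_ xu _]; rewrite ltnNge -ltnS xu. Qed.

Lemma eq_Psi N u f g l : (forall m, spart N m -> f m = g m) -> (`|u| < N)%N ->
  spart N l -> Psi u f l = Psi u g l.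
Proof.
elim: l N f g => [|x t IH] N f g fg uN.
  by case: u uN => [[|k]|k] //= uN _; rewrite fg //= uN.
rewrite spart_cons => /and3P[x0 xN spt]; have [ux|xu] := ltnP `|u| x.
  rewrite !Psi_cons //; congr (- _); apply: (IH x) => // m spm.
  by apply: fg; rewrite /= x0 xN.
have spl : spart `|u|.+1 (x :: t) by rewrite /= x0 ltnS xu.
rewrite !Psi_topE //; case: u {IH} uN xu {spl} => [[|k]|k] /= uN xu.
- by move: x0; move: xu; rewrite leqn0 => /eqP->.
- by case: eqP => // xk; rewrite fg // (spart_le _ spt) // ltnW.
- case: eqP => // xk; rewrite fg // !spart_cons uN x0 spt andbT /=.
  by rewrite ltn_neqAle xu andbT; apply/eqP.
Qed.

Lemma eq_Psi_strict N u f g l : (forall M m, spart M m -> f m = g m) ->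
  spart N l -> Psi u f l = Psi u g l.
Proof.
move=> fg spl; apply: (@eq_Psi (maxn N `|u|.+1)); [exact: fg| | ].
  by rewrite leq_max ltnSn orbT.
by apply: spart_le spl; rewrite leq_maxl.
Qed.

Lemma Psi_lin u (a b : R) f g l :
  Psi u (fun m => a * f m + b * g m) l = a * Psi u f l + b * Psi u g l.
Proof.
have top_lin f' g' l' : Psi_top u (fun m => a * f' m + b * g' m) l' =
    a * Psi_top u f' l' + b * Psi_top u g' l'.
  case: u => [[|k]|k] //=; last by case: ifP => _; ring.
  by case: l' => [|x t]; last case: ifP => _; ring.
elim: l f g => [|x t IH] f g; first exact: top_lin.
rewrite /=; case: ifP => _; last exact: (top_lin f g (x :: t)).
by rewrite (IH (fun m => f (x :: m)) (fun m => g (x :: m))); ring.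
Qed.

Lemma PsiZ u (a : R) f l : Psi u (fun m => a * f m) l = a * Psi u f l.
Proof.
rewrite -[RHS]addr0 -(mul0r (Psi u f l)) -Psi_lin; congr Psi.
by apply: funext => m; ring.
Qed.

Lemma PsiD u f g l : Psi u (fun m => f m + g m) l = Psi u f l + Psi u g l.
Proof.
rewrite -[Psi u f l]mul1r -[Psi u g l]mul1r -Psi_lin; congr Psi.
by apply: funext => m; ring.
Qed.

Lemma PsiN u f l : Psi u (fun m => - f m) l = - Psi u f l.
Proof.
by rewrite -mulN1r -PsiZ; congr Psi; apply: funext => m; rewrite mulN1r.
Qed.

Lemma Psi0 u l : Psi u (fun=> 0) l = 0.
Proof.
rewrite -[RHS](mul0r (Psi u (fun=> 0) l)) -PsiZ; congr Psi; apply: funext => m.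
by rewrite mul0r.
Qed.

(** Modes of different sizes: the smaller one passes the larger part, if it is
    present, at the cost of one sign. *)
Lemma clifford_lt u v f l : (`|u| < `|v|)%N -> spart `|v|.+1 l ->
  Psi u (Psi v f) l + Psi v (Psi u f) l = 0.
Proof.
move=> uv spl; rewrite [Psi v _ _]Psi_topE //.
have [/eqP hl|hl] := boolP (head 0 l == `|v|%N).
  case: l spl hl => [|x t]; first by move=> _ /= v0; exfalso; lia.
  rewrite spart_cons => /and3P[x0 _ spt] /= xv; rewrite -/(Psi u (Psi v f) (x :: t)).
  have ux : (`|u| < x)%N by rewrite xv.
  rewrite Psi_cons //.
  have -> : Psi u (fun m => Psi v f (x :: m)) t =
      Psi u (fun m => if v is Posz _ then 2 * f m else 0) t.
    apply: (eq_Psi (N := x)) => // m spm; rewrite Psi_topE; last first.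
      by rewrite /= xv -{1}xv x0 leqnn -xv.
    by case: v xv {uv} => [[|k]|k] /= xv; rewrite xv ?eqxx // in x0 *.
  case: v xv {uv} => [[|k]|k] /= xv; rewrite ?PsiZ ?Psi0 ?xv ?eqxx ?oppr0 ?addr0 //.
    by rewrite xv in x0.
  by rewrite addNr.
have spl' : spart `|v|%N l.
  apply: (spart_head spl); case: l spl hl => /= [|x t].
    by rewrite lt0n eq_sym.
  by case/and3P=> _; rewrite ltnS ltn_neqAle => -> _ ->.
have -> : Psi u (Psi v f) l =
    Psi u (fun m => if v is Negz k then (-1) ^+ k.+1 * f (k.+1 :: m) else 0) l.
  apply: (eq_Psi (N := `|v|%N)) => // m spm; rewrite Psi_topE; last first.
    by apply: spart_le spm; rewrite leqnSn.
  have hm : (head 0 m == `|v|%N) = false.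
    case: m spm => /= [_|x t]; last by case/and3P=> _ xv _; rewrite ltn_eqF.
    by rewrite eq_sym; apply/negbTE; rewrite -lt0n (leq_trans _ uv).
  clear spl spl' hl spm; case: v hm uv => [[|k]|k] //= hm _; rewrite ?hm //.
  by case: m hm => //= x t ->.
case: v uv hl spl {spl'} => [[|k]|k] // uv hl spl.
  rewrite /= Psi0; case: l hl spl => //= [|x t] hl _; rewrite ?addr0 //.
  by rewrite (negbTE hl) addr0.
rewrite PsiZ /= (negbTE hl) /= -mulrDr.
rewrite -[if _ then _ else _]/(Psi u f (k.+1 :: l)) Psi_cons //.
by rewrite subrr mulr0.
Qed.

Lemma Psi_create_in k f l : Psi k.+1%:Z f (k.+1 :: l) = 2 * f l.
Proof. by rewrite /= ltnn eqxx. Qed.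

Lemma Psi_create_out k f l : spart k.+1 l -> Psi k.+1%:Z f l = 0.
Proof.
move=> spl; rewrite Psi_topE; last exact: spart_le spl.
by case: l spl => //= x t /and3P[_ xk _]; rewrite ltn_eqF.
Qed.

Lemma Psi_kill_in k f l : Psi (Negz k) f (k.+1 :: l) = 0.
Proof. by rewrite /= ltnn eqxx. Qed.

Lemma Psi_kill_out k f l : spart k.+1 l ->
  Psi (Negz k) f l = (-1) ^+ k.+1 * f (k.+1 :: l).
Proof.
move=> spl; rewrite Psi_topE; last exact: spart_le spl.
by case: l spl => //= x t /and3P[_ xk _]; rewrite ltn_eqF.
Qed.

Lemma spart_top k l : spart k.+2 l -> spart k.+1 l \/ exists2 t, l = k.+1 :: t & spart k.+1 t.
Proof.
case: l => [|x t] /=; first by left.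
case/and3P=> x0; rewrite ltnS leq_eqVlt => /orP[/eqP->|xk] spt; first by right; exists t.
by left; rewrite x0 xk.
Qed.

Lemma clifford_eq u v f l : (`|u| = `|v|)%N -> spart `|v|.+1 l ->
  Psi u (Psi v f) l + Psi v (Psi u f) l =
  if u + v == 0 then 2 * (-1) ^+ `|u| * f l else 0.
Proof.
case: u v => [[|j]|j] [[|k]|k] //=.
- move=> _; case: l => [_|x t /and3P[x0]] /=; first by ring.
  by rewrite ltnS leqNgt x0.
- case=> <- /spart_top [spl|[t -> spt]].
    by rewrite !Psi_create_out // addr0.
  by rewrite !Psi_create_in !Psi_create_out //; ring.
- case=> <-; have -> : (Posz j.+1 + Negz j == 0) by apply/eqP; lia.
  move=> /spart_top [spl|[t -> spt]].
    by rewrite Psi_create_out // Psi_kill_out // Psi_create_in exprS; ring.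
  by rewrite Psi_create_in Psi_kill_in Psi_kill_out // exprS; ring.
- case=> <-; have -> : (Negz j + Posz j.+1 == 0) by apply/eqP; lia.
  move=> /spart_top [spl|[t -> spt]].
    by rewrite Psi_create_out // Psi_kill_out // Psi_create_in exprS; ring.
  by rewrite Psi_create_in Psi_kill_in Psi_kill_out // exprS; ring.
- case=> <- /spart_top [spl|[t -> spt]].
    by rewrite !(Psi_kill_out _ spl) !Psi_kill_in; ring.
  by rewrite !Psi_kill_in addr0.
Qed.

(** Both modes pass the parts larger than |u| and |v|, where the two signs
    cancel; the modes act on what is left at the top of the partition. *)
Theorem clifford N u v f l : spart N l ->
  Psi u (Psi v f) l + Psi v (Psi u f) l =
  if u + v == 0 then 2 * (-1) ^+ `|u| * f l else 0.
Proof.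
have top l0 f0 : spart (maxn `|u| `|v|).+1 l0 ->
    Psi u (Psi v f0) l0 + Psi v (Psi u f0) l0 =
    if u + v == 0 then 2 * (-1) ^+ `|u| * f0 l0 else 0.
  case: (ltngtP `|u|%N `|v|%N) => uv spl; last by apply: clifford_eq; rewrite -?uv.
    by rewrite clifford_lt // ifN //; apply/eqP; lia.
  by rewrite addrC clifford_lt // ifN //; apply/eqP; lia.
elim: l N f => [|x t IH] N f spl; first exact: top.
have [|le_max] := ltnP (maxn `|u| `|v|) x; last first.
  by apply: top; move: spl => /= /and3P[-> _ ->]; rewrite ltnS le_max.
rewrite gtn_max => /andP[ux vx]; case/and3P: spl => x0 _ spt.
rewrite !Psi_cons //.
have tail w' : (`|w'| < x)%N ->
    (fun m => Psi w' f (x :: m)) = (fun m => - Psi w' (fun m => f (x :: m)) m).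
  by move=> wx; apply: funext => m; rewrite Psi_cons.
by rewrite !tail // !PsiN !opprK (IH x).
Qed.

End Fermions.

(** * The operators that add one variable *)

Lemma part_sub_refl l : part_sub l l.
Proof. by move=> i. Qed.

Lemma part_sub_cons x y m l : (x <= y)%N -> part_sub m l -> part_sub (x :: m) (y :: l).
Proof. by move=> xy ml [|i] /=. Qed.

Lemma part_sub_trans l1 l2 l3 : part_sub l1 l2 -> part_sub l2 l3 -> part_sub l1 l3.
Proof. by move=> l12 l23 i; apply: leq_trans (l12 i) (l23 i). Qed.

Lemma part_sub_nil M m : spart M m -> part_sub m [::] -> m = [::].
Proof. by case: m => //= x t /and3P[x0 _ _] /(_ 0%N) /=; rewrite leqNgt x0. Qed.

Lemma part_sub_spart M N m l : spart M m -> part_sub m l -> spart N l -> spart N m.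
Proof.
case: m l => // x t [|y l] spm sub spl; first by rewrite (part_sub_nil spm sub).
apply: (spart_head spm); apply: leq_ltn_trans (sub 0%N) _.
by case/and3P: spl.
Qed.

Lemma spart1 t : spart 1 t -> t = [::].
Proof. by case: t => //= -[|x] t. Qed.

Lemma spart_notop k t : spart k.+1 t -> head 0 t <> k -> (0 < k)%N -> spart k t.
Proof.
case: t => // x t; rewrite !spart_cons => /and3P[-> xk ->] /= /eqP hk _.
by rewrite andbT ltn_neqAle hk.
Qed.

Section Branching.
Variables (R : realType) (a : R).
Implicit Types (f g h : seq nat -> R) (l m t : seq nat) (u v w : int).

(** The mode - k without its sign, applied to partitions whose parts are all at
    most k.  The value 0 when the part k is present, and the convention for
    k = 0, make the recursion of Gamma uniform in k. *)
Definition put (k : nat) f l : R :=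
  if k == 0%N then f l else if head 0%N l == k then 0 else f (k :: l).

(** The recursion is the commutation relation
    (1 + a / z) Psi(z) Gamma = Gamma (1 - a / z) Psi(z), read on the mode
    - (k + 1) at a partition t with all parts at most k:
    put (k + 1) Gamma - a put k Gamma = Gamma (put (k + 1)) + a Gamma (put k).
    The inner fixpoint lowers the first part down to the next one. *)
Fixpoint Gamma f l {struct l} : R :=
  if l is x :: t then
    (fix top k := if k is k'.+1 then
       if (k' < head 0%N t)%N then 0
       else a * top k' + Gamma (put k'.+1 f) t + a * Gamma (put k' f) t
     else if t is [::] then f [::] else 0) x
  else f [::].

Lemma Psi_put k f t : spart k.+1 t -> Psi (- k%:Z) f t = (-1) ^+ k * put k f t.
Proof.
case: k => [|k] spt.
  case: t spt => [|x t] /=; first by rewrite mul1r.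
  by case: x.
rewrite -NegzE Psi_topE // /= /put /=; case: ifP => // _; by rewrite mulr0.
Qed.

Lemma Gamma_put k f t : spart k.+1 t ->
  put k.+1 (Gamma f) t =
  a * put k (Gamma f) t + Gamma (put k.+1 f) t + a * Gamma (put k f) t.
Proof.
move=> spt; rewrite /put /=; have hk : (head 0 t <= k)%N.
  by case: t spt => //= x t /and3P[_ + _]; rewrite ltnS.
rewrite ltn_eqF ?ltnS // ltnNge hk /=; congr (a * _ + _ + _).
case: k hk spt => [|k] /= hk spt; first by case: t hk spt => // -[].
by case: (ltngtP k.+1 (head 0%N t)) hk => // hk _.
Qed.

Lemma Gamma_cons k t f : spart k.+1 t ->
  Gamma f (k.+1 :: t) =
  a * put k (Gamma f) t + Gamma (put k.+1 f) t + a * Gamma (put k f) t.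
Proof.
move=> spt; rewrite -Gamma_put // /put /= ltn_eqF //.
by case: t spt => //= x t /and3P[].
Qed.

(** Induction over strict partitions by lowering the first part one step at a
    time, down to the point where it is absorbed by the next part. *)
Lemma spart_put_ind (P : seq nat -> Prop) :
  P [::] ->
  (forall k t, spart k.+1 t -> P t -> (spart k t -> (0 < k)%N -> P (k :: t)) ->
     P (k.+1 :: t)) ->
  forall N l, spart N l -> P l.
Proof.
move=> P0 PS N l; elim: l N => // x t IH N; rewrite spart_cons => /and3P[x0 _].
elim: x x0 => // k IHk _ spt; apply: (PS) => //; first exact: IH spt.
by move=> spt' k0; apply: IHk.
Qed.

(** Gamma is triangular for the inclusion of partitions.  Identities are proved
    at strict partitions only, and this is what lets them be used inside
    Gamma. *)
Lemma eq_Gamma N f g l :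
  (forall M m, spart M m -> part_sub m l -> f m = g m) -> spart N l ->
  Gamma f l = Gamma g l.
Proof.
move=> fg spl; move: N l spl f g fg; apply: spart_put_ind => [f g fg|k t spt IHt IHk f g fg].
  by rewrite /= (fg 0%N).
have headm M m : spart M m -> part_sub m t -> spart k.+1 m.
  by move=> spm mt; apply: part_sub_spart spm mt spt.
rewrite !Gamma_cons //; congr (a * _ + _ + a * _).
- rewrite /put; case: k spt IHk fg {headm} => [|k] spt IHk fg /=.
    apply: IHt => M m spm mt; apply: (fg M) => // i.
    by apply: leq_trans (mt i) _; rewrite (spart1 spt) nth_nil.
  case: eqP => // hk; apply: IHk => // [|M m spm mt]; first exact: spart_notop.
  by apply: (fg M) => //; apply: part_sub_trans mt _; apply: part_sub_cons.
- apply: IHt => M m spm mt; rewrite /put /=.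
  case: eqP => // hk; apply: (fg k.+2); last exact: part_sub_cons.
  by rewrite spart_cons ltnS leqnn (headm M).
- apply: IHt => M m spm mt; rewrite /put.
  case: k spt fg headm {IHk} => [|k] spt fg headm /=.
    apply: (fg M) => // i; apply: leq_trans (mt i) _.
    by rewrite (spart1 spt) nth_nil.
  case: eqP => // hk; apply: (fg k.+3); last exact: part_sub_cons.
  by rewrite spart_cons ltnS leqnSn /= (spart_notop (headm _ _ spm mt)).
Qed.

Lemma Gamma_lin N (b c : R) f g l : spart N l ->
  Gamma (fun m => b * f m + c * g m) l = b * Gamma f l + c * Gamma g l.
Proof.
move=> spl; move: N l spl f g; apply: spart_put_ind => [f g|k t spt IHt IHk f g] //.
have put_lin j : put j (fun m => b * f m + c * g m) =
    (fun m => b * put j f m + c * put j g m).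
  by apply: funext => m; rewrite /put; do 2?case: ifP => // _; ring.
rewrite !Gamma_cons // !put_lin !IHt.
have -> : put k (Gamma (fun m => b * f m + c * g m)) t =
    b * put k (Gamma f) t + c * put k (Gamma g) t.
  rewrite /put; case: k spt IHk => [|k] spt IHk /=; first exact: IHt.
  case: eqP => // hk; first by ring.
  by apply: IHk => //; exact: spart_notop.
by ring.
Qed.

Lemma GammaZ N (b : R) f l : spart N l -> Gamma (fun m => b * f m) l = b * Gamma f l.
Proof.
move=> spl; rewrite -[RHS]addr0 -(mul0r (Gamma f l)) -(Gamma_lin _ _ _ _ spl).
by congr Gamma; apply: funext => m; ring.
Qed.

Lemma Gamma0 N l : spart N l -> Gamma (fun=> 0) l = 0.
Proof.
move=> spl; rewrite -[RHS](mul0r (Gamma (fun=> 0) l)) -(GammaZ _ _ spl).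
by congr Gamma; apply: funext => m; rewrite mul0r.
Qed.

Lemma Gamma_ge0 N f l : 0 <= a -> (forall M m, spart M m -> 0 <= f m) -> spart N l ->
  0 <= Gamma f l.
Proof.
move=> a0 f0 spl; rewrite (@eq_Gamma N _ (fun m => `|f m|) l) //; last first.
  by move=> M m spm _; rewrite ger0_norm // (f0 M).
pose g m := `|f m|; have g0 m : 0 <= g m by exact: normr_ge0.
rewrite -[fun m => _]/g; move: g g0 => {}g; move: N l spl g {f f0}.
apply: spart_put_ind => [g g0|k t spt IHt IHk g g0]; first exact: (g0 [::]).
have put_ge0 j h m : (forall m, 0 <= h m) -> 0 <= put j h m.
  by move=> h0; rewrite /put; do 2?case: ifP.
rewrite Gamma_cons //; apply: addr_ge0; last first.
  by rewrite mulr_ge0 // IHt // => m; apply: put_ge0.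
apply: addr_ge0; last by rewrite IHt // => m; apply: put_ge0.
rewrite mulr_ge0 // /put; case: k spt IHk => [|k] spt IHk /=; first exact: IHt.
by case: eqP => // hk; apply: IHk => //; exact: spart_notop.
Qed.

End Branching.

Section Intertwining.
Variables (R : realType).
Implicit Types (a : R) (f g h : seq nat -> R) (l m t : seq nat) (u v w : int).

(** The coefficient of z^u in (1 + a / z) Psi(z). *)
Definition mix a u h l : R := Psi u h l + a * Psi (u + 1) h l.

(** The anticommutator of Psi u and Psi v. *)
Definition cliff u v : R := if u + v == 0 then 2 * (-1) ^+ `|u| else 0.

Lemma cliff_cancel u v : cliff u (v + 1) + cliff (u + 1) v = 0.
Proof.
rewrite /cliff (_ : u + 1 + v = u + (v + 1)); last by lia.
case: eqP => uv; last by rewrite addr0.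
rewrite -signr_odd -[in X in _ + X]signr_odd.
have -> : odd `|u + 1| = ~~ odd `|u| by lia.
by case: odd; rewrite ?expr0 ?expr1; ring.
Qed.

Lemma eq_Psi_below N u f g l : (forall m, spart N m -> f m = g m) ->
  (- N%:Z < u) -> spart N l -> Psi u f l = Psi u g l.
Proof.
move=> fg uN spl; have [uN'|uN'] := ltnP `|u| N; first exact: eq_Psi fg uN' spl.
case: u uN uN' => [[|k]|k] /= uN uN'; try lia.
by rewrite !Psi_create_out // (spart_le uN').
Qed.

Lemma eq_mix_below N a u f g l : (forall m, spart N m -> f m = g m) ->
  (- N%:Z < u) -> spart N l -> mix a u f l = mix a u g l.
Proof.
move=> fg uN spl; rewrite /mix !(eq_Psi_below fg _ spl) //.
by apply: lt_trans uN _; rewrite ltzD1.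
Qed.

(** Multiplying the field by 1 + a / z multiplies the anticommutator by
    (1 + a / z) (1 + a / w), which at w = - z becomes 1 - a^2 / z^2; the terms
    linear in a cancel, and the anticommutator stays a scalar. *)
Lemma mix_anti N a u v h l : spart N l ->
  mix a u (mix a v h) l + mix a v (mix a u h) l =
  (cliff u v + a ^+ 2 * cliff (u + 1) (v + 1)) * h l.
Proof.
move=> spl; rewrite /mix !PsiD !PsiZ.
have E w w' : Psi w (Psi w' h) l = cliff w w' * h l - Psi w' (Psi w h) l.
  apply/(canRL (addrK _)); rewrite (clifford _ _ _ spl) /cliff.
  by case: ifP => _; rewrite ?mul0r.
rewrite (E v u) (E v (u + 1)) (E (v + 1) u) (E (v + 1) (u + 1)).
have cc := cliff_cancel u v.
have clC w w' : cliff w w' = cliff w' w.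
  by rewrite /cliff addrC; case: eqP => // ww; congr (_ * _ ^+ _); lia.
rewrite (clC v u) (clC v (u + 1)) (clC (v + 1) u) (clC (v + 1) (u + 1)).
have -> : cliff (u + 1) v = - cliff u (v + 1).
  by apply/eqP; rewrite -addr_eq0 addrC cc.
by ring.
Qed.

Lemma mix_put a k h t : spart k.+1 t ->
  mix a (Negz k) h t = (-1) ^+ k.+1 * (put k.+1 h t - a * put k h t).
Proof.
move=> spt; rewrite /mix NegzE (_ : - Posz k.+1 + 1 = - k%:Z); last by lia.
by rewrite !Psi_put // ?(spart_le _ spt) // exprS; ring.
Qed.

Lemma Gamma_mix_top a k f t : spart k.+1 t ->
  mix a (Negz k) (Gamma a f) t = Gamma a (mix (- a) (Negz k) f) t.
Proof.
move=> spt; rewrite mix_put // Gamma_put //.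
rewrite [RHS](@eq_Gamma _ _ k.+1 _ (fun m => (-1) ^+ k.+1 * put k.+1 f m +
   ((-1) ^+ k.+1 * a) * put k f m) t) //; last first.
  move=> M m spm mt; rewrite mix_put ?(part_sub_spart spm mt spt) //; ring.
by rewrite (Gamma_lin _ _ _ _ _ spt); ring.
Qed.

(** The relation (1 + a / z) Psi(z) Gamma = Gamma (1 - a / z) Psi(z) on all
    modes.  On the lowest modes it is the definition of Gamma.  A coordinate
    with first part k + 1 is the value of the mode w = - (k + 1) at the tail, up
    to lower coordinates (split_top).  The mode u is then moved past w, where
    both sides produce the same scalar (mix_anti), and the induction hypothesis
    applies to the tail. *)
Theorem Gamma_mix N a u f l : spart N l ->
  mix a u (Gamma a f) l = Gamma a (mix (- a) u f) l.
Proof.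
move=> spl; move: N l spl u f; apply: spart_put_ind => [u f|k t spt IHt IHk u f].
  case: u => [[|k]|k]; last exact: (@Gamma_mix_top a k f [::]).
    by rewrite /mix add0r /= !mulr0 !addr0.
  by rewrite /mix -PoszD addn1 /= !mulr0 addr0.
have IHput v h : put k (mix a v (Gamma a h)) t = put k (Gamma a (mix (- a) v h)) t.
  rewrite /put; case: k spt IHk => [|k] spt IHk /=; first exact: IHt.
  by case: eqP => // hk; apply: IHk => //; exact: spart_notop.
have below : spart k.+2 (k.+1 :: t) by rewrite spart_cons ltnSn.
have [ku|uk] := ltP u (- k.+1%:Z).
  case: u ku => [n|n] ku; first by lia.
  by apply: Gamma_mix_top; apply: spart_le below; lia.
have split_top h : h (k.+1 :: t) =
    (-1) ^+ k.+1 * mix a (Negz k) h t + a * put k h t.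
  rewrite mix_put // mulrA -exprD -signr_odd addnn odd_double expr0 mul1r.
  rewrite {1}/put /= ifN ?addrNK //; apply/eqP => hk.
  by case: t spt hk {IHt IHk IHput below} => //= x t /and3P[_ + _] xk; rewrite xk ltnn.
rewrite (split_top (mix a u _)) (split_top (Gamma a _)) IHput IHt; congr (_ * _ + _).
set w := Negz k.
have antiB : Gamma a (mix (- a) u (mix (- a) w f)) t +
    Gamma a (mix (- a) w (mix (- a) u f)) t =
    (cliff w u + a ^+ 2 * cliff (w + 1) (u + 1)) * Gamma a f t.
  rewrite -[X in X + _]mul1r -[X in _ + X]mul1r -(Gamma_lin _ _ _ _ _ spt).
  rewrite -(GammaZ _ _ _ spt); apply: (eq_Gamma _ (N := k.+1)) => // M m spm _.
  by rewrite !mul1r addrC (mix_anti _ _ _ _ spm) sqrrN.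
have antiA := mix_anti a w u (Gamma a f) spt.
(* For u = w the anticommutator is twice the square, hence determines it. *)
have [uw|uw] := eqVneq u w.
  rewrite uw in antiA antiB *; move: antiA; rewrite -antiB -!mulr2n.
  by move/eqP; rewrite eqr_pMn2r // => /eqP.
have step : mix a u (mix a w (Gamma a f)) t = Gamma a (mix (- a) u (mix (- a) w f)) t.
  rewrite -IHt; apply: (eq_mix_below (N := k.+1)) => //.
    by move=> m spm; apply: Gamma_mix_top.
  by rewrite lt_neqAle uk andbT eq_sym -NegzE.
by apply: (addIr (mix a u (mix a w (Gamma a f)) t)); rewrite antiA step -antiB addrC.
Qed.

End Intertwining.

(** * Wick formula in the vacuum *)

Section Vacuum.
Variable R : realType.
Implicit Types (a : R) (A : seq R) (f g h : seq nat -> R) (l m t : seq nat).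
Implicit Types (u v w : int) (s : seq int).

Definition delta m : seq nat -> R := fun l => (l == m)%:R.

(** The adjoint of Psi u for the pairing
    (g, f) |-> sum_l 2^-(size l) * g l * f l. *)
Definition Phi u f l : R := (-1) ^+ `|u| * Psi (- u) f l.

Fixpoint adj s g : seq nat -> R := if s is u :: s' then adj s' (Phi u g) else g.

Lemma eq_Phi N u f g l : (forall M m, spart M m -> f m = g m) ->
  spart N l -> Phi u f l = Phi u g l.
Proof. by move=> fg spl; rewrite /Phi (eq_Psi_strict _ fg spl). Qed.

Lemma Phi_lin u (b c : R) f g l :
  Phi u (fun m => b * f m + c * g m) l = b * Phi u f l + c * Phi u g l.
Proof. by rewrite /Phi Psi_lin; ring. Qed.

Lemma eq_adj N s f g l : (forall M m, spart M m -> f m = g m) ->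
  spart N l -> adj s f l = adj s g l.
Proof.
elim: s f g => [|u s IH] f g fg spl /=; first exact: fg spl.
by apply: IH => // M m spm; apply: eq_Phi spm.
Qed.

Lemma adj_lin s (b c : R) f g l :
  adj s (fun m => b * f m + c * g m) l = b * adj s f l + c * adj s g l.
Proof.
elim: s f g => [|u s IH] f g //=; rewrite -IH; congr (adj _ _ _).
by apply: funext => m; rewrite Phi_lin.
Qed.

Lemma adjZ s (b : R) f l : adj s (fun m => b * f m) l = b * adj s f l.
Proof.
rewrite -[RHS]addr0 -[X in _ + X](mul0r (adj s f l)) -adj_lin.
by congr (adj _ _ _); apply: funext => m; ring.
Qed.

Lemma adj_vanish N s h l : (forall m, spart N m -> h m = 0) ->
  all (fun v => (`|v| < N)%N) s -> spart N l -> adj s h l = 0.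
Proof.
elim: s h => [|v s IH] h h0 /=; first by move=> _; exact: h0.
case/andP=> vN sN spl; apply: IH => // m spm.
rewrite /Phi (@eq_Psi _ N _ _ (fun=> 0)) ?Psi0 ?mulr0 //; last by lia.
Qed.

Lemma Phi_clifford N u v f l : spart N l ->
  Phi u (Phi v f) l = cliff R u v * f l - Phi v (Phi u f) l.
Proof.
move=> spl; apply/(canRL (addrK _)); rewrite /Phi !PsiZ.
have E : Psi (- u) (Psi (- v) f) l = cliff R u v * f l - Psi (- v) (Psi (- u) f) l.
  apply/(canRL (addrK _)); rewrite (clifford _ _ _ spl) /cliff -opprD oppr_eq0.
  by case: ifP => _; rewrite ?mul0r // abszN.
rewrite E mulrA [X in _ + X]mulrA [(-1) ^+ `|v| * _]mulrC -mulrDr.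
rewrite subrK /cliff; case: eqP => uv; last by rewrite !mul0r mulr0.
rewrite (_ : `|v|%N = `|u|%N); last by lia.
by rewrite -exprD -signr_odd addnn odd_double expr0 mul1r.
Qed.

Lemma Phi_mix b u h l :
  Phi u h l - b * Phi (u - 1) h l = (-1) ^+ `|u| * mix b (- u) h l.
Proof.
have -> : mix b (- u) h l = Psi (- u) h l + b * Psi (- (u - 1)) h l.
  by rewrite /mix; congr (_ + _ * Psi _ _ _); lia.
rewrite /Phi -(signr_odd _ `|u - 1|) -(signr_odd _ `|u|).
have -> : odd `|u - 1| = ~~ odd `|u| by lia.
by case: odd; rewrite /= ?expr0 ?expr1; ring.
Qed.

Lemma Phi_Gamma N a u f l : spart N l ->
  Phi u (Gamma a f) l - a * Phi (u - 1) (Gamma a f) l =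
  Gamma a (Phi u f) l + a * Gamma a (Phi (u - 1) f) l.
Proof.
move=> spl; rewrite Phi_mix (Gamma_mix _ _ _ spl) -[LHS](GammaZ _ _ _ spl).
rewrite -[Gamma a (Phi u f) l]mul1r -(Gamma_lin _ _ _ _ _ spl).
apply: (eq_Gamma _ (N := N)) => // M m spm _.
by rewrite -Phi_mix; ring.
Qed.

(** The expansion of (z - w) / (z + w) for |w| < |z|. *)
Definition ker_coef (k : nat) : R := if k == 0%N then 1 else 2 * (-1) ^+ k.

(** The coefficient of z^u w^v in (z - w) / (z + w) J(z) I(w), |w| < |z|, for
    p = (J, u) and r = (I, v), when I is a power series: the expansion then
    stops at k = v. *)
Definition Kfin (p r : (int -> R) * int) : R :=
  if r.2 is Posz n then
    \sum_(k < n.+1) ker_coef k * (p.1 (p.2 + k%:Z) * r.1 (n%:Z - k%:Z))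
  else 0.

Definition qcoef A : int -> R := laurent_pos (qfun A).

(** By the Clifford relations, moving the mode u across the word s leaves one
    contraction with each letter. *)
Lemma adj_move N s u h l : spart N l ->
  adj (u :: s) h l =
  contract (cliff R) u (fun s' => adj s' h l) s + (-1) ^+ size s * Phi u (adj s h) l.
Proof.
move=> spl; elim: s h => [|v s IH] h; first by rewrite /= add0r mul1r.
have -> : adj (u :: v :: s) h l = cliff R u v * adj s h l - adj (u :: s) (Phi v h) l.
  rewrite -[X in _ - X]mul1r -mulNr -adj_lin.
  apply: (@eq_adj N s) => // M m spm.
  rewrite (Phi_clifford v u _ spm) mulN1r; congr (_ * _ - _).
  by rewrite /cliff addrC; case: eqP => // uv; congr (_ * _ ^+ _); lia.
by rewrite IH /= exprS; ring.
Qed.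

Lemma Kvac u v : Kfin (qcoef [::], u) (qcoef [::], v) =
  if (u + v == 0) && (0 <= v) then ker_coef `|v| else 0.
Proof.
rewrite /Kfin /=; case: v => [n|n] /=; last by rewrite andbF.
rewrite andbT (bigD1 ord_max) //= big1 ?addr0 => [|k kn]; last first.
  rewrite /qcoef /laurent_pos /= (_ : n%:Z - k%:Z = Posz (n - k)); last first.
    by have := ltn_ord k; lia.
  rewrite (_ : ((n - k)%N == 0%N) = false) ?mulr0 //.
  by apply/negbTE; move: kn; rewrite -val_eqE /=; have := ltn_ord k; lia.
rewrite subrr /qcoef /laurent_pos /= mulr1.
have -> : (if u + n is Posz n0 then ((n0 == 0%N)%:R : R) else 0) = (u + n == 0)%:R.
  by case: (u + n) => // -[].
by case: eqP; rewrite ?mulr1 ?mulr0.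
Qed.

(** A negative mode in the first position is contracted with the rest and then
    kills the vacuum; a positive one kills the vacuum immediately.  The mode 0
    fixes the vacuum from both sides, hence is half of its own contraction:
    this is the coefficient 1, instead of 2, at k = 0 in ker_coef. *)
Theorem wick_vacuum n s : size s = n.*2 ->
  adj s (delta [::]) [::] = pfl Kfin n (map (pair (qcoef [::])) s).
Proof.
rewrite pfl_map; elim: n s => [|n IH] [|u s] //.
case=> szs.
rewrite [RHS]/=.
have Kcl : u < 0 -> (fun v => Kfin (qcoef [::], u) (qcoef [::], v)) =1 cliff R u.
  move=> u0 v; rewrite Kvac /cliff; case: eqP => //= uv.
  have -> : 0 <= v by lia.
  rewrite /ker_coef (_ : `|v|%N = `|u|%N); last by lia.
  by case: eqP => //; lia.
have Fn s' : size s' = n.*2 -> adj s' (delta [::]) [::] =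
    pfl (fun x y => Kfin (qcoef [::], x) (qcoef [::], y)) n s' by exact: IH.
have [u0|u0|u0] := ltgtP u 0.
- rewrite (@adj_move 0) // (_ : Phi u _ _ = 0) ?mulr0 ?addr0; last first.
    by rewrite /Phi; case: u u0 {Kcl} => // k _; rewrite NegzE opprK /= mulr0.
  apply: eq_contract_size szs => // v; by rewrite Kcl.
- rewrite /= (_ : adj s _ _ = 0); last first.
    rewrite (@eq_adj 0 _ _ (fun m => 0 * delta [::] m)) ?adjZ ?mul0r // => M m spm.
    rewrite mul0r /Phi; case: u u0 {Kcl} => // -[//|k] _.
    rewrite -NegzE; elim: m M spm => [|x m IHm] M; first by rewrite /= !mulr0.
    rewrite spart_cons => /and3P[x0 _ spm]; rewrite /=; case: ifP => kx.
      rewrite (@eq_Psi _ x _ _ (fun=> 0)) ?Psi0 ?oppr0 ?mulr0 //.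
    by case: ifP; rewrite ?mulr0 //= !mulr0.
  pose K x y := Kfin (qcoef [::], x) (qcoef [::], y).
  transitivity (contract (fun x y => 0 * K x y) u (pfl K n) s).
    by rewrite contractZl mul0r.
  apply: eq_contract_size szs => // v.
  by rewrite mul0r /K Kvac; case: ifP => // /andP[/eqP uv v0]; lia.
have X1 : adj (u :: s) (delta [::]) [::] = adj s (delta [::]) [::].
  rewrite /= u0; apply: (@eq_adj 0) => // M m; rewrite /Phi mul1r oppr0.
  case: m => // x t; rewrite spart_cons => /and3P[x0 _ _].
  by rewrite Psi_cons // (_ : (fun _ => _) = (fun=> 0)) ?Psi0 ?oppr0.
have X2 := @adj_move 0 s u (delta [::]) [::] isT.
rewrite X1 u0 szs -signr_odd /= odd_double /= /Phi /= !mul1r mulN1r in X2.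
apply: (@mulfI _ 2); first by rewrite pnatr_eq0.
pose K x y := Kfin (qcoef [::], x) (qcoef [::], y).
transitivity (contract (cliff R) u (fun s' => adj s' (delta [::]) [::]) s).
  by rewrite X1 mulr_natl mulr2n {1}X2 subrK u0.
rewrite -(contractZl K); apply: eq_contract_size szs => // v.
rewrite u0 /K Kvac /cliff add0r; case: eqP => [->|]; rewrite ?mulr0 //.
Qed.

Definition Gammas A f : seq nat -> R := foldr (@Gamma R) f A.

Lemma qfun_cons0 a A : qfun (a :: A) 0 = qfun A 0.
Proof.
rewrite /= /ps_mul big_ord1 /F_factor /ps_mul big_ord1 /=.
by rewrite coefD coef1 coefZ coefX mulr0 addr0 expr0 !mul1r.
Qed.

Lemma F_factor0 a : F_factor a 0 = 1.
Proof. by rewrite /F_factor /ps_mul big_ord1 coefD coef1 coefZ coefX mulr0 addr0 !mul1r. Qed.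

Lemma F_factorS a n : F_factor a n.+1 = 2 * a ^+ n.+1.
Proof.
rewrite /F_factor /ps_mul !big_ord_recl big1 ?addr0 => [|i _] /=.
  rewrite !coefD !coef1 !coefZ !coefX /= subn0 subSS subn0.
  by rewrite exprS; ring.
by rewrite coefD coef1 coefZ coefX /= mulr0 addr0 mul0r.
Qed.

(** F_(a :: A)(z) (1 - a z) = F_A(z) (1 + a z). *)
Lemma qfun_consS a A n :
  qfun (a :: A) n.+1 - a * qfun (a :: A) n = qfun A n.+1 + a * qfun A n.
Proof.
rewrite /= /ps_mul; move: (qfun A) => g.
rewrite big_ord_recl F_factor0 mul1r subn0 -addrA; congr (_ + _).
rewrite mulr_sumr -sumrB big_ord_recl big1 ?addr0 => [|i _].
  by rewrite /= F_factorS F_factor0 expr1 !subn0 subSS subn0; ring.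
by rewrite /= /bump /= add1n !F_factorS subSS exprS; ring.
Qed.

Lemma qcoef_cons a A u :
  qcoef (a :: A) u - a * qcoef (a :: A) (u - 1) = qcoef A u + a * qcoef A (u - 1).
Proof.
rewrite /qcoef; case: u => [[|n]|n].
- by rewrite (_ : 0%:Z - 1 = Negz 0) // /laurent_pos qfun_cons0 !mulr0; ring.
- by rewrite (_ : n.+1%:Z - 1 = n) ?qfun_consS //=; lia.
- by rewrite (_ : Negz n - 1 = Negz n.+1) //=; [ring | lia].
Qed.

End Vacuum.

(** * Schur Q-functions as coordinates *)

Section SchurQ.
Variable R : realType.
Implicit Types (a : R) (A : seq R) (f g h : seq nat -> R) (l m t : seq nat).
Implicit Types (u v w : int) (s : seq int).

Lemma adj_rcons s u g : adj (rcons s u) g = Phi u (adj s g).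
Proof. by elim: s g => //= v s IH g. Qed.

Lemma adj_cat s1 s2 g : adj (s1 ++ s2) g = adj s2 (adj s1 g).
Proof. by elim: s1 g => //= v s IH g. Qed.

Lemma Phi_neg_vanish N w h l : (0 < N)%N -> w <= - N%:Z -> spart N l -> Phi w h l = 0.
Proof.
move=> N0 wN spl; rewrite /Phi; case: w wN => [n|k] wN; first by lia.
by rewrite NegzE opprK Psi_create_out ?mulr0 //; apply: spart_le spl; lia.
Qed.

Lemma Kfin_widen N (p : (int -> R) * int) (J : int -> R) v :
  (forall k, J (Negz k) = 0) -> v < N%:Z ->
  Kfin p (J, v) = \sum_(k < N) ker_coef R k * (p.1 (p.2 + k%:Z) * J (v - k%:Z)).
Proof.
move=> J0 vN; have J_neg w : w < 0 -> J w = 0 by case: w.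
rewrite /Kfin /=; case: v vN => [n|n] vN; last first.
  by rewrite big1 // => k _; rewrite J_neg ?mulr0 //; lia.
rewrite (big_ord_widen N (fun k => ker_coef R k * (p.1 (p.2 + k%:Z) * J (n%:Z - k%:Z))));
  last by lia.
rewrite big_mkcond; apply: eq_bigr => k _; case: ltnP => // nk.
by rewrite J_neg ?mulr0 //; lia.
Qed.

Lemma Kfin_cons_r (p : (int -> R) * int) a A w :
  Kfin p (qcoef (a :: A), w) - a * Kfin p (qcoef (a :: A), w - 1) =
  Kfin p (qcoef A, w) + a * Kfin p (qcoef A, w - 1).
Proof.
have wN : w < (`|w|.+1)%:Z by lia.
have wN' : w - 1 < (`|w|.+1)%:Z by lia.
rewrite !(Kfin_widen _ _ wN) // !(Kfin_widen _ _ wN') //.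
rewrite !mulr_sumr -sumrB -big_split; apply: eq_bigr => k _ /=.
rewrite (_ : w - 1 - k%:Z = w - k%:Z - 1); last by lia.
have E := qcoef_cons a A (w - k%:Z); move: E; set q1 := qcoef _ _; set q2 := qcoef _ _.
set q3 := qcoef _ _; set q4 := qcoef _ _ => E.
transitivity (ker_coef R k * p.1 (p.2 + k%:Z) * (q1 - a * q2)); first by ring.
by rewrite E; ring.
Qed.

Lemma Kfin_cons_l (p : (int -> R) * int) a A w :
  Kfin (qcoef (a :: A), w) p - a * Kfin (qcoef (a :: A), w - 1) p =
  Kfin (qcoef A, w) p + a * Kfin (qcoef A, w - 1) p.
Proof.
rewrite /Kfin; case: p.2 => [n|n]; last by rewrite mulr0 subr0 addr0.
rewrite !mulr_sumr -sumrB -big_split; apply: eq_bigr => k _ /=.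
rewrite (_ : w - 1 + k%:Z = w + k%:Z - 1); last by lia.
have E := qcoef_cons a A (w + k%:Z); move: E; set q1 := qcoef _ _; set q2 := qcoef _ _.
set q3 := qcoef _ _; set q4 := qcoef _ _ => E.
transitivity (ker_coef R k * p.1 (n%:Z - k%:Z) * (q1 - a * q2)); first by ring.
by rewrite E; ring.
Qed.

(** A solution of x_w = a x_(w-1) on all integers vanishes if it vanishes far
    to the left. *)
Lemma rec_vanish a (x : int -> R) :
  (forall w, x w - a * x (w - 1) = 0) -> (exists M : nat, forall w, w <= - M%:Z -> x w = 0) ->
  forall w, x w = 0.
Proof.
move=> rec [M xM] w; have [wM|Mw] := leP w (- M%:Z); first exact: xM.
have -> : w = - M%:Z + `|w + M%:Z|%:Z by lia.
elim: `|_|%N => [|k IH]; first by rewrite addr0 xM.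
have := rec (- M%:Z + k.+1%:Z).
by rewrite (_ : _ - 1 = - M%:Z + k%:Z) ?IH ?mulr0 ?subr0 //; lia.
Qed.

(** A new operator Gamma a acts after the word.  It is carried inwards, one
    letter at a time, past the letters in s1; letters still to be passed see the
    series of a :: A, the others that of A.  On both sides the passage is the
    same recursion in the mode u, and both sides vanish for u very negative. *)
Theorem wick_Q A n s : size s = n.*2 ->
  adj s (Gammas A (delta R [::])) [::] = pfl (@Kfin R) n (map (pair (qcoef A)) s).
Proof.
elim: A s => [|a A IHA] s szs; first exact: wick_vacuum.
set g := Gammas A (delta R [::]) in IHA *.
pose E (w : int) := (qcoef A, w); pose D (w : int) := (qcoef (a :: A), w).
suff H s1 s2 : size (s1 ++ s2) = n.*2 ->
    adj s2 (Gamma a (adj s1 g)) [::] = pfl (@Kfin R) n (map E s1 ++ map D s2).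
  exact: (H [::] s).
elim: s2 s1 {s szs} => [|u s2 IH] s1; first by rewrite !cats0 => sz; rewrite /= IHA.
move=> sz; apply/eqP; rewrite -subr_eq0; apply/eqP.
pose x w := adj (w :: s2) (Gamma a (adj s1 g)) [::] -
            pfl (@Kfin R) n (map E s1 ++ D w :: map D s2).
rewrite -[LHS]/(x u); apply: (@rec_vanish a) => [w|].
- have slot := @pfl_slot R ((int -> R) * int)%type
    (fun phi => phi (D w) - a * phi (D (w - 1)) = phi (E w) + a * phi (E (w - 1)))
    _ _ (@Kfin R) predT predT n (map E s1) (map D s2) _ _ (all_predT _) (all_predT _).
  have {}slot := slot _ _ _ _.
  have IHw v : adj s2 (Gamma a (Phi v (adj s1 g))) [::] =
      pfl (@Kfin R) n (map E s1 ++ E v :: map D s2).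
    rewrite -adj_rcons IH ?map_rcons ?cat_rcons //.
    by rewrite -sz !size_cat.
  have lin : adj s2 (Phi w (Gamma a (adj s1 g))) [::] -
      a * adj s2 (Phi (w - 1) (Gamma a (adj s1 g))) [::] =
      adj s2 (Gamma a (Phi w (adj s1 g))) [::] +
      a * adj s2 (Gamma a (Phi (w - 1) (adj s1 g))) [::].
    rewrite -[X in X - _]mul1r -[X in _ = X + _]mul1r -mulNr -!adj_lin.
    apply: (@eq_adj _ 0) => // M m spm.
    by rewrite !mul1r mulNr (Phi_Gamma _ _ _ spm).
  rewrite /x /= !mulrBr.
  have -> (p q r t : R) : p - q - (r - t) = (p - r) - (q - t) by ring.
  rewrite lin !IHw slot ?subrr //.
  + by rewrite !mulr0 subr0 addr0.
  + move=> b c phi psi Hphi Hpsi.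
    have -> (p q r t : R) : b * p + c * q - a * (b * r + c * t) =
      b * (p - a * r) + c * (q - a * t) by ring.
    by rewrite Hphi Hpsi; ring.
  + by move=> y _; exact: Kfin_cons_r.
  + by move=> y _; exact: Kfin_cons_l.
- have [M1 HM1] : exists M : nat, forall w, w <= - M%:Z ->
      adj (w :: s2) (Gamma a (adj s1 g)) [::] = 0.
    exists (\max_(v <- s2) `|v|).+1 => w wM.
    apply: (@adj_vanish _ (\max_(v <- s2) `|v|).+1 s2 (Phi w _)) => //.
      by move=> m spm; exact: Phi_neg_vanish spm.
    by apply/allP => v vs; rewrite ltnS; exact: leq_bigmax_seq.
  have [M2 HM2] : exists M : nat, forall w, w <= - M%:Z ->
      pfl (@Kfin R) n (map E s1 ++ D w :: map D s2) = 0.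
    apply: (@pfl_slot R ((int -> R) * int)%type
      (fun phi => exists M : nat, forall w, w <= - M%:Z -> phi (D w) = 0)
      _ _ (@Kfin R) predT predT n (map E s1) (map D s2) _ _ (all_predT _) (all_predT _)).
    + by exists 0%N.
    + move=> b c phi psi [M HM] [M' HM']; exists (maxn M M') => w wM.
      by rewrite HM ?HM' ?mulr0 ?addr0 //; lia.
    + move=> y _; exists 1%N => -[n'|n'] // wM; lia.
    + move=> [J v] _; exists (`|v|.+1) => w wM; rewrite /Kfin /=.
      case: v wM => // k wM; rewrite big1 // => i _.
      rewrite /D /= (_ : qcoef _ (w + i%:Z) = 0) ?mul0r ?mulr0 //.
      have : w + i%:Z < 0 by have := ltn_ord i; lia.
      by case: (w + i%:Z).
  by exists (maxn M1 M2) => w wM; rewrite /x HM1 ?HM2 ?subrr //; lia.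
Qed.

(** The modes of the parts of a partition, read from the largest, extract the
    coordinate at that partition. *)
Lemma adj_parts N l m g : spart N (l ++ m) -> adj (map Posz l) g m = g (l ++ m).
Proof.
elim: l N g => //= x t IH N g /and3P[x0 xN spt]; rewrite (IH _ _ spt).
rewrite /Phi Psi_put; last by apply: spart_le spt.
rewrite mulrA -exprD -signr_odd addnn odd_double expr0 mul1r /put.
rewrite -[x == 0%N]negbK -lt0n x0 /= ifN //; apply/eqP => hx.
by case: (t ++ m) spt hx x0 => [_ /= <-//|y r /and3P[_ + _] /= yx]; rewrite yx ltnn.
Qed.

Lemma schurQ2E A (r s : nat) : schurQ2 A r s = Kfin (qcoef A, r%:Z) (qcoef A, s%:Z).
Proof.
rewrite /schurQ2 /Kfin [RHS]/= big_ord_recl; congr (_ + _).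
  by rewrite /ker_coef /= mul1r !addn0.
rewrite (big_addn 0 s.+1 1) subn1 /= big_mkord mulr_sumr; apply: eq_bigr => i _.
rewrite addn1 /= /bump /= add1n /ker_coef /=.
rewrite (_ : s%:Z - i.+1%:Z = (s - i.+1)%N); last first.
  by have := ltn_ord i; lia.
by rewrite !mulrA.
Qed.

(** The coordinate lambda is extracted by the modes of its parts, and
    the Wick formula turns this into the defining Pfaffian; for odd length the
    part 0 corresponds to the mode 0, which fixes the vacuum coordinate. *)
Theorem schurQ_Gammas A lam : strict_partition lam ->
  schurQ lam A = Gammas A (delta R [::]) lam.
Proof.
move=> /strict_spart spl; rewrite /schurQ; set n := uphalf _.
pose pad := nseq (odd (size lam)) 0%N; pose lam' := lam ++ pad.
have szl : size lam' = n.*2.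
  by rewrite size_cat size_nseq /n uphalf_half doubleD -[in LHS](odd_double_half (size lam)); lia.
have -> : skew_mx n.*2 (fun i j => schurQ2 A (nth 0%N lam i) (nth 0%N lam j)) =
    skew_mx n.*2 (fun i j => schurQ2 A (nth 0%N lam' i) (nth 0%N lam' j)).
  have nthE i : nth 0%N lam' i = nth 0%N lam i.
    rewrite nth_cat; case: ltnP => // li; rewrite [RHS]nth_default // /pad.
    by rewrite nth_nseq if_same.
  by apply/matrixP => i j; rewrite !mxE !nthE.
rewrite (pfaffian_pfl 0%N (schurQ2 A) szl).
have -> : schurQ2 A = fun r s : nat => Kfin (qcoef A, r%:Z) (qcoef A, s%:Z).
  by apply: funext => r; apply: funext => s; rewrite schurQ2E.
rewrite -(pfl_map (fun r : nat => (qcoef A, r%:Z)) (@Kfin R)).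
have -> : map (fun r : nat => (qcoef A, r%:Z)) lam' = map (pair (qcoef A)) (map Posz lam').
  by rewrite -map_comp.
rewrite -wick_Q ?size_map // /lam' map_cat adj_cat.
have {2}-> : lam = lam ++ [::] by rewrite cats0.
have spl0 : spart (head 0%N lam).+1 (lam ++ [::]) by rewrite cats0.
rewrite -(adj_parts _ spl0) /pad; case: odd => //=.
by rewrite /Phi /= mul1r.
Qed.

End SchurQ.

(** * Skew Q-functions as coordinates *)

Fixpoint parts (N : nat) : seq (seq nat) :=
  if N is n.+1 then parts n ++ map (cons n.+1) (parts n) else [:: [::]].

Lemma mem_parts N l : (l \in parts N) = spart N.+1 l.
Proof.
elim: N l => [|n IH] l; first by case: l => //= -[|x] t.
rewrite mem_cat IH; apply/orP/idP => [[|/mapP[t + ->]]|/spart_top[|[t -> spt]]].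
- exact: spart_le.
- by rewrite IH spart_cons ltnSn => ->.
- by left.
- by right; apply/mapP; exists t; rewrite ?IH.
Qed.

Lemma uniq_parts N : uniq (parts N).
Proof.
elim: N => //= n IH; rewrite cat_uniq IH map_inj_uniq ?IH ?andbT => [|l m [] //].
by apply/hasPn => _ /mapP[t _ ->]; rewrite /= mem_parts spart_cons ltnn andbF.
Qed.

Lemma poly_eq0_real (R : realType) (p : {poly R}) : (forall x, p.[x] = 0) -> p = 0.
Proof.
move=> p0; apply/eqP; apply/negP => /negP pn0.
suff : (size [seq i%:R : R | i <- iota 0 (size p)] < size p)%N.
  by rewrite size_map size_iota ltnn.
apply: max_poly_roots => //; first by apply/allP => x _; rewrite rootE p0.
by rewrite map_inj_uniq ?iota_uniq // => i j /eqP; rewrite eqr_nat => /eqP.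
Qed.

Section SkewQ.
Variable R : realType.
Implicit Types (a : R) (A B : seq R) (f g h : seq nat -> R) (l m t : seq nat).

Lemma eq_Gammas N A f g l :
  (forall M m, spart M m -> part_sub m l -> f m = g m) -> spart N l ->
  Gammas A f l = Gammas A g l.
Proof.
elim: A l N => [|a A IH] l N fg spl /=; first exact: fg spl (part_sub_refl l).
apply: (@eq_Gamma _ a N) => // M m spm ml; apply: IH spm => M' m' spm' m'm.
by apply: fg spm' _; apply: part_sub_trans ml.
Qed.

Lemma Gammas_lin N A (b c : R) f g l : spart N l ->
  Gammas A (fun m => b * f m + c * g m) l = b * Gammas A f l + c * Gammas A g l.
Proof.
elim: A l N => [|a A IH] l N spl //=; rewrite -(Gamma_lin _ _ _ _ _ spl).
by apply: (@eq_Gamma _ a N) => // M m spm _; exact: IH spm.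
Qed.

Lemma Gammas0 N A l : spart N l -> Gammas A (fun=> 0) l = 0.
Proof.
move=> spl; rewrite -[RHS](mul0r (Gammas A (fun=> 0) l)) -[RHS]addr0.
rewrite -[X in _ + X](mul0r (Gammas A (fun=> 0) l)) -(Gammas_lin _ _ _ _ _ spl).
by congr Gammas; apply: funext => m; rewrite !mul0r addr0.
Qed.

Lemma Gammas_ge0 N A f l : (forall a, a \in A -> 0 <= a) ->
  (forall M m, spart M m -> 0 <= f m) -> spart N l -> 0 <= Gammas A f l.
Proof.
elim: A l N => [|a A IH] l N A0 f0 spl /=; first exact: f0 spl.
apply: (@Gamma_ge0 _ a N) => //; first by apply: A0; rewrite mem_head.
by move=> M m spm; apply: (IH m M) => // b bA; apply: A0; rewrite inE bA orbT.
Qed.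

Lemma Gammas_cat A B f : Gammas (A ++ B) f = Gammas A (Gammas B f).
Proof. exact: foldr_cat. Qed.

Lemma delta_sum N f l : spart N.+1 l ->
  f l = \sum_(m <- parts N) f m * delta R m l.
Proof.
move=> spl; rewrite (bigD1_seq l) ?mem_parts ?uniq_parts //= /delta eqxx mulr1.
by rewrite big1 ?addr0 // => m /negbTE; rewrite eq_sym => ->; rewrite mulr0.
Qed.

(** Expansion of a functional that is additive on a class of functions stable
    under finite perturbations. *)
Lemma functional_sum (C : (seq nat -> R) -> Prop) (T : (seq nat -> R) -> R) f s :
  C (fun=> 0) -> T (fun=> 0) = 0 ->
  (forall g c m, C g -> C (fun l => c * delta R m l + g l) /\
     T (fun l => c * delta R m l + g l) = c * T (delta R m) + T g) ->
  C (fun l => \sum_(m <- s) f m * delta R m l) /\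
  T (fun l => \sum_(m <- s) f m * delta R m l) = \sum_(m <- s) f m * T (delta R m).
Proof.
move=> C0 T0 CT; elim: s => [|m s [Cs Ts]].
  rewrite big_nil -[X in C X]/(fun _ => _) (_ : (fun l => _) = fun=> 0) //.
  by apply: funext => l; rewrite big_nil.
rewrite big_cons (_ : (fun l => _) =
  fun l => f m * delta R m l + \sum_(m <- s) f m * delta R m l).
  by have [? ->] := CT _ (f m) m Cs; rewrite Ts.
by apply: funext => l; rewrite big_cons.
Qed.

Lemma Gammas_delta_sub N A m l : spart N l -> ~ part_sub m l -> Gammas A (delta R m) l = 0.
Proof.
move=> spl ml; rewrite -(Gammas0 A spl); apply: eq_Gammas spl => M m' _ m'l.
by rewrite /delta; case: eqP => // mm; rewrite mm in m'l.
Qed.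

Lemma Gammas_expand N A f l : spart N.+1 l ->
  Gammas A f l = \sum_(m <- parts N) f m * Gammas A (delta R m) l.
Proof.
move=> spl.
have [//|_ <-] := @functional_sum (fun=> True) (fun g => Gammas A g l) f (parts N) I (Gammas0 A spl).
  move=> g c m _; split=> //; rewrite -[Gammas A g l]mul1r -(Gammas_lin _ _ _ _ _ spl).
  by congr Gammas; apply: funext => m'; rewrite mul1r.
apply: eq_Gammas (spl) => M m spm ml; apply: delta_sum.
exact: part_sub_spart spm ml spl.
Qed.

(** Each step of the recursion lowers the first part by one and costs at most
    one factor a.  The leading term follows the repeated lowering; when the
    first part reaches the next part k, where put vanishes, the term
    a Gamma (put k) takes over. *)
Lemma Gamma_poly N f l : spart N l -> exists p : {poly R},
  [/\ forall a, Gamma a f l = p.[a], (size p <= (head 0%N l).+1)%N &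
      if l is x :: t then p`_x = 2 * f t else True].
Proof.
move=> spl; move: N l spl f; apply: spart_put_ind => [f|k t spt IHt IHk f].
  by exists (f [::])%:P; split=> // [a|]; rewrite ?hornerC // size_polyC; case: eqP.
have [p1 [ev1 sz1 _]] := IHt (put k.+1 f).
have [p2 [ev2 sz2 c2]] := IHt (put k f).
have hk : (head 0 t <= k)%N.
  by case: t spt {IHt IHk ev1 ev2 sz1 sz2 c2} => //= x t /and3P[_ + _]; rewrite ltnS.
have [p0 [ev0 sz0 c0]] : exists p : {poly R}, [/\ forall a, put k (Gamma a f) t = p.[a],
    (size p <= k.+1)%N & p`_k + p2`_k = 2 * f t].
  case: k spt IHk ev2 c2 {ev1 sz1} hk => [|k] spt IHk ev2 c2 hk.
    exists (f [::])%:P; rewrite (spart1 spt) in ev2 sz2 *; split=> [a||].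
    - by rewrite hornerC.
    - by rewrite size_polyC; case: eqP.
    - have := ev2 0; rewrite (size1_polyC sz2) hornerC /= => <-.
      by rewrite !coefC /= /put /=; ring.
  have [hk1|hk1] := eqVneq (head 0%N t) k.+1.
    exists 0; split=> [a||]; rewrite ?size_poly0 ?horner0 //.
      by rewrite /put /= hk1 eqxx.
    case: t hk1 spt c2 {IHt IHk ev2 sz2 hk} => //= x t -> /and3P[_ _ spt] ->.
    rewrite coef0 add0r /put /= ifN //; apply/eqP => ht.
    by case: t spt ht => //= y t /and3P[_ + _] yk; rewrite yk ltnn.
  have spt' : spart k.+1 t by apply: spart_notop => //; exact/eqP.
  have [p [ev sz c]] := IHk spt' isT f; exists p; split=> // [a|].
    by rewrite /put [k.+1 == 0%N]/= (negbTE hk1) -ev.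
  rewrite c [p2`_ _]nth_default ?addr0 //; apply: leq_trans sz2 _.
  by rewrite ltn_neqAle hk1.
exists ('X * p0 + p1 + 'X * p2); split=> [a||].
- by rewrite Gamma_cons // !hornerE ev0 ev1 ev2.
- rewrite /= !(leq_trans (size_polyD _ _)) // geq_max; apply/andP; split.
    rewrite (leq_trans (size_polyD _ _)) // geq_max; apply/andP; split.
      by rewrite mulrC (leq_trans (size_polyMleq _ _)) // size_polyX addn2 ltnS.
    by apply: leq_trans sz1 _; rewrite ltnS (leq_trans hk).
  rewrite mulrC (leq_trans (size_polyMleq _ _)) // size_polyX addn2 ltnS.
  by apply: leq_trans sz2 _; rewrite ltnS.
- rewrite !coefD !coefXM /= [p1`_ _]nth_default ?addr0 //.
  by apply: leq_trans sz1 _; rewrite ltnS.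
Qed.

(** Linear independence of the functions B |-> Q_l(B): the part N + 1 is
    detected by the leading coefficient in a new variable. *)
Lemma schurQ_free N (d : seq nat -> R) :
  (forall B, \sum_(l <- parts N) d l * Gammas B (delta R [::]) l = 0) ->
  forall l, l \in parts N -> d l = 0.
Proof.
elim: N d => [|N IH] d d0 l.
  have := d0 [::]; rewrite big_seq1 /= /delta eqxx mulr1 => dl.
  by rewrite inE => /eqP ->.
have top0 m : m \in parts N -> d (N.+1 :: m) = 0.
  apply: (IH (fun m => d (N.+1 :: m))) => B.
  set h := Gammas B _.
  have /choice[p Hp] m' : exists p : {poly R}, m' \in parts N.+1 ->
      [/\ forall a, Gamma a h m' = p.[a], (size p <= (head 0%N m').+1)%N &
      if m' is x :: t then p`_x = 2 * h t else True].
    have [mm|] := boolP (m' \in parts N.+1); last by exists 0.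
    rewrite mem_parts in mm; have [p Hp] := Gamma_poly h mm.
    by exists p.
  have : \sum_(l <- parts N.+1) (d l)%:P * p l = 0.
    apply: poly_eq0_real => a; rewrite horner_sum -[RHS](d0 (a :: B)).
    apply: eq_big_seq => m' mm; rewrite hornerM hornerC.
    by have [ev _ _] := Hp _ mm; rewrite -ev.
  move/(congr1 (fun q : {poly R} => q`_N.+1)); rewrite coef_sum coef0 big_cat /=.
  rewrite big_seq big1 ?add0r => [|m' mm]; last first.
    rewrite coefCM nth_default ?mulr0 //.
    have mm' : m' \in parts N.+1 by rewrite mem_cat mm.
    have [_ sz _] := Hp _ mm'; apply: leq_trans sz _.
    by move: mm; rewrite mem_parts; case: m' {mm'} => //= x t /and3P[].
  rewrite big_map => H2.
  apply: (@mulfI _ 2); first by rewrite pnatr_eq0.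
  rewrite mulr0 -[RHS]H2 mulr_sumr; apply: eq_big_seq => m' mm.
  have mm' : (N.+1 :: m') \in parts N.+1.
    by rewrite mem_cat orbC map_f.
  by rewrite coefCM; have [_ _ ->] := Hp _ mm'; ring.
rewrite mem_cat => /orP[|/mapP[m mm ->]]; last exact: top0.
apply: IH => B; have := d0 B; rewrite big_cat /= big_map.
by rewrite [X in _ + X]big_seq [X in _ + X]big1 ?addr0 // => m mm; rewrite top0 ?mul0r.
Qed.

(** Gamma_(A ++ B) = Gamma_A Gamma_B, expanded over the indicators of mu,
    gives coefficients with the defining property of the skew functions; they
    are the only ones by schurQ_free. *)
Theorem skewQ_Gammas A lam mu : strict_partition lam -> strict_partition mu ->
  part_sub mu lam -> skewQ lam mu A = Gammas A (delta R mu) lam.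
Proof.
move=> slam smu mulam; have spl := strict_spart slam; set N := head 0%N lam in spl.
pose s := [seq nu <- parts N | `[< part_sub nu lam >]].
have sE : [set nu | strict_partition nu /\ part_sub nu lam]%classic = [set` s]%classic.
  apply/seteqP; split=> nu /=; rewrite mem_filter mem_parts.
    case=> snu nl; apply/andP; split; first exact/asboolP.
    exact: part_sub_spart (strict_spart snu) nl spl.
  by case/andP=> /asboolP nl spn; split=> //; exact: spart_strict spn.
have us : uniq s by rewrite filter_uniq ?uniq_parts.
have sumE (F : seq nat -> R) :
    (\sum_(nu \in [set nu | strict_partition nu /\ part_sub nu lam]%classic) F nu =
    \sum_(nu <- parts N | `[< part_sub nu lam >]) F nu)%R.
  by rewrite sE -fsbig_seq // big_filter.
have Qsum (c : seq nat -> R) B :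
    \sum_(nu <- parts N | `[< part_sub nu lam >]) c nu * schurQ nu B =
    \sum_(nu <- parts N | `[< part_sub nu lam >]) c nu * Gammas B (delta R [::]) nu.
  rewrite big_seq_cond [RHS]big_seq_cond; apply: eq_bigr => nu /andP[+ _].
  by rewrite mem_parts => /spart_strict /schurQ_Gammas ->.
rewrite /skewQ; set S := (X in xget _ X).
have S0 : S (fun nu => Gammas A (delta R nu) lam).
  move=> B; rewrite sumE Qsum schurQ_Gammas // Gammas_cat (Gammas_expand _ _ spl).
  rewrite [RHS]big_mkcond; apply: eq_bigr => nu _.
  by case: asboolP => [_|nl]; rewrite mulrC // (Gammas_delta_sub _ spl nl) mul0r.
have Sx : S (xget (fun=> 0) S) by apply: xgetPex; exists (fun nu => Gammas A (delta R nu) lam).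
move: (xget _ _) Sx => c Sc.
apply/eqP; rewrite -subr_eq0; apply/eqP.
pose d nu := if `[< part_sub nu lam >] then c nu - Gammas A (delta R nu) lam else 0.
have -> : c mu - Gammas A (delta R mu) lam = d mu.
  by rewrite /d; case: asboolP.
apply: (@schurQ_free N); last first.
  by rewrite mem_parts; exact: part_sub_spart (strict_spart smu) mulam spl.
move=> B; have := Sc B; have := S0 B; rewrite !sumE !Qsum => -> /eqP.
rewrite eq_sym -subr_eq0 -sumrB => /eqP E; rewrite -[RHS]E [RHS]big_mkcond.
apply: eq_bigr => nu _; rewrite /d; case: asboolP => _; by rewrite ?mul0r // mulrBl.
Qed.

End SkewQ.

(** * Growth of coordinates *)

Section Weights.
Variable R : realType.
Implicit Types (a c t C : R) (f g h F : seq nat -> R) (l m : seq nat) (u v : int).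

(** The weight t^|l| c^length.  Its sum over strict partitions is the product of
    the factors 1 + c t^k, finite for t < 1 whatever c is; the constant c absorbs
    what each part may cost under the operators. *)
Definition weight c t l : R := \prod_(k <- l) (c * t ^+ k).

Lemma weight_cons c t k l : weight c t (k :: l) = c * t ^+ k * weight c t l.
Proof. by rewrite /weight big_cons. Qed.

Lemma weight_ge0 c t l : 0 <= c -> 0 <= t -> 0 <= weight c t l.
Proof. by move=> c0 t0; apply: prodr_ge0 => k _; rewrite mulr_ge0 ?exprn_ge0. Qed.

Lemma weight_le c c' t l : 0 <= c -> c <= c' -> 0 <= t -> weight c t l <= weight c' t l.
Proof.
move=> c0 cc t0; elim: l => [|k l IH]; first by rewrite /weight !big_nil.
rewrite !weight_cons ler_pM ?weight_ge0 ?mulr_ge0 ?exprn_ge0 //.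
by rewrite ler_wpM2r ?exprn_ge0.
Qed.

Lemma wtM c c' t t' l : weight c t l * weight c' t' l = weight (c * c') (t * t') l.
Proof.
by rewrite /weight -big_split; apply: eq_bigr => k _ /=; rewrite exprMn; ring.
Qed.

Definition wbounded C c t f := forall N l, spart N l -> `|f l| <= C * weight c t l.

(** For fixed t these vectors are preserved by the modes and, if a < t, by
    Gamma a; the constant c may grow at each application. *)
Definition tame t f := exists C c, [/\ 0 <= C, 1 <= c & wbounded C c t f].

Lemma wbounded_le C c C' c' t f : 0 <= C -> 0 <= c -> 0 <= t -> C <= C' -> c <= c' ->
  wbounded C c t f -> wbounded C' c' t f.
Proof.
move=> C0 c0 t0 CC cc b N l spl; apply: le_trans (b N l spl) _.
by apply: ler_pM => //; [exact: weight_ge0 | exact: weight_le].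
Qed.

Lemma wbounded_delta t m : 0 < t -> wbounded (weight 1 t m)^-1 1 t (delta R m).
Proof.
move=> t0 N l spl; have wt_gt0 l' : 0 < weight 1 t l'.
  by apply: prodr_gt0 => k _; rewrite mul1r exprn_gt0.
rewrite /delta; case: eqP => [->|_]; first by rewrite normr1 mulVf ?gt_eqF.
by rewrite normr0 mulr_ge0 // ?invr_ge0 ltW.
Qed.

Lemma wbounded_Psi C c t u f : 0 <= C -> 1 <= c -> 0 < t -> wbounded C c t f ->
  wbounded (2 * c * t ^ (- u) * C) c t (Psi u f).
Proof.
move=> C0 c1 t0 b; have c0 : 0 <= c by apply: le_trans c1.
have t0' := ltW t0.
suff H M l : (`|u| < M)%N -> spart M l -> forall C f, 0 <= C ->
    (forall m, spart M m -> `|f m| <= C * weight c t m) ->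
    `|Psi u f l| <= 2 * c * t ^ (- u) * C * weight c t l.
  move=> N l spl; apply: (H (maxn N `|u|.+1)) => //.
  - by rewrite leq_max ltnSn orbT.
  - by apply: spart_le spl; rewrite leq_maxl.
  - by move=> m; exact: b.
elim: l M {C C0 f b} => [|k l IH] M uM spl C f C0 b.
  case: u uM => [[|k]|k] uM /=.
  - rewrite oppr0 expr0z mulr1 (le_trans (b [::] isT)) //.
    rewrite /weight big_nil !mulr1 -[X in X <= _]mul1r ler_wpM2r //; lra.
  - by rewrite normr0 mulr_ge0 ?weight_ge0 // mulr_ge0 // mulr_ge0 ?exprz_ge0 // mulr_ge0.
  - rewrite normrM normrX normrN1 expr1n mul1r (le_trans (b _ _)) //=.
      by rewrite uM.
    rewrite /weight big_seq1 big_nil mulr1 NegzE opprK -exprnP.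
    have : 0 <= c * t ^+ k.+1 * C by rewrite !mulr_ge0 ?exprn_ge0.
    by move=> ?; nra.
have [k0 kM spl'] : [/\ (0 < k)%N, (k < M)%N & spart k l] by case/and3P: spl.
have [uk|ku] := ltnP `|u| k.
  rewrite Psi_cons // normrN.
  have Ck0 : 0 <= C * (c * t ^+ k) by rewrite !mulr_ge0 ?exprn_ge0.
  have := IH k uk spl' _ (fun m => f (k :: m)) Ck0 _.
  rewrite weight_cons => H; apply: le_trans (H _) _; last by rewrite le_eqVlt; apply/orP; left; apply/eqP; ring.
  move=> m spm; apply: le_trans (b _ _) _; first by rewrite spart_cons k0 kM.
  by rewrite weight_cons !mulrA.
have spu : spart `|u|.+1 (k :: l) by rewrite spart_cons k0 ltnS ku.
have pos : 0 <= 2 * c * t ^ (- u) * C * weight c t (k :: l).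
  by rewrite mulr_ge0 ?weight_ge0 // mulr_ge0 // mulr_ge0 ?exprz_ge0 // mulr_ge0.
rewrite Psi_topE //; case: u uM ku spu pos {IH} => [[|j]|j] uM ku spu pos /=.
- by move: ku k0; rewrite leqn0 => /eqP ->.
- case: eqP => [kj|_]; last by rewrite normr0.
  rewrite normrM ger0_norm // -kj weight_cons.
  have spM : spart M l by apply: spart_le spl'; exact: ltnW.
  have := b l spM; have := weight_ge0 l c0 t0'; move: (weight c t l) => w w0 fw.
  have tk : 0 < t ^+ k by rewrite exprn_gt0.
  have -> : t ^ (- Posz k) = (t ^+ k)^-1 by rewrite -exprnN exprnP.
  have -> : 2 * c / t ^+ k * C * (c * t ^+ k * w) = 2 * (c * c * C * w).
    by field; rewrite gt_eqF.
  rewrite ler_wpM2l // (le_trans fw) // ler_wpM2r // -[X in X <= _]mul1r ler_wpM2r //.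
  by nra.
- case: eqP => [kj|/eqP kj]; first by rewrite normr0.
  rewrite normrM normrX normrN1 expr1n mul1r.
  have spj : spart M (j.+1 :: k :: l).
    by rewrite !spart_cons uM k0 spl' andbT /= [(k < _)%N]ltn_neqAle kj.
  apply: le_trans (b _ spj) _; rewrite [weight c t (j.+1 :: _)]weight_cons NegzE opprK -exprnP.
  have := weight_ge0 (k :: l) c0 t0'; move: (weight c t (k :: l)) => w w0.
  have : 0 <= c * t ^+ j.+1 * C * w by rewrite !mulr_ge0 ?exprn_ge0.
  by move=> ?; nra.
Qed.

(** The condition on c' is the recursion of Gamma, applied to weights and divided
    by the weight of the tail and by t^k. *)
Lemma wbounded_Gamma C c c' a t f : 0 <= C -> 1 <= c -> c <= c' -> 0 <= a -> 0 < t ->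
  a * c' + c * t + a * c <= c' * t ->
  wbounded C c t f -> wbounded C c' t (Gamma a f).
Proof.
move=> C0 c1 cc a0 t0 cct b.
have c0 : 0 <= c by apply: le_trans c1.
have c'0 : 0 <= c' by apply: le_trans cc.
have t0' := ltW t0.
have : forall N l, spart N l -> forall C f, 0 <= C ->
    (forall M m, spart M m -> part_sub m l -> `|f m| <= C * weight c t m) ->
    `|Gamma a f l| <= C * weight c' t l.
  clear b; apply: spart_put_ind => [C' f' C'0 b|k l spl IHl IHk C' f' C'0 b].
    by have := b 0%N [::] isT (part_sub_refl _); rewrite /weight !big_nil.
  have headm M m : spart M m -> part_sub m l -> spart k.+1 m.
    by move=> spm mt; apply: part_sub_spart spm mt spl.
  have w0 := weight_ge0 l c'0 t0'; set w := weight c' t l in w0 *.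
  have Tk (j : nat) : 0 <= t ^+ j by rewrite exprn_ge0.
  have B1 : `|Gamma a (put k.+1 f') l| <= C' * (c * t ^+ k.+1) * w.
    apply: IHl => [|M m spm ml]; first by rewrite !mulr_ge0.
    rewrite /put /=; case: eqP => hk.
      by rewrite normr0 mulr_ge0 ?weight_ge0 ?mulr_ge0.
    rewrite (le_trans (b k.+2 _ _ _)) ?weight_cons ?mulrA //; last exact: part_sub_cons.
    by rewrite spart_cons ltnSn (headm M).
  have B2 : `|Gamma a (put k f') l| <= C' * (c * t ^+ k) * w.
    apply: IHl => [|M m spm ml]; first by rewrite !mulr_ge0.
    rewrite /put; case: k spl headm b {IHk B1} => [|k] spl headm b /=.
      have m0 := spart1 (headm _ _ spm ml); rewrite m0 /weight big_nil expr0 !mulr1.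
      apply: le_trans (b 0%N [::] isT _) _; first by case.
      by rewrite /weight big_nil mulr1 -[X in X <= _]mulr1 ler_wpM2l.
    case: eqP => hk; first by rewrite normr0 mulr_ge0 ?weight_ge0 ?mulr_ge0.
    rewrite (le_trans (b k.+3 _ _ _)) ?weight_cons ?mulrA //; last exact: part_sub_cons.
    by rewrite spart_cons ltnS leqnSn /= (spart_notop (headm _ _ spm ml)).
  have B0 : `|put k (Gamma a f') l| <= C' * (c' * t ^+ k) * w.
    rewrite /put; case: k spl IHk b {headm B1 B2} => [|k] spl IHk b /=.
      rewrite (spart1 spl) /= /w (spart1 spl) /weight big_nil expr0 !mulr1.
      apply: le_trans (b 0%N [::] isT _) _; first by case.
      rewrite /weight big_nil mulr1 -[X in X <= _]mulr1 ler_wpM2l //.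
      exact: le_trans cc.
    case: eqP => hk; first by rewrite normr0 !mulr_ge0.
    have spk : spart k.+1 l by apply: spart_notop.
    rewrite (le_trans (IHk spk isT C' f' C'0 _)) ?weight_cons ?mulrA // => M m spm ml.
    by apply: (b M) => //; apply: part_sub_trans ml _; apply: part_sub_cons.
  rewrite Gamma_cons // weight_cons -/w.
  have -> : C' * (c' * t ^+ k.+1 * w) = C' * t ^+ k * w * (c' * t) by rewrite exprS; ring.
  apply: le_trans (ler_normD _ _) _; rewrite normrM (ger0_norm a0).
  apply: le_trans (lerD (ler_normD _ _) (lexx _)) _; rewrite normrM (ger0_norm a0).
  apply: le_trans (lerD (lerD (ler_wpM2l a0 B0) B1) (ler_wpM2l a0 B2)) _.
  have -> : a * (C' * (c' * t ^+ k) * w) + C' * (c * t ^+ k.+1) * w +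
     a * (C' * (c * t ^+ k) * w) = C' * t ^+ k * w * (a * c' + c * t + a * c).
    by rewrite exprS; ring.
  by rewrite ler_wpM2l // !mulr_ge0.
move=> H N l spl; apply: H spl _ _ C0 _ => M m spm _; exact: b spm.
Qed.

End Weights.

(** * Sums over strict partitions and the pairing *)

Section Sums.
Variable R : realType.
Implicit Types (a b c t C : R) (f g h F G : seq nat -> R) (l m : seq nat) (u v : int).

(** The partial sums of a sum over all strict partitions. *)
Definition psum N F : R := \sum_(l <- parts N) F l.

Lemma psumS N F : psum N.+1 F = psum N F + psum N (fun l => F (N.+1 :: l)).
Proof. by rewrite /psum /= big_cat big_map. Qed.

Lemma psum0 F : psum 0 F = F [::].
Proof. by rewrite /psum big_seq1. Qed.

Lemma eq_psum N F G : (forall l, spart N.+1 l -> F l = G l) -> psum N F = psum N G.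
Proof. by move=> FG; apply: eq_big_seq => l; rewrite mem_parts => /FG. Qed.

Lemma psum_lin N b c F G :
  psum N (fun l => b * F l + c * G l) = b * psum N F + c * psum N G.
Proof. by rewrite /psum big_split !mulr_sumr. Qed.

Lemma ler_psum N F G : (forall l, spart N.+1 l -> F l <= G l) -> psum N F <= psum N G.
Proof.
move=> FG; rewrite /psum big_seq [leRHS]big_seq.
by apply: ler_sum => l; rewrite mem_parts => /FG.
Qed.

Lemma ler_norm_psum N F : `|psum N F| <= psum N (fun l => `|F l|).
Proof. exact: ler_norm_sum. Qed.

(** A strict partition is a choice of a set of parts. *)
Lemma psum_weight N c t : psum N (weight c t) = \prod_(k < N) (1 + c * t ^+ k.+1).
Proof.
elim: N => [|N IH]; first by rewrite psum0 big_ord0 /weight big_nil.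
rewrite psumS big_ord_recr /= -IH mulrDr mulr1; congr (_ + _).
by rewrite /psum mulr_suml; apply: eq_bigr => l _; rewrite weight_cons mulrC.
Qed.

Lemma psum_weight_le N c t : 0 <= c -> 0 <= t -> t < 1 ->
  psum N (weight c t) <= expR (c / (1 - t)).
Proof.
move=> c0 t0 t1; rewrite psum_weight.
apply: (@le_trans _ _ (expR (\sum_(k < N) c * t ^+ k.+1))).
  rewrite expR_sum; apply: ler_prod => k _; rewrite expR_ge1Dx andbT.
  by rewrite addr_ge0 // mulr_ge0 // exprn_ge0.
rewrite ler_expR -mulr_sumr ler_wpM2l //.
have t1' : 0 < 1 - t by rewrite subr_gt0.
rewrite -[leRHS]mul1r ler_pdivlMr // mulrC mulr_sumr.
have -> : \sum_(k < N) (1 - t) * t ^+ k.+1 = t - t ^+ N.+1.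
  elim: N => [|N IH]; first by rewrite big_ord0 expr1 subrr.
  by rewrite big_ord_recr /= IH [t ^+ N.+2]exprS; ring.
by rewrite lerBlDr (le_trans (ltW t1)) // lerDl exprn_ge0.
Qed.

Lemma psum_homo F : (forall N l, spart N l -> 0 <= F l) ->
  {homo (fun N => psum N F) : n m / (n <= m)%N >-> n <= m}.
Proof.
move=> F0; apply: homo_leq => [//|N M K|N]; first exact: le_trans.
rewrite psumS lerDl /psum big_seq sumr_ge0 // => l; rewrite mem_parts => spl.
by apply: (F0 N.+2); rewrite spart_cons ltnSn.
Qed.

(** Domination by a weight with t < 1, the form of absolute convergence used
    throughout. *)
Definition wsummable_by C c t F := [/\ 0 <= C, 0 <= c, 0 <= t, t < 1 &
  forall N l, spart N l -> `|F l| <= C * weight c t l].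

Definition wsummable F := exists C c t, wsummable_by C c t F.

Lemma cvg_psum_ge0 C c t F : wsummable_by C c t F -> (forall N l, spart N l -> 0 <= F l) ->
  cvgn (fun N => psum N F).
Proof.
move=> [C0 c0 t0 t1 FW] F0; apply: nondecreasing_is_cvgn; first exact: psum_homo.
exists (C * expR (c / (1 - t))) => _ [N _ <-].
apply: (@le_trans _ _ (psum N (fun l => C * weight c t l + 0 * 0))).
  apply: ler_psum => l spl; rewrite mul0r addr0.
  by rewrite (le_trans _ (FW _ _ spl)) // ler_norm.
by rewrite (psum_lin _ _ _ _ (fun=> 0)) mul0r addr0 ler_wpM2l // psum_weight_le.
Qed.

Lemma wsummable_weight c t : 0 <= c -> 0 <= t -> t < 1 -> wsummable_by 1 c t (weight c t).
Proof.
by move=> c0 t0 t1; split=> // N l _; rewrite mul1r ger0_norm // weight_ge0.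
Qed.

Lemma cvg_psum F : wsummable F -> cvgn (fun N => psum N F).
Proof.
move=> [C [c [t [C0 c0 t0 t1 FW]]]].
have S1 : wsummable_by (2 * C) c t (fun l => 1 * F l + C * weight c t l).
  split; rewrite ?mulr_ge0 // => N l spl; have := FW _ _ spl.
  rewrite mul1r mulr2n mulrDl mul1r mulrDl => H.
  apply: le_trans (ler_normD _ _) _; rewrite lerD // ger0_norm // mulr_ge0 //.
  exact: weight_ge0.
have cv1 := cvg_psum_ge0 S1 _; have cv2 := cvg_psum_ge0 (wsummable_weight c0 t0 t1) _.
rewrite (_ : (fun N => _) = (fun N => psum N (fun l => 1 * F l + C * weight c t l))
   \- (fun N => C * psum N (weight c t))); last first.
  by apply: funext => N; rewrite /= psum_lin; ring.
apply: is_cvgB.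
  apply: cv1 => N l spl; have := FW _ _ spl; rewrite ler_norml => /andP[+ _].
  by rewrite mul1r -subr_ge0 opprK addrC.
by apply: is_cvgMl_tmp; apply: cv2 => N l _; exact: weight_ge0.
Qed.

Definition psum_lim F : R := limn (fun N => psum N F).

Lemma cvg_psum_lim F : wsummable F -> psum^~ F @ \oo --> psum_lim F.
Proof. exact: cvg_psum. Qed.

Lemma cvg_psum_limE (F : seq nat -> R) x : psum^~ F @ \oo --> x -> psum_lim F = x.
Proof. by move=> Fx; apply: cvg_lim. Qed.

Lemma psum_lim_lin b c F G : wsummable F -> wsummable G ->
  psum_lim (fun l => b * F l + c * G l) = b * psum_lim F + c * psum_lim G.
Proof.
move=> sF sG; apply: cvg_psum_limE; rewrite (_ : psum^~ _ =
  (fun N => b * psum N F) \+ (fun N => c * psum N G)); last first.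
  by apply: funext => N; rewrite psum_lin.
by apply: cvgD; apply: cvgMl_tmp; exact: cvg_psum_lim.
Qed.

Lemma eq_psum_lim F G : (forall N l, spart N l -> F l = G l) -> psum_lim F = psum_lim G.
Proof.
move=> FG; rewrite /psum_lim (_ : psum^~ F = psum^~ G) //.
by apply: funext => N; apply: eq_psum => l; exact: FG.
Qed.

(** Equal eventual partial sums give equal limits, or no limit for both. *)
Lemma eq_psum_lim_near M F G : (forall N, (M <= N)%N -> psum N F = psum N G) ->
  psum_lim F = psum_lim G.
Proof.
move=> FG; rewrite /psum_lim; congr (lim _); apply/seteqP; split=> A /=.
  move=> [N _ H]; exists (maxn M N) => // n /=; rewrite geq_max => /andP[Mn Nn].
  by rewrite /= -FG //; exact: H.
move=> [N _ H]; exists (maxn M N) => // n /=; rewrite geq_max => /andP[Mn Nn].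
by rewrite /= FG //; exact: H.
Qed.

Lemma psum_lim_le C c t F : wsummable_by C c t F -> `|psum_lim F| <= C * expR (c / (1 - t)).
Proof.
move=> sF; have cv : psum^~ F @ \oo --> psum_lim F by apply: cvg_psum_lim; exists C, c, t.
have [C0 c0 t0 t1 FW] := sF.
rewrite -lim_norm; last by apply/cvg_ex; eexists; exact: cv.
apply: limr_le; first by apply: is_cvg_norm; apply/cvg_ex; eexists; exact: cv.
apply: nearW => N; apply: le_trans (ler_norm_psum _ _) _.
apply: (@le_trans _ _ (psum N (fun l => C * weight c t l + 0 * 0))).
  by apply: ler_psum => l spl; rewrite mul0r addr0; exact: FW spl.
by rewrite (psum_lin _ _ _ _ (fun=> 0)) mul0r addr0 ler_wpM2l // psum_weight_le.
Qed.

(** The error made by a truncation of a vector to the parts at most N. *)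
Lemma psum_lim_tail C c t N F : wsummable_by C c t F -> (forall l, spart N.+1 l -> F l = 0) ->
  `|psum_lim F| <= C * (psum_lim (weight c t) - psum N (weight c t)).
Proof.
move=> sF F0; have cv : psum^~ F @ \oo --> psum_lim F by apply: cvg_psum_lim; exists C, c, t.
have [C0 c0 t0 t1 FW] := sF.
have cvW : psum^~ (weight c t) @ \oo --> psum_lim (weight c t).
  by apply: cvg_psum_lim; exists 1, c, t; exact: wsummable_weight.
rewrite -lim_norm; last by apply/cvg_ex; eexists; exact: cv.
apply: limr_le; first by apply: is_cvg_norm; apply/cvg_ex; eexists; exact: cv.
exists N => // M /= NM.
apply: (@le_trans _ _ (C * (psum M (weight c t) - psum N (weight c t)))); last first.
  rewrite ler_wpM2l // lerD2r; apply: nondecreasing_cvgn_le.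
    by apply: psum_homo => K l _; exact: weight_ge0.
  by apply/cvg_ex; eexists; exact: cvW.
rewrite -(subnK NM); elim: (M - N)%N => [|k IH].
  rewrite add0n subrr mulr0 (@eq_psum N F (fun=> 0)) ?normr_le0 //.
  by rewrite /psum big1.
rewrite addSn !psumS (le_trans (ler_normD _ _)) //.
rewrite addrAC mulrDr lerD //; apply: le_trans (ler_norm_psum _ _) _.
rewrite /psum mulr_sumr big_seq [leRHS]big_seq; apply: ler_sum => l.
by rewrite mem_parts => spl; apply: (FW (k + N).+2); rewrite spart_cons ltnSn.
Qed.

(** The factor 2^-length compensates the asymmetry between creation and
    annihilation in Psi, and makes Phi u adjoint to Psi u. *)
Definition pair_term g f l : R := 2 ^- size l * (g l * f l).
Definition pairing g f : R := psum_lim (pair_term g f).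

Lemma psum_adjoint N u g f : (`|u| <= N)%N ->
  psum N (pair_term g (Psi u f)) = psum N (pair_term (Phi u g) f).
Proof.
elim: N g f => [|N IH] g f.
  by case: u => [[|k]|k] // _; rewrite !psum0 /pair_term /Phi /= !mul1r.
rewrite leq_eqVlt => /orP[/eqP uN|uN]; last first.
  rewrite !psumS IH //; congr (_ + _).
  have pull F G : (forall l, F l = - (2^-1) * G l) -> psum N F = - (2^-1) * psum N G.
    by move=> FG; rewrite /psum mulr_sumr; apply: eq_bigr => l _.
  rewrite (pull _ (pair_term (fun l => g (N.+1 :: l)) (Psi u (fun l => f (N.+1 :: l))))).
    rewrite IH //; apply/esym/pull => l; rewrite /pair_term /Phi Psi_cons /=; last by lia.
    by rewrite exprS invfM; ring.
  by move=> l; rewrite /pair_term Psi_cons //= exprS invfM; ring.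
rewrite !psumS; have two : 2 != 0 :> R by rewrite pnatr_eq0.
have vanish F : (forall l, spart N.+1 l -> F l = 0) -> psum N F = 0.
  by move=> F0; rewrite (eq_psum F0) /psum big1.
case: u {IH} uN => [[|k]|k] //= -[kN]; subst k.
  rewrite [X in X + _ = _]vanish => [|l spl]; last first.
    by rewrite /pair_term Psi_create_out // !mulr0.
  rewrite [X in _ = _ + X]vanish => [|l spl]; last first.
    by rewrite /pair_term /Phi Psi_kill_in mulr0 mul0r mulr0.
  rewrite add0r addr0; apply: eq_psum => l spl.
  rewrite /pair_term /Phi Psi_create_in -NegzE (Psi_kill_out _ spl) signrMK [size _]/=.
  by rewrite exprS invfM; field; rewrite expf_neq0.
rewrite [X in _ + X = _]vanish => [|l spl]; last first.
  by rewrite /pair_term Psi_kill_in !mulr0.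
rewrite [X in _ = X + _]vanish => [|l spl]; last first.
  by rewrite /pair_term /Phi NegzE opprK Psi_create_out // mulr0 mul0r mulr0.
rewrite add0r addr0; apply: eq_psum => l spl.
rewrite /pair_term /Phi Psi_kill_out // NegzE opprK Psi_create_in [size _]/= [2 ^+ _.+1]exprS invfM.
by field; rewrite expf_neq0.
Qed.

(** The partial sums agree from N = |u| on, so that no convergence is needed. *)
Lemma pairing_adjoint u g f : pairing g (Psi u f) = pairing (Phi u g) f.
Proof. by apply: (eq_psum_lim_near (M := `|u|%N)) => N; exact: psum_adjoint. Qed.

Lemma pairing_delta0 g : pairing g (delta R [::]) = g [::].
Proof.
apply: cvg_psum_limE; rewrite (_ : psum^~ _ = fun=> g [::]); first exact: cvg_cst.
apply: funext => N; rewrite /psum (bigD1_seq [::]) ?uniq_parts ?mem_parts //=.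
rewrite /pair_term /delta eqxx expr0 invr1 mul1r mulr1 big1 ?addr0 // => l /negbTE ->.
by rewrite !mulr0.
Qed.

Lemma eq_pairing g g' f f' : (forall N l, spart N l -> g l = g' l) ->
  (forall N l, spart N l -> f l = f' l) -> pairing g f = pairing g' f'.
Proof.
by move=> gg ff; apply: eq_psum_lim => N l spl; rewrite /pair_term (gg _ _ spl) (ff _ _ spl).
Qed.

Lemma wbounded_pair_term Cg cg r Cf cf t g f : 0 <= Cg -> 0 <= Cf -> 0 <= cg -> 0 <= cf ->
  0 <= r -> 0 <= t -> r * t < 1 ->
  wbounded Cg cg r g -> wbounded Cf cf t f -> wsummable_by (Cg * Cf) (cg * cf) (r * t) (pair_term g f).
Proof.
move=> Cg0 Cf0 cg0 cf0 r0 t0 rt gW fW; split; rewrite ?mulr_ge0 // => N l spl.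
rewrite /pair_term normrM -wtM normrM.
have -> : Cg * Cf * (weight cg r l * weight cf t l) = 1 * ((Cg * weight cg r l) * (Cf * weight cf t l)).
  by ring.
rewrite ler_pM ?normr_ge0 ?mulr_ge0 //; last first.
  by rewrite ler_pM ?normr_ge0 //; [exact: gW spl | exact: fW spl].
rewrite ger0_norm ?invr_ge0 ?exprn_ge0 // invf_le1 ?exprn_gt0 //.
by rewrite exprn_ege1 // ler1n.
Qed.

Lemma wsummable_pair_term r t g f : 0 <= r -> 0 <= t -> r * t < 1 ->
  tame r g -> tame t f -> wsummable (pair_term g f).
Proof.
move=> r0 t0 rt [Cg [cg [Cg0 cg1 gW]]] [Cf [cf [Cf0 cf1 fW]]].
exists (Cg * Cf), (cg * cf), (r * t); apply: wbounded_pair_term => //.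
  by apply: le_trans cg1.
by apply: le_trans cf1.
Qed.

Lemma pairing_lin_r r t b c g f f' : 0 <= r -> 0 <= t -> r * t < 1 ->
  tame r g -> tame t f -> tame t f' ->
  pairing g (fun l => b * f l + c * f' l) = b * pairing g f + c * pairing g f'.
Proof.
move=> r0 t0 rt gW fW f'W; rewrite /pairing -psum_lim_lin; try exact: (wsummable_pair_term r0 t0 rt).
by apply: eq_psum_lim => N l _; rewrite /pair_term; ring.
Qed.

Lemma pairing_sym g f : pairing g f = pairing f g.
Proof. by apply: eq_psum_lim => N l _; rewrite /pair_term [g l * _]mulrC. Qed.

End Sums.

(** * The adjoint of the one-variable operator *)

Section Cauchy.
Variable R : realType.
Implicit Types (a b c t r y C : R) (f g h F G : seq nat -> R) (l m : seq nat) (u v : int).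

Lemma tame_lin t b c f g : 0 < t -> tame t f -> tame t g ->
  tame t (fun l => b * f l + c * g l).
Proof.
move=> t0 [C [cf [C0 cf1 fW]]] [D [cg [D0 cg1 gW]]].
have cf0 : 0 <= cf by apply: le_trans cf1.
have cg0 : 0 <= cg by apply: le_trans cg1.
exists (`|b| * C + `|c| * D), (Num.max cf cg); split.
- by rewrite addr_ge0 // mulr_ge0.
- by rewrite le_max cf1.
move=> N l spl; apply: le_trans (ler_normD _ _) _; rewrite mulrDl !normrM -!mulrA.
have fW' := wbounded_le C0 cf0 (ltW t0) (lexx C) (_ : cf <= Num.max cf cg) fW.
have gW' := wbounded_le D0 cg0 (ltW t0) (lexx D) (_ : cg <= Num.max cf cg) gW.
by rewrite lerD // ler_wpM2l //; [apply: fW' spl | apply: gW' spl]; rewrite le_max lexx ?orbT.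
Qed.

Lemma tame_eq t f g : (forall N l, spart N l -> f l = g l) -> tame t f -> tame t g.
Proof.
move=> fg [C [c [C0 c1 fW]]]; exists C, c; split=> // N l spl.
by rewrite -(fg N l spl); exact: fW spl.
Qed.

Lemma tame_delta t m : 0 < t -> tame t (delta R m).
Proof.
move=> t0; exists (weight 1 t m)^-1, 1; split=> //; last exact: wbounded_delta.
by rewrite invr_ge0 weight_ge0 // ltW.
Qed.

Lemma tame0 t : 0 < t -> tame t (fun=> 0 : R).
Proof.
by move=> t0; exists 0, 1; split=> // N l _; rewrite normr0 mul0r.
Qed.

Lemma tame_Psi t u f : 0 < t -> tame t f -> tame t (Psi u f).
Proof.
move=> t0 [C [c [C0 c1 fW]]]; exists (2 * c * t ^ (- u) * C), c; split=> //.
  have c0 : 0 <= c by apply: le_trans c1.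
  by rewrite !mulr_ge0 // exprz_ge0 // ltW.
exact: wbounded_Psi.
Qed.

Lemma tame_Phi t u f : 0 < t -> tame t f -> tame t (Phi u f).
Proof.
move=> t0 fW; apply: (tame_eq (f := fun l => (-1) ^+ `|u| * Psi (- u) f l + 0 * f l)).
  by move=> N l _; rewrite mul0r addr0.
by apply: tame_lin => //; exact: tame_Psi.
Qed.

(** The constant c' = c (t + a) / (t - a) is the value of the factor
    (1 + a / z) / (1 - a / z) at z = t. *)
Lemma wbounded_Gamma_ex c a t : 1 <= c -> 0 <= a -> a < t ->
  exists2 c', 1 <= c' &
    forall C f, 0 <= C -> wbounded C c t f -> wbounded C c' t (Gamma a f).
Proof.
move=> c1 a0 at_; have t0 : 0 < t by apply: le_lt_trans at_.
have d0 : 0 < t - a by rewrite subr_gt0.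
pose c' := c * (t + a) / (t - a).
have c'E : c' * (t - a) = c * (t + a) by rewrite /c' mulfVK // gt_eqF.
have cc' : c <= c'.
  rewrite /c' ler_pdivlMr //; have : 0 <= c by apply: le_trans c1.
  by move=> ?; nra.
exists c' => [|C f C0 fW]; first by apply: le_trans cc'.
by apply: wbounded_Gamma fW => //; move: c'E; rewrite mulrBr mulrDr; lra.
Qed.

Lemma tame_Gamma t a f : 0 <= a -> a < t -> tame t f -> tame t (Gamma a f).
Proof.
move=> a0 at_ [C [c [C0 c1 fW]]]; have [c' c'1 GW] := wbounded_Gamma_ex c1 a0 at_.
by exists C, c'; split=> //; exact: GW.
Qed.

Lemma tame_Gammas t A f : (forall a, a \in A -> 0 <= a < t) -> tame t f -> tame t (Gammas A f).
Proof.
elim: A => //= a A IH At ft; have /andP[a0 at_] := At a (mem_head _ _).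
by apply: tame_Gamma => //; apply: IH => // b bA; apply: At; rewrite inE bA orbT.
Qed.

Lemma psum_lim0 F : (forall N l, spart N l -> F l = 0) -> psum_lim F = 0.
Proof.
move=> F0; apply: cvg_psum_limE; rewrite (_ : (fun N => psum N F) = (fun=> 0 : R)).
  exact: cvg_cst.
by apply: funext => K; rewrite (eq_psum (F0 K.+1)) /psum big1.
Qed.

Section Lowering.
Variables (a t r : R).
Hypotheses (a0 : 0 <= a) (at_ : a < t) (r0 : 0 < r) (rt : r * t < 1).

Let t0 : 0 < t. Proof. exact: le_lt_trans at_. Qed.
Let tr : t * r < 1. Proof. by rewrite mulrC. Qed.

(** The adjoint of Gamma a, given by its coordinates: unlike those of Gamma a,
    they are infinite sums. *)
Definition Gamma_adj g m : R := 2 ^+ size m * pairing (Gamma a (delta R m)) g.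

Lemma wsummable_Gamma f g : tame t f -> tame r g -> wsummable (pair_term (Gamma a f) g).
Proof.
by move=> ft gr; apply: (wsummable_pair_term (ltW t0) (ltW r0) tr) => //; exact: tame_Gamma.
Qed.

Lemma eq_Gamma_adj g g' l : (forall N l, spart N l -> g l = g' l) -> Gamma_adj g l = Gamma_adj g' l.
Proof. by move=> gg; rewrite /Gamma_adj; congr (_ * _); apply: eq_pairing. Qed.

Lemma Gamma_adj_lin b c g g' l : tame r g -> tame r g' ->
  Gamma_adj (fun l => b * g l + c * g' l) l = b * Gamma_adj g l + c * Gamma_adj g' l.
Proof.
move=> gr gr'; rewrite /Gamma_adj (pairing_lin_r _ _ (ltW t0) (ltW r0) tr) //; first by ring.
by apply: tame_Gamma => //; exact: tame_delta.
Qed.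

Lemma pairing_Gamma_lin b c f f' g : tame t f -> tame t f' -> tame r g ->
  pairing (Gamma a (fun l => b * f l + c * f' l)) g =
  b * pairing (Gamma a f) g + c * pairing (Gamma a f') g.
Proof.
move=> ft ft' gr; rewrite /pairing -psum_lim_lin; try exact: wsummable_Gamma.
by apply: eq_psum_lim => N l spl; rewrite /pair_term (Gamma_lin _ _ _ _ _ spl); ring.
Qed.

(** Adjointness on vectors with finitely many nonzero coordinates, where the sum
    over the coordinates of f can be exchanged with the pairing. *)
Lemma pairing_Gamma_finite N f g : tame t f -> tame r g ->
  (forall M m, spart M m -> ~~ spart N.+1 m -> f m = 0) ->
  pairing (Gamma a f) g = psum N (pair_term f (Gamma_adj g)).
Proof.
move=> ft gr fN.
have T0 : pairing (Gamma a (fun=> 0)) g = 0.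
  by apply: psum_lim0 => M l spl; rewrite /pair_term (Gamma0 _ spl) mul0r mulr0.
have step h c m : tame t h -> tame t (fun l => c * delta R m l + h l) /\
    pairing (Gamma a (fun l => c * delta R m l + h l)) g =
    c * pairing (Gamma a (delta R m)) g + pairing (Gamma a h) g.
  move=> ht; have E : (fun l => c * delta R m l + h l) =
      (fun l => c * delta R m l + 1 * h l) by apply: funext => l; rewrite mul1r.
  rewrite E; split; first by apply: tame_lin => //; exact: tame_delta.
  by rewrite pairing_Gamma_lin ?mul1r //; exact: tame_delta.
have [_ sumE] := functional_sum f (parts N) (tame0 t0) T0 step.
transitivity (pairing (Gamma a (fun l => \sum_(m <- parts N) f m * delta R m l)) g).
  apply: eq_pairing => // K l spl; apply: eq_Gamma spl => M m spm _.
  have [spN|nspN] := boolP (spart N.+1 m); first exact: delta_sum.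
  rewrite (fN M) // big1_seq // => m' /=; rewrite mem_parts => spm'.
  by rewrite /delta; case: eqP => [mm|_]; [rewrite mm spm' in nspN | rewrite mulr0].
rewrite sumE; apply: eq_bigr => m _; rewrite /pair_term /Gamma_adj.
by field; rewrite expf_neq0 // pnatr_eq0.
Qed.

Lemma Psi_support N v f M l : (`|v| <= N)%N ->
  (forall M m, spart M m -> ~~ spart N.+1 m -> f m = 0) ->
  spart M l -> ~~ spart N.+1 l -> Psi v f l = 0.
Proof.
move=> vN fN; case: l => // x l spl nspl.
have Nx : (N < x)%N.
  by rewrite ltnNge; apply: contra nspl => xN; apply: (spart_head spl); rewrite /= ltnS.
rewrite Psi_cons ?(leq_ltn_trans vN) // (@eq_Psi _ x _ _ (fun=> 0)) ?Psi0 ?oppr0 //.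
- move=> m spm; apply: (fN x.+1); first by case/and3P: spl => x0 _ _; rewrite spart_cons x0 ltnSn.
  by rewrite spart_cons ltnS [(x <= N)%N]leqNgt Nx andbF.
- exact: leq_ltn_trans Nx.
- by case/and3P: spl.
Qed.

Lemma Gamma_adj_Psi M g v l : tame r g -> spart M l ->
  Psi v (Gamma_adj g) l = 2 ^+ size l * pairing (Gamma a (Phi v (delta R l))) g.
Proof.
move=> gr spl; pose N := maxn `|v| M.
have splN : spart N.+1 l by apply: spart_le spl; rewrite leqW // leq_maxr.
rewrite (@pairing_Gamma_finite N) //; last 2 first.
- by apply: tame_Phi => //; exact: tame_delta.
- move=> K m spm nspm; rewrite /Phi (@Psi_support N _ _ K) ?mulr0 //.
    by rewrite abszN leq_maxl.
  by move=> K' m' _ nm'; rewrite /delta; case: eqP => // mm; rewrite mm splN in nm'.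
rewrite -psum_adjoint ?leq_maxl // /psum (bigD1_seq l) ?uniq_parts ?mem_parts //=.
rewrite big1 ?addr0 => [|m /negbTE ml]; last by rewrite /pair_term /delta ml mul0r mulr0.
by rewrite /pair_term /delta eqxx mul1r mulrA mulfV ?mul1r // expf_neq0 // pnatr_eq0.
Qed.

(** The coefficient of z^v in (1 + b z) Psi(z). *)
Definition mixd b v h l : R := Psi v h l + b * Psi (v - 1) h l.

(** The adjoint of the relation of Gamma with the field:
    (1 + a z) Psi(z) Gamma^* = Gamma^* (1 - a z) Psi(z). *)
Lemma Gamma_adj_mix M g v l : tame r g -> spart M l ->
  mixd a v (Gamma_adj g) l = Gamma_adj (mixd (- a) v g) l.
Proof.
move=> gr spl; rewrite /mixd !(Gamma_adj_Psi _ gr spl).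
have clsPg w : tame r (Psi w g) by exact: tame_Psi.
have dt := tame_delta l t0.
have -> : Gamma_adj (fun l => Psi v g l + - a * Psi (v - 1) g l) l =
    Gamma_adj (fun l => 1 * Psi v g l + - a * Psi (v - 1) g l) l.
  by apply: eq_Gamma_adj => K m _; rewrite mul1r.
rewrite Gamma_adj_lin // /Gamma_adj.
have adjG w : pairing (Gamma a (delta R l)) (Psi w g) = pairing (Phi w (Gamma a (delta R l))) g.
  exact: pairing_adjoint.
have clsPG w : tame t (Phi w (Gamma a (delta R l))).
  by apply: tame_Phi => //; exact: tame_Gamma.
have clsGP w : tame t (Gamma a (Phi w (delta R l))).
  by apply: tame_Gamma => //; exact: tame_Phi.
rewrite !adjG.
have lin F G b : tame t F -> tame t G ->
    pairing (fun l => 1 * F l + b * G l) g = 1 * pairing F g + b * pairing G g.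
  by move=> Ft Gt; rewrite 3!(pairing_sym _ g) (pairing_lin_r _ _ (ltW r0) (ltW t0) rt).
have := lin _ _ a (clsGP v) (clsGP (v - 1)); have := lin _ _ (- a) (clsPG v) (clsPG (v - 1)).
have -> : pairing (fun m => 1 * Phi v (Gamma a (delta R l)) m +
    - a * Phi (v - 1) (Gamma a (delta R l)) m) g =
   pairing (fun m => 1 * Gamma a (Phi v (delta R l)) m +
    a * Gamma a (Phi (v - 1) (delta R l)) m) g.
  by apply: eq_pairing => // K m spm; rewrite !mul1r mulNr (Phi_Gamma _ _ _ spm).
by move=> -> E; rewrite !mul1r in E *; rewrite mulrCA -mulrDr -E; ring.
Qed.

End Lowering.
End Cauchy.

(** * The skew Cauchy identity *)

Section CauchyIdentity.
Variable R : realType.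
Implicit Types (a b c t r y C : R) (f g h F G : seq nat -> R) (l m : seq nat) (u v : int).

Definition one_row (k : nat) : seq nat := if k is 0 then [::] else [:: k].

Lemma Gamma_delta_row a k : Gamma a (delta R [::]) [:: k.+1] = 2 * a ^+ k.+1.
Proof.
have put0 j l : put j.+1 (delta R [::]) l = 0 by rewrite /put /=; case: ifP.
have put_fun0 j : put j.+1 (delta R [::]) = fun=> 0.
  by apply: funext => l.
elim: k => [|k IH]; rewrite Gamma_cons // put_fun0 (@Gamma0 _ a 0) // addr0.
  rewrite /put /= /delta /= expr1; ring.
rewrite put_fun0 (@Gamma0 _ a 0) // mulr0 addr0 /put [k.+1 == 0%N]/= [head _ _ == _]/=.
by rewrite IH [a ^+ k.+2]exprS mulrCA.
Qed.

(** One variable produces one part at most out of the empty partition. *)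
Lemma Gamma_delta_long a N k j l : spart N [:: k, j & l] ->
  Gamma a (delta R [::]) [:: k, j & l] = 0.
Proof.
have put0 i : put i.+1 (delta R [::]) = fun=> 0.
  by apply: funext => m; rewrite /put /=; case: ifP.
case: k => // k; rewrite spart_cons => /and3P[_ _ spj].
have /and3P[j0 jk spl] := spj.
elim: k {N} jk spj => [|k IH]; first by rewrite ltnS leqNgt j0.
move=> jk spj; rewrite Gamma_cons // !put0 !(Gamma0 _ spj) mulr0 !addr0.
have -> h : put k.+1 h (j :: l) = if j == k.+1 then 0 else h [:: k.+1, j & l] by [].
case: eqP => [_|/eqP jk']; first by rewrite mulr0.
have jk2 : (j < k.+1)%N by rewrite ltn_neqAle jk'.
by rewrite IH ?mulr0 // spart_cons j0 jk2.
Qed.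

Lemma psum_row N a h :
  psum N (pair_term (Gamma a (delta R [::])) h) = \sum_(0 <= k < N.+1) a ^+ k * h (one_row k).
Proof.
elim: N => [|N IH].
  by rewrite psum0 big_nat1 /pair_term /delta /= !mul1r invr1 mul1r.
rewrite psumS IH [RHS]big_nat_recr //; congr (_ + _).
rewrite /psum (bigD1_seq [::]) ?uniq_parts ?mem_parts //= big1_seq => [|l].
  rewrite addr0 /pair_term Gamma_delta_row /= expr1.
  by rewrite -!mulrA mulKf // pnatr_eq0.
rewrite mem_parts; case: l => [|j l] /andP[//] _ spl.
rewrite /pair_term (@Gamma_delta_long a N.+2) ?mul0r ?mulr0 //.
by rewrite spart_cons ltnSn.
Qed.

Lemma Gamma_row y g k :
  Gamma y g (one_row k.+1) = y * Gamma y g (one_row k) + g (one_row k.+1) + y * g (one_row k).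
Proof. by rewrite /one_row Gamma_cons //; case: k. Qed.

(** The recursion of Gamma y on one-row partitions, multiplied by a^k and
    summed. *)
Lemma sum_row a y g N :
  \sum_(0 <= k < N.+2) a ^+ k * Gamma y g (one_row k) =
  a * y * (\sum_(0 <= k < N.+1) a ^+ k * Gamma y g (one_row k)) +
  \sum_(0 <= k < N.+2) a ^+ k * g (one_row k) +
  a * y * (\sum_(0 <= k < N.+1) a ^+ k * g (one_row k)).
Proof.
have rec n (F : nat -> R) : \sum_(0 <= k < n.+1) F k = \sum_(0 <= k < n) F k + F n :> R.
  by rewrite big_nat_recr.
elim: N => [|N IH].
  have G0 : Gamma y g (one_row 0) = g (one_row 0) by [].
  by rewrite !(rec 1%N) !big_nat1 Gamma_row G0 expr0 expr1; ring.
rewrite (rec N.+2) [X in X + _ = _]IH Gamma_row [a ^+ N.+2]exprS.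
rewrite [X in _ = _ + X + _](rec N.+2).
rewrite [X in _ = a * y * X + _ + _](rec N.+1).
rewrite [X in _ = _ + _ + a * y * X](rec N.+1) exprS.
set S1 := \sum_(0 <= _ < _) _; set S2 := \sum_(0 <= _ < _) _.
set S3 := \sum_(0 <= _ < _) _.
by rewrite !exprS; ring.
Qed.

Lemma intB_succ (k n : nat) : k%:Z - n.+1%:Z + 1 = k%:Z - n%:Z.
Proof. by lia. Qed.

Lemma intB_pred (k n : nat) : k%:Z - n%:Z - 1 = k%:Z - n.+1%:Z.
Proof. by lia. Qed.

Lemma intB_double (k : nat) : k.+1%:Z - (k.+1 + k.+1)%:Z = Negz k.
Proof. by lia. Qed.

Section Commutation.
Variables (a y t r : R).
Hypotheses (a0 : 0 <= a) (at_ : a < t) (y0 : 0 <= y) (yr : y < r) (rt : r * t < 1).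

Let t0 : 0 < t. Proof. exact: le_lt_trans at_. Qed.
Let r0 : 0 < r. Proof. exact: le_lt_trans yr. Qed.
Let ay1 : a * y < 1.
Proof.
have : a * y <= t * r by rewrite ler_pM // ltW.
by move: rt; rewrite mulrC => ? ?; lra.
Qed.
Let H : R := (1 + a * y) / (1 - a * y).

(** With the limits U and W of the two sums in sum_row, the recursion becomes
    U = a y U + W + a y W. *)
Lemma Cauchy_base g : tame r g ->
  pairing (Gamma a (delta R [::])) (Gamma y g) = H * pairing (Gamma a (delta R [::])) g.
Proof.
move=> gr; pose d := delta R [::].
have cv h : tame r h -> (fun N => psum N (pair_term (Gamma a d) h)) @ \oo --> pairing (Gamma a d) h.
  by move=> hr; apply: cvg_psum_lim; apply: (wsummable_Gamma a0 at_ r0 rt) => //; exact: tame_delta.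
have cvG := cv _ (tame_Gamma y0 yr gr); have cvg := cv _ gr.
set U := pairing _ (Gamma y g) in cvG *; set W := pairing _ g in cvg *.
have rec : U = a * y * U + W + a * y * W.
  transitivity (limn (fun N => psum N (pair_term (Gamma a d) (Gamma y g)))).
    by apply/esym/cvg_lim.
  apply: cvg_lim => //.
  rewrite -(cvg_shiftn 1%N).
  rewrite (_ : (fun n => _) = (fun N => a * y * psum N (pair_term (Gamma a d) (Gamma y g))) \+
     (fun N => psum (N + 1) (pair_term (Gamma a d) g)) \+
     (fun N => a * y * psum N (pair_term (Gamma a d) g))); last first.
    by apply: funext => N; rewrite /= addn1 !psum_row sum_row.
  apply: cvgD; last exact: cvgMl_tmp.
  by apply: cvgD; [exact: cvgMl_tmp | rewrite (cvg_shiftn 1%N (fun N => psum N (pair_term (Gamma a d) g)))].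
have ay1' : 1 - a * y != 0 by rewrite subr_eq0 eq_sym lt_eqF.
rewrite /H; apply: (mulfI ay1').
transitivity ((1 + a * y) * W); last by field.
by rewrite mulrBl mul1r {1}rec; ring.
Qed.

(** The commutation of the removal of a with the addition of y, by induction on
    the partition k :: rest.  Let D be the difference of the two sides.  The
    field (1 + a z) (1 + y / z) Psi(z) passes through both products of
    operators in the same way, and D vanishes at rest by induction; hence
    x_w = (Psi_w D)(rest) satisfies
    (1 + a y) x_w + a x_(w-1) + y x_(w+1) = 0.  As x_w = 0 for w >= k, all x_w
    vanish, and x_(-k) is the coordinate of D at k :: rest up to sign. *)
Lemma Gamma_adj_Gamma g M m : tame r g -> spart M m ->
  Gamma_adj a (Gamma y g) m = H * Gamma y (Gamma_adj a g) m.
Proof.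
elim: m M g => [|k rest IH] M g gr spm.
  by rewrite /Gamma_adj /= expr0 !mul1r Cauchy_base.
have [k0 kM spr] : [/\ (0 < k)%N, (k < M)%N & spart k rest] by case/and3P: spm.
pose D g m := Gamma_adj a (Gamma y g) m + - H * Gamma y (Gamma_adj a g) m.
have Gr h : tame r h -> tame r (Gamma y h) by exact: tame_Gamma.
have Pr w h : tame r h -> tame r (Psi w h) by exact: tame_Psi.
have mixdr b w h : tame r h -> tame r (mixd b w h).
  move=> hr; apply: (tame_eq (f := fun l => 1 * Psi w h l + b * Psi (w - 1) h l)).
    by move=> N l _; rewrite mul1r.
  by apply: tame_lin => //; exact: Pr.
have mixr b w h : tame r h -> tame r (mix b w h).
  move=> hr; apply: (tame_eq (f := fun l => 1 * Psi w h l + b * Psi (w + 1) h l)).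
    by move=> N l _; rewrite mul1r.
  by apply: tame_lin => //; exact: Pr.
pose theta w h l := 1 * mix (- y) w h l + - a * mix (- y) (w - 1) h l.
have thetaE w h l : theta w h l = 1 * mixd (- a) w h l + - y * mixd (- a) (w + 1) h l.
  rewrite /theta /mix /mixd (_ : w - 1 + 1 = w); last by lia.
  by rewrite (_ : w + 1 - 1 = w); [ring | lia].
have thetar w h : tame r h -> tame r (theta w h).
  by move=> hr; apply: tame_lin => //; exact: mixr.
have mixE b w h l : mixd b w h l + y * mixd b (w + 1) h l =
    mix y w h l + b * mix y (w - 1) h l.
  by rewrite /mix /mixd (subrK 1 w) (addrK 1 w); ring.
have mixE' w h l : mix (- y) w h l + a * mix (- y) (w - 1) h l =
    mixd a w h l + - y * mixd a (w + 1) h l.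
  by rewrite /mix /mixd (subrK 1 w) (addrK 1 w); ring.
have stepLG w : mixd a w (Gamma_adj a (Gamma y g)) rest + y * mixd a (w + 1) (Gamma_adj a (Gamma y g)) rest =
    Gamma_adj a (Gamma y (theta w g)) rest.
  rewrite !(Gamma_adj_mix a0 at_ r0 rt _ (Gr _ gr) spr).
  rewrite -[X in X + _]mul1r -(Gamma_adj_lin a0 at_ r0 rt); try by apply: mixdr; exact: Gr.
  apply: eq_Gamma_adj => N l spl; rewrite mul1r mixE !(Gamma_mix _ _ _ spl).
  by rewrite (Gamma_lin _ _ _ _ _ spl) mul1r.
have stepGL w : mixd a w (Gamma y (Gamma_adj a g)) rest + y * mixd a (w + 1) (Gamma y (Gamma_adj a g)) rest =
    Gamma y (Gamma_adj a (theta w g)) rest.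
  rewrite mixE !(Gamma_mix _ _ _ spr) -[X in X + _]mul1r -(Gamma_lin _ _ _ _ _ spr).
  apply: eq_Gamma spr => N l spl _; rewrite mul1r mixE' !(Gamma_adj_mix a0 at_ r0 rt _ gr spl).
  rewrite -[X in X + _]mul1r -(Gamma_adj_lin a0 at_ r0 rt); try exact: mixdr.
  by apply: eq_Gamma_adj => K m _; rewrite thetaE.
pose x w := Psi w (D g) rest.
have recx w : (1 + a * y) * x w + a * x (w - 1) + y * x (w + 1) = 0.
  have mixD b h h' v : mixd b v (fun l => 1 * h l + - H * h' l) rest =
      mixd b v h rest + - H * mixd b v h' rest.
    by rewrite /mixd !Psi_lin; ring.
  have -> : (1 + a * y) * x w + a * x (w - 1) + y * x (w + 1) =
      mixd a w (D g) rest + y * mixd a (w + 1) (D g) rest.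
    by rewrite /x /mixd (addrK 1 w); ring.
  have -> : D g = fun l => 1 * Gamma_adj a (Gamma y g) l + - H * Gamma y (Gamma_adj a g) l.
    by apply: funext => l; rewrite /D mul1r.
  rewrite !mixD.
  have -> (p q p' q' : R) : p + - H * q + y * (p' + - H * q') =
    (p + y * p') - H * (q + y * q') by ring.
  by rewrite stepLG stepGL (IH _ _ (thetar w g gr) spr) subrr.
have xk w : k%:Z <= w -> x w = 0.
  case: w => [[|j]|j] // kw; first by move: k0 kw; case: (k).
  by rewrite /x Psi_create_out //; exact: spart_le spr.
have x0 n : x (k%:Z - n%:Z) = 0 /\ x (k%:Z - n%:Z + 1) = 0.
  elim: n => [|n [IH1 IH2]].
    by rewrite subr0; split; apply: xk => //; rewrite lerDl.
  have e1 := intB_succ k n; have e2 := intB_pred k n.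
  rewrite e1; split=> //; have [az|an0] := eqVneq a 0.
    have := recx (k%:Z - n.+1%:Z).
    by rewrite e1 IH1 az !mul0r mulr0 !addr0 mul1r.
  have := recx (k%:Z - n%:Z); rewrite IH1 IH2 e2 !mulr0 add0r addr0 => /eqP.
  by rewrite mulf_eq0 (negbTE an0) => /eqP.
have [+ _] := x0 (k + k)%N; rewrite /x.
case: k k0 kM spr {spm IH stepLG stepGL xk x0 recx} => // k _ kM spr.
rewrite intB_double.
rewrite Psi_kill_out // => /eqP; rewrite mulf_eq0 signr_eq0 /= /D => /eqP E.
by apply/eqP; rewrite -subr_eq0 -mulNr E.
Qed.

End Commutation.

Definition Cauchy_factor a A : R := \prod_(y <- A) ((1 + a * y) / (1 - a * y)).

Section Eigen.
Variables (a t r : R) (Y : seq R).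
Hypotheses (a0 : 0 <= a) (at_ : a < t) (r0 : 0 < r) (rt : r * t < 1).
Hypothesis (Yr : forall y, y \in Y -> 0 <= y < r).

Let t0 : 0 < t. Proof. exact: le_lt_trans at_. Qed.

(** The adjoint of Gamma a passes each Gamma y at the cost of one factor, and
    fixes vac. *)
Lemma Gamma_adj_Gammas M m : spart M m ->
  Gamma_adj a (Gammas Y (delta R [::])) m = Cauchy_factor a Y * Gammas Y (delta R [::]) m.
Proof.
move=> spm; elim: Y Yr m M spm => [|y A IH] Ar m M spm.
  rewrite /Cauchy_factor big_nil mul1r /Gamma_adj pairing_delta0 /=.
  by rewrite /delta eq_sym; case: eqP => [->|]; rewrite ?expr0 ?mulr1 ?mulr0.
have /andP[y0 yr] := Ar y (mem_head _ _).
have Ar' b : b \in A -> 0 <= b < r by move=> bA; apply: Ar; rewrite inE bA orbT.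
have gr : tame r (Gammas A (delta R [::])) by apply: tame_Gammas => //; exact: tame_delta.
rewrite [Gammas (y :: A) _]/(Gamma y (Gammas A (delta R [::]))) (Gamma_adj_Gamma a0 at_ y0 yr rt gr spm).
rewrite /Cauchy_factor big_cons -/(Cauchy_factor a A) -[RHS]mulrA; congr (_ * _).
rewrite -(GammaZ _ _ _ spm); apply: eq_Gamma spm => K l spl _.
exact: IH spl.
Qed.

(** For f with finitely many nonzero coordinates this is the eigenvector
    property.  In general f is truncated to the parts at most N; its image under
    Gamma a changes only at partitions with a part above N, and the pairing with
    the change is bounded by a tail. *)
Theorem Cauchy f : tame t f ->
  pairing (Gamma a f) (Gammas Y (delta R [::])) = Cauchy_factor a Y * pairing f (Gammas Y (delta R [::])).
Proof.
move=> [C [c [C0 c1 fW]]]; set g := Gammas Y _.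
have gr : tame r g by apply: tame_Gammas => //; exact: tame_delta.
have ft : tame t f by exists C, c.
pose fN N l : R := if spart N.+1 l then f l else 0.
have fNW N : wbounded C c t (fN N).
  move=> K l spl; rewrite /fN; case: ifP => _; first exact: fW spl.
  by rewrite normr0 mulr_ge0 // weight_ge0 ?(ltW t0) // (le_trans _ c1).
have [c' c'1 GW] := wbounded_Gamma_ex c1 a0 at_.
have [D [d [D0 d1 gW]]] := gr.
have truncE N : pairing (Gamma a (fN N)) g = Cauchy_factor a Y * psum N (pair_term f g).
  rewrite (pairing_Gamma_finite a0 at_ r0 rt (N := N)) //; last 2 first.
  - by exists C, c.
  - by move=> K l _ nspl; rewrite /fN (negbTE nspl).
  rewrite /psum mulr_sumr; apply: eq_big_seq => l; rewrite mem_parts => spl.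
  by rewrite /pair_term (Gamma_adj_Gammas spl) /fN spl -/g; ring.
pose e N l := 1 * Gamma a f l + - 1 * Gamma a (fN N) l.
have eW N : wbounded C c' t (e N).
  move=> K l spl; rewrite /e -(Gamma_lin _ _ _ _ _ spl).
  apply: (GW _ _ C0 _ K l spl) => K' l' spl'; rewrite /fN; case: ifP => _.
    rewrite mul1r mulN1r subrr normr0 mulr_ge0 // weight_ge0 ?(ltW t0) //.
    by apply: le_trans c1.
  by rewrite mul1r mulr0 addr0; exact: fW spl'.
have e0 N l : spart N.+1 l -> e N l = 0.
  move=> spl; rewrite /e (@eq_Gamma _ a N.+1 (fN N) f) ?mul1r ?mulN1r ?subrr //.
  by move=> K m spm ml; rewrite /fN (part_sub_spart spm ml spl).
have tr : t * r < 1 by rewrite mulrC.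
have c'0 : 0 <= c' by apply: le_trans c'1.
have d0 : 0 <= d by apply: le_trans d1.
have tail N : `|pairing (Gamma a f) g - pairing (Gamma a (fN N)) g| <=
    (C * D) * (psum_lim (weight (c' * d) (t * r)) - psum N (weight (c' * d) (t * r))).
  have -> : pairing (Gamma a f) g - pairing (Gamma a (fN N)) g = pairing (e N) g.
    rewrite /e -[X in X - _]mul1r -mulN1r; apply/esym.
    rewrite 3!(pairing_sym _ g) (pairing_lin_r _ _ (ltW r0) (ltW t0) rt) //.
    - by rewrite mulr1 mulN1r.
    - exact: tame_Gamma.
    - by apply: tame_Gamma => //; exists C, c.
  apply: psum_lim_tail => [|l spl]; last by rewrite /pair_term e0 // mul0r mulr0.
  exact: wbounded_pair_term C0 D0 c'0 d0 (ltW t0) (ltW r0) tr (eW N) gW.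
have cvT : (fun N => (C * D) * (psum_lim (weight (c' * d) (t * r)) -
    psum N (weight (c' * d) (t * r)))) @ \oo --> (0 : R).
  rewrite -[X in _ --> X](mulr0 (C * D)); apply: cvgMl_tmp.
  rewrite -[X in _ --> X](subrr (psum_lim (weight (c' * d) (t * r)))).
  apply: cvgB; first exact: cvg_cst.
  apply: cvg_psum_lim; exists 1, (c' * d), (t * r); apply: wsummable_weight => //.
    by rewrite mulr_ge0.
  by rewrite mulr_ge0 // ltW.
have cvF : (fun N => Cauchy_factor a Y * psum N (pair_term f g)) @ \oo --> Cauchy_factor a Y * pairing f g.
  by apply: cvgMl_tmp; apply: cvg_psum_lim; exact: (wsummable_pair_term (ltW t0) (ltW r0) tr).
have cvG : (fun N => Cauchy_factor a Y * psum N (pair_term f g)) @ \oo --> pairing (Gamma a f) g.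
  apply/cvgrPdist_le => /= eps eps0; move/cvgrPdist_le: cvT => /(_ _ eps0).
  apply: filterS => N; rewrite sub0r normrN -truncE => H.
  apply: le_trans (tail N) _; apply: le_trans H; exact: ler_norm.
by rewrite -(cvg_lim _ cvG) // -(cvg_lim _ cvF).
Qed.

End Eigen.

End CauchyIdentity.

(** * Series of integers and Laurent coefficients *)

Section NatSums.
Variable R : realType.
Implicit Types (x y : nat -> R) (C rho b c : R).

Definition nsum x : R := limn (series x).

Definition geom_by C rho x := [/\ 0 <= C, 0 <= rho, rho < 1 &
  forall k, `|x k| <= C * rho ^+ k].

Definition geom x := exists C rho, geom_by C rho x.

Lemma cvg_nsum x : geom x -> series x @ \oo --> nsum x.
Proof.
move=> [C [rho [C0 r0 r1 xW]]]; apply: normed_cvg.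
apply: (@series_le_cvg _ _ (geometric C rho)) => [n|n|n|].
- exact: normr_ge0.
- by rewrite /geometric /= mulr_ge0 // exprn_ge0.
- exact: xW.
- by apply: is_cvg_geometric_series; rewrite ger0_norm.
Qed.

Lemma nsumE x l : series x @ \oo --> l -> nsum x = l.
Proof. by move=> xl; apply: cvg_lim. Qed.

Lemma nsum_lin b c x y : geom x -> geom y ->
  nsum (fun k => b * x k + c * y k) = b * nsum x + c * nsum y.
Proof.
move=> gx gy; apply: nsumE.
rewrite (_ : series _ = (fun n => b * series x n) \+ (fun n => c * series y n)).
  by apply: cvgD; apply: cvgMl_tmp; exact: cvg_nsum.
by apply: funext => n; rewrite /series /= big_split /= !mulr_sumr.
Qed.

Lemma nsum_le C rho x : geom_by C rho x -> `|nsum x| <= C / (1 - rho).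
Proof.
move=> gx; have [C0 r0 r1 xW] := gx; have cv : series x @ \oo --> nsum x.
  by apply: cvg_nsum; exists C, rho.
rewrite -lim_norm; last by apply/cvg_ex; eexists; exact: cv.
have rn : `|rho| < 1 by rewrite ger0_norm.
rewrite -(cvg_lim _ (@cvg_geometric_series _ C rho rn)) //.
apply: ler_lim; first by apply: is_cvg_norm; apply/cvg_ex; eexists; exact: cv.
  exact: is_cvg_geometric_series.
apply: nearW => n; apply: le_trans (ler_norm_sum _ _ _) _.
by apply: ler_sum => k _; exact: xW.
Qed.

Lemma nsum_shift x : geom x -> nsum x = x 0%N + nsum (fun k => x k.+1).
Proof.
move=> gx; apply: nsumE; rewrite -(cvg_shiftn 1%N).
rewrite (_ : (fun n => _) = (fun=> x 0%N) \+ series (fun k => x k.+1)).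
  apply: cvgD; first exact: cvg_cst.
  apply: cvg_nsum; case: gx => C [rho [C0 r0 r1 xW]]; exists (C * rho), rho.
  by split=> // [|k]; rewrite ?mulr_ge0 // -mulrA -exprS.
apply: funext => n; rewrite /series /= addn1 big_nat_recl //.
Qed.

Lemma nsum_finite n x : (forall k, (n <= k)%N -> x k = 0) ->
  nsum x = \sum_(k < n) x k.
Proof.
move=> x0; apply: nsumE; apply: (@cvg_near_cst _ _ _ _ _ _).
exists n => // m /= nm; rewrite /series /= -(big_mkord predT x).
by rewrite (big_cat_nat _ nm) //= [X in _ + X]big_nat_cond [X in _ + X]big1 ?addr0 // => i /andP[/andP[ni _] _]; exact: x0.
Qed.

Lemma eq_nsum x y : x =1 y -> nsum x = nsum y.
Proof. by move=> xy; congr nsum; apply: funext. Qed.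

Lemma geom_by_eq C rho x y : x =1 y -> geom_by C rho x -> geom_by C rho y.
Proof. by move=> /funext ->. Qed.

(** For a <> 0 the solutions are the multiples of (- a)^(- w), for which
    a^n x_(w + n) has constant absolute value. *)
Lemma rec_decay a (x : int -> R) : (forall w, x w + a * x (w + 1) = 0) ->
  (forall w, (fun n : nat => a ^+ n * x (w + n%:Z)) @ \oo --> (0 : R)) ->
  forall w, x w = 0.
Proof.
move=> rec dec w.
have E n : x w = (- 1) ^+ n * (a ^+ n * x (w + n%:Z)).
  elim: n => [|n IH]; first by rewrite !expr0 !mul1r addr0.
  rewrite {1}IH; have := rec (w + n%:Z); rewrite -addrA.
  have -> : n%:Z + 1 = n.+1%:Z by lia.
  move=> /eqP; rewrite addr_eq0 => /eqP ->; rewrite !exprS; ring.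
have H : (fun n : nat => `|a ^+ n * x (w + n%:Z)|) @ \oo --> `|x w|.
  rewrite (_ : (fun n => _) = fun=> `|x w|); first exact: cvg_cst.
  by apply: funext => n; rewrite [in RHS](E n) [in RHS]normrM normrX normrN1 expr1n mul1r.
have H0 : (fun n : nat => `|a ^+ n * x (w + n%:Z)|) @ \oo --> `|0 : R|.
  by apply: cvg_norm; exact: dec.
apply/eqP; rewrite -normr_eq0; apply/eqP.
by rewrite -(cvg_lim _ H) // (cvg_lim _ H0) // normr0.
Qed.

End NatSums.

Section Dressing.
Variable R : realType.
Implicit Types (a b t C : R) (A : seq R) (J : int -> R) (u v w : int).

(** The Cauchy estimate for a Laurent series that converges on |z| = t. *)
Definition laurent_bd t J := exists2 C, 0 <= C & forall u, `|J u| <= C * t ^ (- u).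

(** The coefficients of J(z) F_A(- 1 / z). *)
Definition dress A J u : R := nsum (fun k => J (u + k%:Z) * ((-1) ^+ k * qfun A k)).

Lemma qfun_le A b : 0 < b -> (forall a, a \in A -> 0 <= a < b) ->
  exists2 C, 0 <= C & forall k, `|qfun A k| <= C * b ^+ k.
Proof.
move=> b0; elim: A => [|a A IH] Ab.
  exists 1 => // -[|k]; first by rewrite /= normr1 mulr1.
  by rewrite /= normr0 mul1r exprn_ge0 // ltW.
have /andP[a0 ab] := Ab a (mem_head _ _).
have [C C0 CW] : exists2 C, 0 <= C & forall k, `|qfun A k| <= C * b ^+ k.
  by apply: IH => c cA; apply: Ab; rewrite inE cA orbT.
have d0 : 0 < b - a by rewrite subr_gt0.
pose D := C * (b + a) / (b - a).
have DE : D * (b - a) = C * (b + a) by rewrite /D mulfVK // gt_eqF.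
have CD : C <= D by rewrite /D ler_pdivlMr //; nra.
exists D; first exact: le_trans CD.
elim=> [|k IHk]; first by rewrite qfun_cons0 (le_trans (CW 0%N)) // !mulr1.
have -> : qfun (a :: A) k.+1 = a * qfun (a :: A) k + (qfun A k.+1 + a * qfun A k).
  by rewrite -qfun_consS; ring.
apply: le_trans (ler_normD _ _) _; rewrite normrM (ger0_norm a0).
apply: le_trans (lerD (ler_wpM2l a0 IHk) (ler_normD _ _)) _.
rewrite normrM (ger0_norm a0).
apply: le_trans (lerD (lexx _) (lerD (CW k.+1) (ler_wpM2l a0 (CW k)))) _.
rewrite [b ^+ k.+1]exprS; have : 0 <= b ^+ k by rewrite exprn_ge0 // ltW.
by move: (b ^+ k) => z z0; nra.
Qed.

Lemma exprz_shift t u (k : nat) : 0 < t -> t ^ (- (u + k%:Z)) = t ^ (- u) * (t^-1) ^+ k.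
Proof. by move=> t0; rewrite opprD expfzDr ?gt_eqF // -exprnN exprVn. Qed.

Lemma exprz_shiftN t u (k : nat) : 0 < t -> t ^ (- (u - k%:Z)) = t ^ (- u) * t ^+ k.
Proof. by move=> t0; rewrite opprB addrC expfzDr ?gt_eqF // exprnP. Qed.

Lemma dress_geom_by A J t : 0 < t -> (forall a, a \in A -> 0 <= a < t) -> laurent_bd t J ->
  exists C rho, forall u, geom_by (C * t ^ (- u)) rho
     (fun k => J (u + k%:Z) * ((-1) ^+ k * qfun A k)).
Proof.
move=> t0 At [CJ CJ0 JW].
have [b [b0 bt Ab]] : exists b, [/\ 0 < b, b < t & forall a, a \in A -> 0 <= a < b].
  elim: A At => [|a A IH] At; first by exists (t / 2); split=> //; lra.
  have At' c : c \in A -> 0 <= c < t by move=> cA; apply: At; rewrite inE cA orbT.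
  have [b [b0 bt Ab]] := IH At'.
  have /andP[a0 at_] := At a (mem_head _ _).
  exists ((Num.max a b + t) / 2); have m1 : a <= Num.max a b by rewrite le_max lexx.
  have m2 : b <= Num.max a b by rewrite le_max lexx orbT.
  have m3 : Num.max a b < t by rewrite gt_max at_ bt.
  split; [lra|lra|] => c; rewrite inE => /orP[/eqP ->|cA]; first by apply/andP; split; lra.
  by have /andP[c0 cb] := Ab c cA; apply/andP; split; lra.
have [C C0 CW] := qfun_le b0 Ab.
exists (CJ * C), (b / t) => u; split.
- by rewrite !mulr_ge0 // exprz_ge0 // ltW.
- by rewrite mulr_ge0 ?invr_ge0 ?ltW.
- by rewrite ltr_pdivrMr // mul1r.
move=> k; rewrite !normrM normrX normrN1 expr1n mul1r.
apply: le_trans (ler_pM (normr_ge0 _) (normr_ge0 _) (JW _) (CW _)) _.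
by rewrite exprz_shift // exprMn le_eqVlt; apply/orP; left; apply/eqP; ring.
Qed.

Lemma laurent_bd_dress A J t : 0 < t -> (forall a, a \in A -> 0 <= a < t) -> laurent_bd t J ->
  laurent_bd t (dress A J).
Proof.
move=> t0 At Jt; have [C [rho H]] := dress_geom_by t0 At Jt.
have [C0 r0 r1 _] := H 0; exists (C / (1 - rho)).
  by rewrite oppr0 expr0z mulr1 in C0; rewrite divr_ge0 // subr_ge0 ltW.
by move=> u; apply: le_trans (nsum_le (H u)) _; rewrite mulrAC.
Qed.

Lemma dress_nil J u : dress [::] J u = J u.
Proof.
rewrite /dress (@nsum_finite _ 1%N); first by rewrite big_ord1 /= addr0 expr0 !mulr1.
by case=> // k _; rewrite /= !mulr0.
Qed.

(** Multiplication by (1 - a / z) / (1 + a / z). *)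
Lemma dress_cons a A J t u : 0 < t -> (forall b, b \in a :: A -> 0 <= b < t) -> laurent_bd t J ->
  dress (a :: A) J u + a * dress (a :: A) J (u + 1) =
  dress A J u - a * dress A J (u + 1).
Proof.
move=> t0 At Jt.
have At' c : c \in A -> 0 <= c < t by move=> cA; apply: At; rewrite inE cA orbT.
have key B b : (forall c, c \in B -> 0 <= c < t) ->
    dress B J u + b * dress B J (u + 1) = J u * qfun B 0 +
    nsum (fun k => J (u + 1 + k%:Z) * ((-1) ^+ k.+1 * (qfun B k.+1 - b * qfun B k))).
  move=> Bt; have [C [rho H]] := dress_geom_by t0 Bt Jt.
  have [C0 r0 r1 Hu] := H u; have g1 : geom (fun k => J (u + k%:Z) * ((-1) ^+ k * qfun B k)).
    by exists (C * t ^ (- u)), rho.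
  have g2 : geom (fun k => J (u + 1 + k%:Z) * ((-1) ^+ k * qfun B k)).
    by exists (C * t ^ (- (u + 1))), rho.
  have g3 : geom (fun k => J (u + k.+1%:Z) * ((-1) ^+ k.+1 * qfun B k.+1)).
    exists (C * t ^ (- u) * rho), rho; split=> // [|k]; first by rewrite mulr_ge0.
    by rewrite -mulrA -exprS.
  rewrite /dress (nsum_shift g1) expr0 mul1r addr0 -addrA; congr (_ + _).
  rewrite -[X in X + _]mul1r -nsum_lin //; apply: eq_nsum => k.
  have -> : u + 1 + k%:Z = u + k.+1%:Z by lia.
  by rewrite exprS; ring.
rewrite (key _ a) // -mulNr (key _ (- a)) // qfun_cons0; congr (_ + _).
apply: eq_nsum => k; rewrite qfun_consS; ring.
Qed.

End Dressing.

(** * Wick formula with one-variable operators *)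

Section Kernel.
Variable R : realType.
Implicit Types (a b t C : R) (A : seq R) (J : int -> R) (u v w : int).

(** The coefficient of z^u w^v in (z - w) / (z + w) J(z) I(w), |w| < |z|, for
    p = (J, u) and q = (I, v). *)
Definition Kser (p q : (int -> R) * int) : R :=
  nsum (fun k => ker_coef R k * (p.1 (p.2 + k%:Z) * q.1 (q.2 - k%:Z))).

Variables (t1 t2 : R).
Hypotheses (t1_gt0 : 0 < t1) (t12 : t1 < t2).

Let t2_gt0 : 0 < t2. Proof. exact: lt_trans t12. Qed.

Lemma Kser_geom_by J J' C C' u v : 0 <= C -> 0 <= C' ->
  (forall u, `|J u| <= C * t2 ^ (- u)) -> (forall u, `|J' u| <= C' * t1 ^ (- u)) ->
  geom_by (2 * C * C' * t2 ^ (- u) * t1 ^ (- v)) (t1 / t2)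
    (fun k => ker_coef R k * (J (u + k%:Z) * J' (v - k%:Z))).
Proof.
move=> C0 C'0 JW J'W; split.
- by rewrite !mulr_ge0 // exprz_ge0 // ltW.
- by rewrite mulr_ge0 ?invr_ge0 ?ltW.
- by rewrite ltr_pdivrMr // mul1r.
move=> k; rewrite !normrM.
have k2 : `|ker_coef R k| <= 2.
  rewrite /ker_coef; case: eqP => _; first by rewrite normr1 ler1n.
  by rewrite normrM normrX normrN1 expr1n mulr1 ger0_norm.
apply: le_trans (ler_pM (normr_ge0 _) _ k2
  (ler_pM (normr_ge0 _) (normr_ge0 _) (JW _) (J'W _))) _.
  by rewrite mulr_ge0.
rewrite exprz_shift // exprz_shiftN // exprMn le_eqVlt; apply/orP; left; apply/eqP.
by ring.
Qed.

Lemma Kser_geom J J' u v : laurent_bd t2 J -> laurent_bd t1 J' ->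
  geom (fun k => ker_coef R k * (J (u + k%:Z) * J' (v - k%:Z))).
Proof.
by move=> [C C0 JW] [C' C'0 J'W]; do 2!eexists; exact: Kser_geom_by JW J'W.
Qed.

Lemma Kser_le J J' : laurent_bd t2 J -> laurent_bd t1 J' -> exists2 D, 0 <= D &
  forall u v, `|Kser (J, u) (J', v)| <= D * t2 ^ (- u) * t1 ^ (- v).
Proof.
move=> [C C0 JW] [C' C'0 J'W]; exists (2 * C * C' / (1 - t1 / t2)).
  by rewrite !mulr_ge0 // invr_ge0 subr_ge0 ler_pdivrMr // mul1r ltW.
move=> u v; apply: le_trans (nsum_le (Kser_geom_by u v C0 C'0 JW J'W)) _.
by rewrite le_eqVlt; apply/orP; left; apply/eqP; ring.
Qed.

(** In Kser the first series is estimated on |z| = t2 and the second on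
    |w| = t1.  A series that may occur in either place needs both bounds. *)
Definition both J := laurent_bd t1 J /\ laurent_bd t2 J.

(** J' is J multiplied by (1 - a / z) / (1 + a / z). *)
Definition dressed_by a J J' := forall u, J' u + a * J' (u + 1) = J u - a * J (u + 1).

Lemma Kser_dressed_l a J J' q w : dressed_by a J J' -> both J -> both J' -> both q.1 ->
  Kser (J', w) q + a * Kser (J', w + 1) q = Kser (J, w) q - a * Kser (J, w + 1) q.
Proof.
case: q => [I v] JJ [_ J2] [_ J'2] [I1 _]; rewrite /Kser /=.
rewrite -[X in X + _]mul1r -[X in X - _]mul1r -mulNr.
rewrite -!nsum_lin; try exact: Kser_geom.
apply: eq_nsum => k; have := JJ (w + k%:Z).
rewrite (_ : w + k%:Z + 1 = w + 1 + k%:Z); last by rewrite -!addrA [1 + _]addrC.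
set j1 := J' _; set j2 := J' _; set j3 := J _; set j4 := J _ => E.
transitivity (ker_coef R k * I (v - k%:Z) * (j1 + a * j2)); first by ring.
by rewrite E; ring.
Qed.

Lemma Kser_dressed_r a J J' p w : dressed_by a J J' -> both J -> both J' -> both p.1 ->
  Kser p (J', w) + a * Kser p (J', w + 1) = Kser p (J, w) - a * Kser p (J, w + 1).
Proof.
case: p => [I v] JJ [J1 _] [J'1 _] [_ I2]; rewrite /Kser /=.
rewrite -[X in X + _]mul1r -[X in X - _]mul1r -mulNr.
rewrite -!nsum_lin; try exact: Kser_geom.
apply: eq_nsum => k; have := JJ (w - k%:Z).
rewrite (_ : w - k%:Z + 1 = w + 1 - k%:Z); last by rewrite -!addrA [1 - _]addrC.
set j1 := J' _; set j2 := J' _; set j3 := J _; set j4 := J _ => E.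
transitivity (ker_coef R k * I (v + k%:Z) * (j1 + a * j2)); first by ring.
by rewrite E; ring.
Qed.

Lemma cvg_decay a t D (x : nat -> R) u : 0 <= a -> a < t -> 0 < t ->
  (forall n, `|x n| <= D * t ^ (- (u + n%:Z))) ->
  (fun n => a ^+ n * x n) @ \oo --> (0 : R).
Proof.
move=> a0 at_ t0 xW; have D0 : 0 <= D * t ^ (- (u + 0%N%:Z)).
  exact: le_trans (xW 0%N).
have D0' : 0 <= D * t ^ (- u) by move: D0; rewrite addr0.
apply/norm_cvg0P; apply: (@squeeze_cvgr _ _ _ _ (fun=> 0)
  (geometric (D * t ^ (- u)) (a / t))); last 2 first.
- exact: cvg_cst.
- apply: cvg_geometric; rewrite ger0_norm; first by rewrite ltr_pdivrMr // mul1r.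
  by rewrite mulr_ge0 // invr_ge0 ltW.
apply: nearW => n; rewrite normr_ge0 /= normrM normrX (ger0_norm a0).
apply: le_trans (ler_wpM2l (exprn_ge0 n a0) (xW n)) _.
by rewrite /geometric /= exprz_shift // exprMn le_eqVlt; apply/orP; left; apply/eqP; ring.
Qed.

(** Both entries of the kernel satisfy the recursion of the series, and the
    Pfaffian is linear in each point. *)
Lemma pfl_dressed n a J J' l1 l2 w :
  dressed_by a J J' -> both J -> both J' ->
  all (fun q => `[< both q.1 >]) l1 -> all (fun q => `[< both q.1 >]) l2 ->
  pfl Kser n (l1 ++ (J', w) :: l2) + a * pfl Kser n (l1 ++ (J', w + 1) :: l2) =
  pfl Kser n (l1 ++ (J, w) :: l2) - a * pfl Kser n (l1 ++ (J, w + 1) :: l2).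
Proof.
move=> JJ bJ bJ' b1 b2.
apply: (@pfl_slot R ((int -> R) * int)%type (fun phi =>
   phi (J', w) + a * phi (J', w + 1) = phi (J, w) - a * phi (J, w + 1))
   _ _ Kser _ _ n l1 l2 _ _ b1 b2).
- by rewrite !mulr0 subr0 addr0.
- move=> b c phi psi Hphi Hpsi.
  have -> (p q r t : R) : b * p + c * q + a * (b * r + c * t) =
    b * (p + a * r) + c * (q + a * t) by ring.
  by rewrite Hphi Hpsi; ring.
- by move=> y /asboolP; exact: Kser_dressed_r.
- by move=> y /asboolP; exact: Kser_dressed_l.
Qed.

Lemma pfl_decay n a J' l1 l2 w : 0 <= a -> a < t1 -> both J' ->
  all (fun q => `[< both q.1 >]) l1 -> all (fun q => `[< both q.1 >]) l2 ->
  (fun k => a ^+ k * pfl Kser n (l1 ++ (J', w + k%:Z) :: l2)) @ \oo --> (0 : R).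
Proof.
move=> a0 at_ [J1 J2] b1 b2.
apply: (@pfl_slot R ((int -> R) * int)%type (fun phi =>
   (fun k => a ^+ k * phi (J', w + k%:Z)) @ \oo --> (0 : R))
   _ _ Kser _ _ n l1 l2 _ _ b1 b2).
- rewrite (_ : (fun k => _) = fun=> 0); first exact: cvg_cst.
  by apply: funext => k; rewrite mulr0.
- move=> b c phi psi Hphi Hpsi.
  rewrite (_ : (fun k => _) = (fun k => b * (a ^+ k * phi (J', w + k%:Z))) \+
      (fun k => c * (a ^+ k * psi (J', w + k%:Z)))); last first.
    by apply: funext => k /=; ring.
  have lim0 : b * 0 + c * 0 = 0 :> R by rewrite !mulr0 addr0.
  rewrite -[X in _ --> X]lim0.
  by apply: cvgD; [exact: cvgMl_tmp Hphi | exact: cvgMl_tmp Hpsi].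
- move=> [I v] /asboolP [_ I2]; have [D D0 KW] := Kser_le I2 J1.
  apply: (@cvg_decay a t1 (D * t2 ^ (- v)) _ w) => // k; exact: KW.
- move=> [I v] /asboolP [I1 _]; have [D D0 KW] := Kser_le J2 I1.
  apply: (@cvg_decay a t2 (D * t1 ^ (- v)) _ w) => //; first exact: lt_trans t12.
  by move=> k; apply: le_trans (KW _ _) _; rewrite mulrAC.
Qed.

End Kernel.

Section Wick.
Variable R : realType.
Implicit Types (a b t C : R) (A : seq R) (J : int -> R) (u v w : int) (s : seq int).
Implicit Types (f g : seq nat -> R).

Definition word s f : seq nat -> R := foldr (@Psi R) f s.

Lemma word_rcons s u f : word (rcons s u) f = word s (Psi u f).
Proof. exact: foldr_rcons. Qed.

Lemma word_cat s1 s2 f : word (s1 ++ s2) f = word s1 (word s2 f).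
Proof. exact: foldr_cat. Qed.

Lemma word_lin s b c f f' l :
  word s (fun m => b * f m + c * f' m) l = b * word s f l + c * word s f' l.
Proof.
elim: s l => //= u s IH l; rewrite -Psi_lin; congr Psi; exact: funext.
Qed.

Lemma eq_word N s f f' l : (forall M m, spart M m -> f m = f' m) ->
  spart N l -> word s f l = word s f' l.
Proof.
move=> ff; elim: s N l => [|u s IH] N l spl /=; first exact: ff spl.
by apply: eq_Psi_strict spl => M m spm; exact: IH spm.
Qed.

Lemma tame_word t s f : 0 < t -> tame t f -> tame t (word s f).
Proof. by move=> t0 ft; elim: s => //= u s; exact: tame_Psi. Qed.

Lemma wbounded_word t c s : 0 < t -> 1 <= c -> exists2 B, 0 <= B &
  forall C f, 0 <= C -> wbounded C c t f -> wbounded (B * C) c t (word s f).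
Proof.
move=> t0 c1; elim: s => [|u s [B B0 H]].
  by exists 1 => // C f _ fW; rewrite mul1r.
have c0 : 0 <= c by apply: le_trans c1.
exists (2 * c * t ^ (- u) * B) => [|C f C0 fW].
  by rewrite !mulr_ge0 // exprz_ge0 // ltW.
by rewrite -mulrA; apply: wbounded_Psi => //; [exact: mulr_ge0 | exact: H].
Qed.

Variables (Y : seq R) (t1 t2 r : R).
Hypotheses (t1_gt0 : 0 < t1) (t12 : t1 < t2) (r_gt0 : 0 < r) (rt2 : r * t2 < 1).
Hypothesis Yr : forall y, y \in Y -> 0 <= y < r.

Let t2_gt0 : 0 < t2. Proof. exact: lt_trans t12. Qed.
Let rt1 : r * t1 < 1.
Proof. by apply: le_lt_trans rt2; rewrite ler_wpM2l // ltW. Qed.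

Let g := Gammas Y (delta R [::]).
Let gr : tame r g. Proof. by apply: tame_Gammas => //; exact: tame_delta. Qed.

Lemma pairing_word s f : pairing g (word s f) = pairing (adj s g) f.
Proof. by elim: s g => //= u s IH g'; rewrite pairing_adjoint IH. Qed.

(** The bound of wbounded_Psi on the mode u + k contains t1^(- (u + k)), and
    a < t1. *)
Lemma word_decay a s u f : 0 <= a -> a < t1 -> tame t1 f ->
  (fun k => a ^+ k * pairing g (word s (Psi (u + k%:Z) f))) @ \oo --> (0 : R).
Proof.
move=> a0 at_ [C [c [C0 c1 fW]]]; have [B B0 BW] := wbounded_word s t1_gt0 c1.
have [D [d [D0 d1 gW]]] := gr.
have c0 : 0 <= c by apply: le_trans c1.
have d0 : 0 <= d by apply: le_trans d1.
set S := expR (d * c / (1 - r * t1)).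
apply: (@cvg_decay _ a t1 (D * (B * (2 * c * C)) * S) _ u) => // k.
have W1 : wbounded (2 * c * t1 ^ (- (u + k%:Z)) * C) c t1 (Psi (u + k%:Z) f).
  exact: wbounded_Psi.
have W0 : 0 <= 2 * c * t1 ^ (- (u + k%:Z)) * C.
  by rewrite !mulr_ge0 // exprz_ge0 // ltW.
have W2 := BW _ _ W0 W1.
have := psum_lim_le (wbounded_pair_term D0 (mulr_ge0 B0 W0) d0 c0 (ltW r_gt0) (ltW t1_gt0) rt1 gW W2).
move=> H; apply: le_trans H _; rewrite -/S le_eqVlt; apply/orP; left; apply/eqP.
by ring.
Qed.

(** The operator Gamma a stands between s1 and s2 and is moved to the left, so
    the induction runs over s1 from its last letter.  Once s1 is empty, the
    Cauchy identity removes Gamma a. *)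
Lemma cross n a J J' J2 (h : seq int -> seq nat -> R) (Z : R) :
  0 <= a -> a < t1 -> dressed_by a J J' -> both t1 t2 J -> both t1 t2 J' ->
  both t1 t2 J2 -> (forall s, tame t1 (h s)) ->
  (forall s2 s3, size (s2 ++ s3) = n.*2 -> pairing g (word s2 (h s3)) =
     Z * pfl (@Kser R) n (map (pair J) s2 ++ map (pair J2) s3)) ->
  forall s1 s2 s3, size (s1 ++ s2 ++ s3) = n.*2 ->
    pairing g (word s1 (Gamma a (word s2 (h s3)))) = Cauchy_factor a Y * Z *
      pfl (@Kser R) n (map (pair J') s1 ++ map (pair J) s2 ++ map (pair J2) s3).
Proof.
move=> a0 at_ JJ bJ bJ' bJ2 hc base s1 s2 s3; elim/last_ind: s1 s2 => [|s u IH] s2.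
  move=> sz; rewrite /= pairing_sym (Cauchy a0 at_ r_gt0 rt1 Yr).
    by rewrite -mulrA -base // pairing_sym.
  exact: tame_word.
rewrite cat_rcons => sz.
have hw : tame t1 (word s2 (h s3)) by exact: tame_word.
set F := word s2 (h s3) in hw *.
pose l2 := map (pair J) s2 ++ map (pair J2) s3.
pose x w := pairing g (word s (Psi w (Gamma a F))) -
  Cauchy_factor a Y * Z * pfl (@Kser R) n (map (pair J') s ++ (J', w) :: l2).
suff x0 : x u = 0.
  rewrite word_rcons map_rcons cat_rcons -/l2.
  by apply/eqP; rewrite -subr_eq0 -/(x u) x0.
have b1 : all (fun q : (int -> R) * int => `[< both t1 t2 q.1 >]) (map (pair J') s).
  by apply/allP => _ /mapP[i _ ->]; apply/asboolP.
have b2 : all (fun q : (int -> R) * int => `[< both t1 t2 q.1 >]) l2.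
  by rewrite all_cat; apply/andP; split; apply/allP => _ /mapP[i _ ->]; apply/asboolP.
have ws f : tame t1 f -> tame t1 (word s f) by exact: tame_word.
have GF w : tame t1 (Gamma a (Psi w F)) by apply: tame_Gamma => //; exact: tame_Psi.
have PG w : tame t1 (Psi w (Gamma a F)) by apply: tame_Psi => //; exact: tame_Gamma.
have lin b f f' : tame t1 f -> tame t1 f' ->
    pairing g (word s f) + b * pairing g (word s f') = pairing g (word s (fun l => 1 * f l + b * f' l)).
  move=> ft ft'; rewrite -[X in X + _]mul1r.
  rewrite -(pairing_lin_r _ _ (ltW r_gt0) (ltW t1_gt0) rt1) //; try exact: ws.
  by apply: eq_pairing => // N l spl; rewrite word_lin.
apply: (@rec_decay _ a x) => w; last first.
  rewrite (_ : (fun k => _) = (fun k => a ^+ k * pairing g (word s (Psi (w + k%:Z) (Gamma a F)))) \-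
     (fun k => Cauchy_factor a Y * Z * (a ^+ k * pfl (@Kser R) n (map (pair J') s ++ (J', w + k%:Z) :: l2)))).
    have lim0 : 0 - Cauchy_factor a Y * Z * 0 = 0 :> R by rewrite mulr0 subr0.
    rewrite -[X in _ --> X]lim0.
    apply: cvgB; first by apply: word_decay => //; exact: tame_Gamma.
    by apply: cvgMl_tmp; exact: (pfl_decay t1_gt0 t12).
  have dist (p q s0 b : R) : p * (q - b * s0) = p * q - b * (p * s0) by ring.
  by apply: funext => k; rewrite /x dist.
have IHw v : pairing g (word s (Gamma a (Psi v F))) =
    Cauchy_factor a Y * Z * pfl (@Kser R) n (map (pair J') s ++ (J, v) :: l2).
  have vsz : size (s ++ (v :: s2) ++ s3) = n.*2 by rewrite -sz !size_cat /= !size_cat.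
  exact: (IH (v :: s2) vsz).
have opE : pairing g (word s (Psi w (Gamma a F))) + a * pairing g (word s (Psi (w + 1) (Gamma a F))) =
    pairing g (word s (Gamma a (Psi w F))) + - a * pairing g (word s (Gamma a (Psi (w + 1) F))).
  rewrite !lin //; apply: eq_pairing => // N l spl; apply: eq_word spl => M m spm.
  rewrite mul1r -/(mix a w (Gamma a F) m) (Gamma_mix _ _ _ spm).
  rewrite -(Gamma_lin _ _ _ _ _ spm); apply: eq_Gamma spm => K l' _ _.
  by rewrite mul1r.
have pfE := pfl_dressed t1_gt0 t12 n w JJ bJ bJ' b1 b2.
rewrite /x; move: opE; rewrite !IHw => opE.
set p1 := pairing _ _ in opE *; set p2 := pairing _ _ in opE *.
set q1 := pfl _ _ _ in pfE *; set q2 := pfl _ _ _ in pfE *.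
set q3 := pfl _ _ _ in pfE opE *; set q4 := pfl _ _ _ in pfE opE *.
transitivity (p1 + a * p2 - Cauchy_factor a Y * Z * (q1 + a * q2)); first by ring.
by rewrite opE pfE; ring.
Qed.

(** The vector h s3 stands for whatever is to the right of Gamma_A.  Leaving it
    arbitrary, with its own Pfaffian formula as a hypothesis, lets the formula be
    iterated: first with Gamma_qX and then with Gamma_X. *)
Theorem wick_Gammas n A J J2 (h : seq int -> seq nat -> R) (Z : R) :
  (forall a, a \in A -> 0 <= a < t1) -> both t1 t2 J -> both t1 t2 J2 ->
  (forall s, tame t1 (h s)) ->
  (forall s2 s3, size (s2 ++ s3) = n.*2 -> pairing g (word s2 (h s3)) =
     Z * pfl (@Kser R) n (map (pair J) s2 ++ map (pair J2) s3)) ->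
  forall s1 s3, size (s1 ++ s3) = n.*2 ->
    pairing g (word s1 (Gammas A (h s3))) = (\prod_(a <- A) Cauchy_factor a Y) * Z *
      pfl (@Kser R) n (map (pair (dress A J)) s1 ++ map (pair J2) s3).
Proof.
move=> At bJ bJ2 hc base; elim: A At => [|a A IH] At s1 s3 sz.
  rewrite big_nil mul1r (_ : dress [::] J = J) ?base //.
  by apply: funext => u; exact: dress_nil.
have At' c : c \in A -> 0 <= c < t1 by move=> cA; apply: At; rewrite inE cA orbT.
have /andP[a0 at_] := At a (mem_head _ _).
have le2 B : (forall c, c \in B -> 0 <= c < t1) -> forall c, c \in B -> 0 <= c < t2.
  by move=> Bt c cB; have /andP[-> ct] := Bt c cB; exact: lt_trans t12.
have bothd B : (forall c, c \in B -> 0 <= c < t1) -> both t1 t2 (dress B J).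
  by move=> Bt; case: bJ => J1 J2'; split; apply: laurent_bd_dress => //; exact: le2.
rewrite big_cons -[Cauchy_factor a Y * _ * Z]mulrA.
have := @cross n a (dress A J) (dress (a :: A) J) J2 (fun s => Gammas A (h s))
  ((\prod_(c <- A) Cauchy_factor c Y) * Z) a0 at_ _ (bothd _ At') (bothd _ At) bJ2 _ (IH At') s1 [::] s3.
apply => //.
- by move=> u; case: bJ => J1 _; exact: dress_cons J1.
- by move=> s; apply: tame_Gammas.
Qed.

End Wick.

(** * The correlation kernel as a series *)

Section AbsSum.
Variable R : realType.

Lemma geom_norm_le (x y : nat -> R) : (forall k, `|y k| <= `|x k|) -> geom x -> geom y.
Proof.
move=> yx [C [rho [C0 r0 r1 xW]]]; exists C, rho; split=> // k.
exact: le_trans (yx k) (xW k).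
Qed.

Lemma esum_nat (T : choiceType) (e : nat -> T) (G : T -> R) : injective e ->
  (forall t, 0 <= G t) -> (forall t, (forall k, t <> e k) -> G t = 0) ->
  geom (G \o e) ->
  (\esum_(t in [set: T]) (G t)%:E = (nsum (G \o e))%:E)%E.
Proof.
move=> ie G0 Ge gG.
have -> : (\esum_(t in [set: T]) (G t)%:E = \esum_(t in range e) (G t)%:E)%E.
  rewrite [RHS]esum_mkcond; apply: eq_esum => t _; case: ifPn => //.
  rewrite notin_setE => nt; rewrite Ge // => k tk; apply: nt; exists k => //.
rewrite (@reindex_esum _ _ _ [set: nat] _ e); last first.
  split; [by move=> k _; exists k | by move=> i j _ _; exact: ie | by []].
rewrite -(@nneseries_esumT _ (fun k => (G (e k))%:E)); last by move=> n; rewrite lee_fin.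
apply: cvg_lim => //; have cv := cvg_nsum gG.
rewrite (_ : (fun n => _) = EFin \o series (G \o e)); first by apply: cvg_EFin; [exact: nearW | exact: cv].
by apply: funext => n; rewrite /series /= sumEFin.
Qed.

(** The sum of a family supported on the image of e as an ordinary series; the
    positive and negative parts are summed separately. *)
Lemma abs_sum_nat (T : choiceType) (e : nat -> T) (F : T -> R) : injective e ->
  (forall t, (forall k, t <> e k) -> F t = 0) -> geom (F \o e) ->
  abs_sum F = nsum (F \o e).
Proof.
move=> ie Fe gF; rewrite /abs_sum.
pose P t := Num.max (F t) 0; pose N t := Num.max (- F t) 0.
have gP : geom (P \o e).
  by apply: geom_norm_le gF => k; rewrite /= /P; have [|] := leP (F (e k)) 0; rewrite ?normr0.
have gN : geom (N \o e).
  apply: geom_norm_le gF => k; rewrite /= /N.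
  by have [|] := leP (- F (e k)) 0; rewrite ?normr0 ?normrN.
have -> : (\esum_(i in [set: T]) (EFin \o F)^\+ i = \esum_(i in [set: T]) (P i)%:E)%E.
  by apply: eq_esum => t _; rewrite funeposE /P EFin_max.
have -> : (\esum_(i in [set: T]) (EFin \o F)^\- i = \esum_(i in [set: T]) (N i)%:E)%E.
  by apply: eq_esum => t _; rewrite funenegE /N EFin_max.
rewrite (esum_nat ie _ _ gP) => [|t|t te]; last 2 first.
- by rewrite /P le_max lexx orbT.
- by rewrite /P Fe // maxxx.
rewrite (esum_nat ie _ _ gN) => [|t|t te]; last 2 first.
- by rewrite /N le_max lexx orbT.
- by rewrite /N Fe // oppr0 maxxx.
rewrite /= -[X in X - _]mul1r -mulN1r -nsum_lin //; apply: eq_nsum => k.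
rewrite /= /P /N; have [|] := leP (F (e k)) 0; have [|] := leP (- F (e k)) 0; lra.
Qed.

End AbsSum.

Section CorrelationKernel.
Variable R : realType.
Implicit Types (A X Y : seq R) (J : int -> R) (u v : int).

Lemma laurent_mul_dress A J t u : 0 < t -> (forall a, a \in A -> 0 <= a < t) -> laurent_bd t J ->
  laurent_mul J (laurent_neg (ps_opp (qfun A))) u = dress A J u.
Proof.
move=> t0 At Jt; rewrite /laurent_mul (@abs_sum_nat _ _ (fun k : nat => u + k%:Z)).
- apply: eq_nsum => k /=; rewrite /laurent_neg /ps_opp.
  by rewrite (_ : - (u - (u + k%:Z)) = k%:Z); [|lia].
- by move=> i j /addrI [].
- move=> w wu; rewrite /laurent_neg /laurent_pos.
  case E : (- (u - w)) => [k|k]; rewrite ?mulr0 //.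
  by case: (wu k); lia.
have [C [rho H]] := dress_geom_by t0 At Jt.
exists (C * t ^ (- u)), rho; apply: geom_by_eq (H u) => k /=.
rewrite /laurent_neg /ps_opp.
by rewrite (_ : - (u - (u + k%:Z)) = k%:Z); [|lia].
Qed.

Lemma kernel_factorE (m n : int) : kernel_factor R true m n =
  if n is Posz k then if m == - k%:Z then ker_coef R k / 2 else 0 else 0.
Proof.
rewrite /kernel_factor /inv_add /inv_add_gt /ker_coef.
case: n => [[|k]|k]; last by rewrite subr0 mul0r.
  rewrite (_ : 0%:Z - 1 = Negz 0) // subr0 (_ : (m - 1 == -1 - 0) = (m == - 0%:Z)).
    by case: ifP; rewrite ?mul0r.
  by apply/eqP/eqP; lia.
rewrite (_ : k.+1%:Z - 1 = k%:Z); last by lia.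
rewrite (_ : (m - 1 == -1 - k.+1%:Z) = (m == - k.+1%:Z)); last by apply/eqP/eqP; lia.
rewrite (_ : (m == -1 - k%:Z) = (m == - k.+1%:Z)); last by apply/eqP/eqP; lia.
by case: ifP => _; rewrite ?subr0 ?mul0r //= exprS; ring.
Qed.

Lemma kernel_factor_sym (m n : int) : kernel_factor R false m n = - kernel_factor R true n m.
Proof. by rewrite /kernel_factor /inv_add -mulNr opprB. Qed.

Variables (q : R) (X Y : seq R) (t1 t2 r : R).
Hypotheses (t1_gt0 : 0 < t1) (t12 : t1 < t2) (r_gt0 : 0 < r) (rt2 : r * t2 < 1).
Hypothesis Yr : forall y, y \in Y -> 0 <= y < r.
Hypothesis Xt : forall a, a \in X -> 0 <= a < t1.
Hypothesis qXt : forall a, a \in scale_alphabet q X -> 0 <= a < t1.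

Let t2_gt0 : 0 < t2. Proof. exact: lt_trans t12. Qed.

Lemma both_qcoef : both t1 t2 (qcoef Y).
Proof.
have [C C0 CW] := qfun_le r_gt0 Yr.
have H t : 0 < t -> r * t < 1 -> laurent_bd t (qcoef Y).
  move=> t0 rt; exists C => // -[k|k]; last first.
    by rewrite /qcoef /= normr0 mulr_ge0 // exprz_ge0 // ltW.
  apply: le_trans (CW k) _; rewrite ler_wpM2l // -exprnN -exprVn.
  rewrite lerXn2r ?nnegrE ?invr_ge0 ?(ltW r_gt0) ?(ltW t0) //.
  by rewrite -[leRHS]mul1r ler_pdivlMr // ltW.
split; apply: H => //; apply: le_lt_trans rt2; rewrite ler_wpM2l // ltW //.
Qed.

Lemma both_dress A J : (forall a, a \in A -> 0 <= a < t1) -> both t1 t2 J ->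
  both t1 t2 (dress A J).
Proof.
move=> At [J1 J2]; split; apply: laurent_bd_dress => // a aA.
by have /andP[-> at_] := At a aA; exact: lt_trans t12.
Qed.

Lemma J1_dress : J1 q X Y = dress (scale_alphabet q X) (qcoef Y).
Proof.
apply: funext => u; apply: laurent_mul_dress t1_gt0 qXt _.
by case: both_qcoef.
Qed.

Lemma J2_dress : J2 q X Y = dress X (J1 q X Y).
Proof.
apply: funext => u; apply: laurent_mul_dress t1_gt0 Xt _.
by rewrite J1_dress; case: (both_dress qXt both_qcoef).
Qed.

Lemma both_J t : both t1 t2 (J q X Y t).
Proof.
rewrite /J; case: ifP => _; rewrite ?J2_dress J1_dress.
  exact: both_dress both_qcoef.
by apply: both_dress => //; exact: both_dress both_qcoef.
Qed.

Lemma norm_half_le1 : `|2^-1 : R| <= 1.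
Proof. by rewrite ger0_norm ?invr_ge0 // invf_le1 ?ler1n. Qed.

Lemma corrK_ge a b u v : (b <= a)%N ->
  corrK q X Y a b u v = 2^-1 * Kser (J q X Y a, u) (J q X Y b, v).
Proof.
move=> ba; rewrite /corrK ba /laurent2_mul.
set F := fun m : int * int => _.
have gK : geom (fun k => ker_coef R k * (J q X Y a (u + k%:Z) * J q X Y b (v - k%:Z))).
  by apply: (Kser_geom t1_gt0 t12); [case: (both_J a) | case: (both_J b)].
have FE k : F (- k%:Z, k%:Z) =
    2^-1 * (ker_coef R k * (J q X Y a (u + k%:Z) * J q X Y b (v - k%:Z))).
  by rewrite /F /= kernel_factorE eqxx opprK; ring.
rewrite (@abs_sum_nat _ _ (fun k : nat => (- k%:Z, k%:Z))).
- rewrite /Kser /= -[RHS]addr0 -[X in _ + X](mul0r (nsum (fun k =>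
    ker_coef R k * (J q X Y a (u + k%:Z) * J q X Y b (v - k%:Z))))) -nsum_lin //.
  by apply: eq_nsum => k; rewrite /comp FE mul0r addr0.
- by move=> i j [_ ->].
- move=> [m n] mn; rewrite /F /= kernel_factorE; case: n mn => [k|k] mn; last by rewrite mul0r.
  by case: eqP => [mk|]; rewrite ?mul0r //; case: (mn k); rewrite mk.
- apply: geom_norm_le gK => k; rewrite /comp FE normrM.
  by rewrite -[leRHS]mul1r ler_wpM2r // norm_half_le1.
Qed.

(** (z - w) / (z + w) changes sign when z and w are exchanged, and so does the
    region of expansion. *)
Lemma corrK_lt a b u v : (a < b)%N ->
  corrK q X Y a b u v = - corrK q X Y b a v u.
Proof.
move=> ab; rewrite (corrK_ge _ _ (ltnW ab)) /corrK leqNgt ab /laurent2_mul /=.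
set F := fun m : int * int => _.
have gK : geom (fun k => ker_coef R k * (J q X Y b (v + k%:Z) * J q X Y a (u - k%:Z))).
  by apply: (Kser_geom t1_gt0 t12); [case: (both_J b) | case: (both_J a)].
have FE k : F (k%:Z, - k%:Z) =
    - 2^-1 * (ker_coef R k * (J q X Y b (v + k%:Z) * J q X Y a (u - k%:Z))).
  by rewrite /F /= kernel_factor_sym kernel_factorE eqxx opprK; ring.
rewrite (@abs_sum_nat _ _ (fun k : nat => (k%:Z, - k%:Z))).
- rewrite /Kser /= -mulNr -[RHS]addr0 -[X in _ + X](mul0r (nsum (fun k =>
    ker_coef R k * (J q X Y b (v + k%:Z) * J q X Y a (u - k%:Z))))) -nsum_lin //.
  by apply: eq_nsum => k; rewrite /comp FE mul0r addr0.
- by move=> i j [->].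
- move=> [m n] mn; rewrite /F /= kernel_factor_sym kernel_factorE.
  case: m mn => [k|k] mn; last by rewrite oppr0 mul0r.
  by case: eqP => [mk|]; rewrite ?oppr0 ?mul0r //; case: (mn k); rewrite mk.
- apply: geom_norm_le gK => k; rewrite /comp FE normrM normrN.
  by rewrite -[leRHS]mul1r ler_wpM2r // norm_half_le1.
Qed.

End CorrelationKernel.

(** * Reordering pairs of points in a Pfaffian *)

Section Pairs.
Variables (R : comNzRingType) (P : eqType) (T : Type) (K : T -> T -> R).
Variables (creator annihilator : P -> T).
Implicit Types (p : P) (s : seq P) (c d : seq T).

Definition anti x y := K x y = - K y x.

Hypothesis anti_pm : forall p p', p != p' ->
  forall x y, x = creator p \/ x = annihilator p -> y = creator p' \/ y = annihilator p' -> anti x y.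

(** Here creator p and annihilator p are the two modes of the point p. *)
Definition pairs s := flatten [seq [:: creator p; annihilator p] | p <- s].

Lemma size_pairs s : size (pairs s) = (size s).*2.
Proof. by elim: s => //= p s; rewrite /pairs /= => ->. Qed.

Lemma In_pairs y s : List.In y (pairs s) ->
  exists2 p, p \in s & y = creator p \/ y = annihilator p.
Proof.
elim: s => //= p s IH [yp|[yp|/IH[p' ps yp]]].
- by exists p; [rewrite mem_head | left].
- by exists p; [rewrite mem_head | right].
- by exists p' => //; rewrite inE ps orbT.
Qed.

(** A field commutes with a product of pairs that belong to other points. *)
Lemma pfl_move_pairs n x p s c d : p \notin s -> x = creator p \/ x = annihilator p ->
  pfl K n (c ++ x :: pairs s ++ d) = pfl K n (c ++ pairs s ++ x :: d).
Proof.
move=> ps xp; rewrite pfl_move => [|y /In_pairs[p' p's yp]].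
  by rewrite size_pairs -signr_odd odd_double mul1r.
by apply: (anti_pm _ xp yp); apply: contraNneq ps => ->.
Qed.

Lemma pfl_pairs_front n p s1 s2 c d : p \notin s1 ->
  pfl K n (c ++ pairs (s1 ++ p :: s2) ++ d) = pfl K n (c ++ pairs (p :: s1 ++ s2) ++ d).
Proof.
move=> ps1; rewrite /pairs /= !map_cat !flatten_cat /= -/(pairs s1) -/(pairs s2).
rewrite -!catA /= -(pfl_move_pairs _ _ _ ps1) //; last by left.
rewrite -cat_rcons -(pfl_move_pairs _ _ _ ps1) ?cat_rcons //; last by right.
Qed.

Lemma pfl_pairs_perm n s s' c d : uniq s -> perm_eq s s' ->
  pfl K n (c ++ pairs s ++ d) = pfl K n (c ++ pairs s' ++ d).
Proof.
elim: s s' c => [|p s IH] s' c /= us ps; first by have := perm_size ps; case: s' {ps}.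
case/andP: us => psn us.
have ps' : p \in s' by rewrite -(perm_mem ps) mem_head.
have us' : uniq s' by rewrite -(perm_uniq ps) /= psn.
move: ps us'; case/splitPr: ps' => s1 s2 ps us'.
have ps12 : perm_eq s (s1 ++ s2).
  by rewrite -(perm_cons p) (perm_trans ps) // perm_catC /= perm_cons perm_catC.
have ps1 : p \notin s1.
  by move: us'; rewrite cat_uniq /= negb_or => /and3P[_ /andP[]].
rewrite pfl_pairs_front // /pairs /= -/(pairs s) -/(pairs (s1 ++ s2)).
have := IH _ (rcons (rcons c (creator p)) (annihilator p)) us ps12.
by rewrite !cat_rcons.
Qed.

Lemma In_nested y s : List.In y (map creator s ++ rev (map annihilator s)) ->
  exists2 p, p \in s & y = creator p \/ y = annihilator p.
Proof.
have InE (l : seq T) : List.In y (rev l) -> List.In y l.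
  by rewrite -[l in X in _ -> X]revK; elim: (rev l) => //= z t IH H; rewrite rev_cons;
    move: H IH; rewrite -cats1 => -[->|/[swap] H /H]; rewrite List.in_app_iff /=; tauto.
have In_map (h : P -> T) : List.In y (map h s) -> exists2 p, p \in s & y = h p.
  elim: s => //= p s IH [<-|/IH[p' ps ->]]; first by exists p; rewrite ?mem_head.
  by exists p' => //; rewrite inE ps orbT.
rewrite List.in_app_iff => -[/In_map|/InE /In_map] [p ps yp]; exists p => //.
  by left.
by right.
Qed.

(** The innermost pair stays; the annihilator of each outer point moves
    inwards past the pairs of the other points. *)
Lemma pfl_nested n s c d : uniq s ->
  pfl K n (c ++ (map creator s ++ rev (map annihilator s)) ++ d) =
  pfl K n (c ++ pairs s ++ d).
Proof.
elim: s c => //= p s IH c /andP[ps us].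
rewrite rev_cons -cats1 catA -!catA /=.
have := IH (rcons (rcons c (creator p)) (annihilator p)) us; rewrite !cat_rcons => <-.
rewrite -cat_rcons (catA (map creator s)) -[in RHS]cat_rcons pfl_move.
  rewrite size_cat size_rev !size_map addnn -signr_odd odd_double mul1r.
  by rewrite -!catA.
move=> y /In_nested[p' p's yp]; apply: (anti_pm (p := p) (p' := p')) => //; last by right.
by apply: contraNneq ps => ->.
Qed.

End Pairs.

(** * Occupation of parts as a word of fields *)

Section Occupation.
Variable R : realType.
Implicit Types (f : seq nat -> R) (xs : seq nat).

Definition occupied xs f l : R := if all (fun k => k \in l) xs then f l else 0.

(** The order in which M_S lists the modes of its points. *)
Definition nested_ints xs : seq int := map Posz xs ++ rev (map (fun x : nat => - x%:Z) xs).

Lemma size_nested_ints xs : size (nested_ints xs) = (size xs).*2.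
Proof. by rewrite size_cat size_rev !size_map addnn. Qed.

(** Psi_x Psi_(-x) is 2 (-1)^x times the projection onto the partitions that
    contain x.  A function c of the other parts may stand between the two modes,
    for the projections of the points nested inside. *)
Lemma Psi_Psi_occ N (c f : seq nat -> R) x l : (0 < x)%N -> spart N l ->
  (forall l1 l2, c (l1 ++ x :: l2) = c (l1 ++ l2)) ->
  Psi x%:Z (fun m => c m * Psi (- x%:Z) f m) l =
  2 * (-1) ^+ x * (if x \in l then c l * f l else 0).
Proof.
case: x => // x _; rewrite -NegzE; elim: l N c f => [|y t IH] N c f.
  by rewrite /= !mulr0.
rewrite spart_cons => /and3P[y0 yN spt] cx.
have [xy|yx] := ltnP x.+1 y.
  rewrite Psi_cons // (_ : (fun m => _) =
    fun m => - (c (y :: m) * Psi (Negz x) (fun m => f (y :: m)) m)); last first.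
    by apply: funext => m; rewrite Psi_cons // mulrN.
  rewrite PsiN opprK (IH y (fun m => c (y :: m)) (fun m => f (y :: m))) //.
    by rewrite inE ltn_eqF.
  by move=> l1 l2; apply: (cx (y :: l1)).
move: yx; rewrite leq_eqVlt => /orP[/eqP yx|yx].
  rewrite yx in y0 spt *; rewrite Psi_create_in Psi_kill_out // mem_head.
  by rewrite (cx [::] t) /=; ring.
have spy : spart x.+1 (y :: t) by rewrite spart_cons y0 yx.
rewrite Psi_create_out // (_ : x.+1 \in y :: t = false) ?mulr0 //.
apply/negbTE; rewrite inE gtn_eqF //= => {IH cx}.
elim: t y {N yN y0 spt} yx spy => //= z t IH y yx /and3P[y0 _ /and3P[z0 zy spt]].
rewrite inE gtn_eqF ?(ltn_trans zy) //=; apply: (IH z); first exact: ltn_trans zy yx.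
by rewrite z0 (ltn_trans zy yx).
Qed.

Lemma word_nested_ints N xs f l : uniq xs -> all (fun x => 0 < x)%N xs -> spart N l ->
  word (nested_ints xs) f l = (\prod_(x <- xs) (2 * (-1) ^+ x)) * occupied xs f l.
Proof.
elim: xs N f l => [|x xs IH] N f l; first by rewrite big_nil mul1r.
case/andP=> xxs us /andP[x0 xs0] spl.
have -> : nested_ints (x :: xs) = x%:Z :: nested_ints xs ++ [:: - x%:Z].
  by rewrite /nested_ints /= rev_cons -cats1 catA.
set D := \prod_(x <- xs) _ in IH *.
pose c (m : seq nat) : R := D * (if all (fun k => k \in m) xs then 1 else 0).
rewrite /word /= -/(word _ f) word_cat.
rewrite (@eq_Psi_strict _ N _ _ (fun m => c m * Psi (- x%:Z) f m)) //; last first.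
  move=> M m spm; rewrite (IH M) // /c /occupied -mulrA; congr (_ * _).
  by case: ifP; rewrite ?mul1r ?mul0r.
rewrite (@Psi_Psi_occ N) //; last first.
  move=> l1 l2; rewrite /c (@eq_in_all _ _ (fun k => k \in l1 ++ l2)) // => k kx.
  rewrite !mem_cat inE; have -> // : (k == x) = false.
  by apply/negbTE; apply: contraNneq xxs => <-.
rewrite big_cons -/D /c /occupied [all _ (x :: xs)]/=; case: (x \in l) => /=; last by ring.
by case: (all _ xs); ring.
Qed.

Lemma tame_occupied t xs f : 0 < t -> tame t f -> tame t (occupied xs f).
Proof.
move=> t0 [C [c [C0 c1 fW]]]; exists C, c; split=> // N l spl; rewrite /occupied.
case: ifP => _; first exact: fW spl.
by rewrite normr0 mulr_ge0 // weight_ge0 ?ltW // (lt_le_trans _ c1).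
Qed.

End Occupation.

Section Correlations.
Variable R : realType.
Variables (q : R) (X Y : seq R) (t1 t2 r : R).
Hypotheses (t1_gt0 : 0 < t1) (t12 : t1 < t2) (r_gt0 : 0 < r) (rt2 : r * t2 < 1).
Hypothesis Yr : forall y, y \in Y -> 0 <= y < r.
Hypothesis Xt : forall a, a \in X -> 0 <= a < t1.
Hypothesis qXt : forall a, a \in scale_alphabet q X -> 0 <= a < t1.

Let t2_gt0 : 0 < t2. Proof. exact: lt_trans t12. Qed.
Let rt1 : r * t1 < 1.
Proof. by apply: le_lt_trans rt2; rewrite ler_wpM2l // ltW. Qed.

Local Notation qX := (scale_alphabet q X).
Local Notation d0 := (delta R [::]).
Local Notation g := (Gammas Y d0).
Local Notation f1 := (Gammas qX d0).

Definition Znorm : R := \prod_(a <- X) Cauchy_factor a Y * \prod_(a <- qX) Cauchy_factor a Y.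

Lemma Znorm_Hprod : Znorm = Hprod X Y * Hprod qX Y.
Proof. by []. Qed.

Lemma Znorm_gt0 : 0 < Znorm.
Proof.
have H A : (forall a, a \in A -> 0 <= a < t1) -> 0 < \prod_(a <- A) Cauchy_factor a Y.
  move=> At; rewrite big_seq prodr_gt0 // => a /At/andP[a0 at_].
  rewrite /Cauchy_factor big_seq prodr_gt0 // => y /Yr/andP[y0 yr].
  have : a * y <= t1 * r by rewrite ler_pM // ltW.
  move: rt1; rewrite mulrC => H1 H2; have ay : 0 <= a * y by rewrite mulr_ge0.
  by rewrite divr_gt0 //; lra.
by rewrite mulr_gt0 // H.
Qed.

(** With fields only, the pairing is a coordinate of an adjoint word at the
    empty partition. *)
Lemma wick_base n s2 s3 : size (s2 ++ s3) = n.*2 ->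
  pairing g (word s2 (word s3 d0)) =
  1 * pfl (@Kser R) n (map (pair (qcoef Y)) s2 ++ map (pair (qcoef Y)) s3).
Proof.
move=> sz; rewrite -word_cat pairing_word pairing_delta0 (wick_Q _ sz) -map_cat mul1r.
rewrite !pfl_map; congr pfl; apply: funext => u; apply: funext => v.
rewrite /Kser /=; case: v => [m|m].
  rewrite (@nsum_finite _ m.+1) // => k mk; rewrite (_ : qcoef Y (m%:Z - k%:Z) = 0) ?mulr0 //.
  have : m%:Z - k%:Z < 0 by lia.
  by case: (m%:Z - k%:Z).
rewrite (@nsum_finite _ 0%N) ?big_ord0 // => k _.
rewrite (_ : qcoef Y (Negz m - k%:Z) = 0) ?mulr0 //.
have : Negz m - k%:Z < 0 by lia.
by case: (Negz m - k%:Z).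
Qed.

Lemma wick1 n s : size s = n.*2 ->
  pairing g (word s f1) = (\prod_(a <- qX) Cauchy_factor a Y) *
    pfl (@Kser R) n (map (pair (J1 q X Y)) s).
Proof.
move=> sz; have bqz : both t1 t2 (qcoef Y) by exact: (both_qcoef t1_gt0 t12 r_gt0 rt2 Yr).
have hc s' : tame t1 (word s' d0) by apply: tame_word => //; exact: tame_delta.
have sz' : size (s ++ [::]) = n.*2 by rewrite cats0.
rewrite (J1_dress t1_gt0 t12 r_gt0 rt2 Yr qXt).
have := @wick_Gammas _ Y t1 t2 r t1_gt0 t12 r_gt0 rt2 Yr n qX (qcoef Y) (qcoef Y)
  (fun s => word s d0) 1 qXt bqz bqz hc (@wick_base n) s [::] sz'.
by rewrite cats0 mulr1.
Qed.

Lemma wick2 n s2 s1 : size (s2 ++ s1) = n.*2 ->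
  pairing g (word s2 (Gammas X (word s1 f1))) = Znorm *
    pfl (@Kser R) n (map (pair (J2 q X Y)) s2 ++ map (pair (J1 q X Y)) s1).
Proof.
move=> sz; have bJ1 : both t1 t2 (J1 q X Y).
  rewrite (J1_dress t1_gt0 t12 r_gt0 rt2 Yr qXt).
  by apply: both_dress => //; exact: (both_qcoef t1_gt0 t12 r_gt0 rt2 Yr).
rewrite (J2_dress t1_gt0 t12 r_gt0 rt2 Yr Xt qXt).
apply: (@wick_Gammas _ Y t1 t2 r t1_gt0 t12 r_gt0 rt2 Yr n X _ _ (fun s => word s f1)) => //.
- move=> s; apply: tame_word => //; apply: tame_Gammas => //; exact: tame_delta.
- by move=> s s' szs; rewrite -word_cat (wick1 szs) map_cat.
Qed.

Lemma f1_tame : tame t1 f1.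
Proof. by apply: tame_Gammas => //; exact: tame_delta. Qed.

Lemma g_tame : tame r g.
Proof. by apply: tame_Gammas => //; exact: tame_delta. Qed.

Lemma pairing_anti f u v : tame t1 f -> u + v != 0 ->
  pairing g (word [:: u; v] f) = - pairing g (word [:: v; u] f).
Proof.
move=> ft uv; apply/eqP; rewrite -addr_eq0 -[X in X + _]mul1r -[X in _ + X]mul1r.
rewrite -(pairing_lin_r _ _ (ltW r_gt0) (ltW t1_gt0) rt1 g_tame); try by apply: tame_word.
apply/eqP; apply: psum_lim0 => N l spl.
by rewrite /pair_term /= !mul1r (clifford _ _ _ spl) (negbTE uv) !mulr0.
Qed.

(** The series itself does not show the antisymmetry.  Up to a nonzero constant
    it is a pairing with two fields, to which the Clifford relations apply. *)
Lemma Kser_anti t u v : u + v != 0 ->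
  Kser (J q X Y t, u) (J q X Y t, v) = - Kser (J q X Y t, v) (J q X Y t, u).
Proof.
move=> uv; have Z0 : Znorm != 0 by rewrite gt_eqF // Znorm_gt0.
have pf2 (I : int -> R) w w' :
    pfl (@Kser R) 1 [:: (I, w); (I, w')] = Kser (I, w) (I, w').
  by rewrite /= mulr1 subr0.
rewrite /J; case: ifP => _.
  have W w w' : pairing g (word [:: w; w'] f1) =
      (\prod_(a <- qX) Cauchy_factor a Y) * Kser (J1 q X Y, w) (J1 q X Y, w').
    by rewrite (@wick1 1) // pf2.
  have := pairing_anti f1_tame uv; rewrite !W -mulrN; apply: mulfI.
  by move: Z0; rewrite mulf_eq0 negb_or => /andP[].
have W w w' : pairing g (word [:: w; w'] (Gammas X f1)) =
    Znorm * Kser (J2 q X Y, w) (J2 q X Y, w').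
  by rewrite (@wick2 1 [:: w; w'] [::]) // pf2.
have ft : tame t1 (Gammas X f1) by apply: tame_Gammas => //; exact: f1_tame.
by have := pairing_anti ft uv; rewrite !W -mulrN; apply: mulfI.
Qed.

End Correlations.

(** * Radii of convergence *)

Section Radii.
Variable R : realType.

Lemma exists_max (A : seq R) : (forall a, a \in A -> 0 <= a) ->
  exists m, [/\ 0 <= m, forall a, a \in A -> a <= m & m = 0 \/ m \in A].
Proof.
elim: A => [|a A IH] A0; first by exists 0; split=> //; left.
have [|m [m0 Am mA]] := IH; first by move=> b bA; apply: A0; rewrite inE bA orbT.
have a0 := A0 a (mem_head _ _); have [am|ma] := leP a m.
  exists m; split=> // [b|]; first by rewrite inE => /orP[/eqP ->|/Am].
  by case: mA => mA; [left | right; rewrite inE mA orbT].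
exists a; split=> // [b|]; last by right; rewrite mem_head.
by rewrite inE => /orP[/eqP ->//|/Am bm]; exact: le_trans bm (ltW ma).
Qed.

Lemma exists_between (m p : R) : 0 <= m -> 0 <= p -> m * p < 1 ->
  exists2 s, p < s & m * s < 1.
Proof.
move=> m0 p0 mp; have [->|mn0] := eqVneq m 0.
  by exists (p + 1); rewrite ?mul0r ?ltr01 // ltrDl ltr01.
have m_gt0 : 0 < m by rewrite lt_neqAle eq_sym mn0.
have pm : p < m^-1 by rewrite -[m^-1]mul1r ltr_pdivlMr // mulrC.
exists ((p + m^-1) / 2); first by lra.
have -> : m * ((p + m^-1) / 2) = (m * p + 1) / 2 by field.
lra.
Qed.

(** With such radii the annulus t1 <= |z| <= t2 lies in the region of
    convergence of all series, and has room for |w| < |z|. *)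
Lemma exists_radii (A Y : seq R) : (forall a, a \in A -> 0 <= a) ->
  (forall y, y \in Y -> 0 <= y) -> (forall a y, a \in A -> y \in Y -> a * y < 1) ->
  exists t1 t2 r : R, [/\ 0 < t1, t1 < t2, 0 < r, r * t2 < 1 &
    (forall y, y \in Y -> 0 <= y < r) /\ (forall a, a \in A -> 0 <= a < t1)].
Proof.
move=> A0 Y0 AY; have [m [m0 Am mA]] := exists_max A0.
have [p [p0 Yp pY]] := exists_max Y0.
have mp : m * p < 1.
  case: mA => [->|mA]; first by rewrite mul0r.
  by case: pY => [->|pY]; [rewrite mulr0 | exact: AY].
have [r pairing mr] := exists_between m0 p0 mp.
have r0 : 0 <= r by apply: le_trans (ltW pairing).
have [|t2 mt rt] := exists_between r0 m0 _; first by rewrite mulrC.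
exists ((m + t2) / 2), t2, r; split=> //; try lra.
split=> [y yY|a aA]; apply/andP; split; first exact: Y0.
- exact: le_lt_trans (Yp y yY) pairing.
- exact: A0.
- by have := Am a aA; lra.
Qed.

End Radii.

(** * Correlations as pairings *)

Section CountableSums.
Variable R : realType.

(** A sum of nonnegative terms can be computed along any exhaustion by finite
    sets. *)
Lemma esum_lim (T : choiceType) (D : set T) (a : T -> R) (s : nat -> seq T) (l : R) :
  (forall t, D t -> 0 <= a t) ->
  (forall N, uniq (s N)) -> (forall N t, t \in s N -> D t) ->
  (forall N M, (N <= M)%N -> {subset s N <= s M}) ->
  (forall t, D t -> exists N, t \in s N) ->
  (fun N => \sum_(t <- s N) a t) @ \oo --> l ->
  (\esum_(t in D) (a t)%:E = l%:E)%E.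
Proof.
move=> a0 us sD sM Ds cv.
have s_split N M : (N <= M)%N ->
    \sum_(t <- s M) a t = \sum_(t <- s N) a t + \sum_(t <- s M | t \notin s N) a t.
  move=> NM; rewrite (bigID (mem (s N))) /=; congr (_ + _).
  rewrite -big_filter; apply: perm_big; apply: uniq_perm; rewrite ?filter_uniq //.
  move=> t; rewrite mem_filter; case tN : (t \in s N) => //=.
  exact: (sM _ _ NM).
have homo_s : {homo (fun N => \sum_(t <- s N) a t) : N M / (N <= M)%N >-> N <= M}.
  move=> N M NM; rewrite (s_split _ _ NM) lerDl big_seq_cond sumr_ge0 // => t.
  by case/andP=> /sD /a0.
have cvgs : cvgn (fun N => \sum_(t <- s N) a t) by apply/cvg_ex; exists l.
have lE : limn (fun N => \sum_(t <- s N) a t) = l by apply: cvg_lim.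
apply/eqP; rewrite eq_le; apply/andP; split.
  apply: ub_ereal_sup => _ [A [finA AD] <-].
  have [B uB AB] : exists2 B : seq T, uniq B & A = [set` B].
    have /finite_seqP[b ->] := finA; exists (undup b); first exact: undup_uniq.
    by apply/seteqP; split=> t /=; rewrite mem_undup.
  have [N AN] : exists N, forall t, A t -> t \in s N.
    have : forall t, t \in B -> D t by move=> t tB; apply: AD; rewrite AB.
    rewrite AB; elim: (B) => [|b b' IH] rD; first by exists 0%N.
    have [t tb|N HN] := IH _; first by apply: rD; rewrite inE tb orbT.
    have [M bM] := Ds b (rD b (mem_head _ _)); exists (maxn N M) => t.
    rewrite /= inE => /orP[/eqP ->|tr].
      by apply: sM bM; rewrite leq_maxr.
    by apply: sM (HN t tr); rewrite leq_maxl.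
  rewrite AB -fsbig_seq //.
  rewrite sumEFin lee_fin.
  apply: (@le_trans _ _ (\sum_(t <- s N) a t)).
    rewrite [leRHS](bigID (mem B)) /=.
    rewrite -[leLHS]addr0; apply: lerD; last first.
      by rewrite big_seq_cond sumr_ge0 // => t /andP[/sD /a0].
    rewrite le_eqVlt; apply/orP; left; apply/eqP; rewrite -[RHS]big_filter.
    apply: perm_big; apply: uniq_perm; rewrite ?filter_uniq //.
    move=> t; rewrite mem_filter; case tB : (t \in B) => //=.
    by apply/esym; apply: AN; rewrite AB.
  rewrite -lE; exact: nondecreasing_cvgn_le.
rewrite -lE -EFin_lim //; apply: lime_le => //.
  by apply/cvg_ex; exists l%:E; apply: cvg_EFin; [exact: nearW | exact: cv].
apply: nearW => N; rewrite /= -sumEFin; apply: esum_ge.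
exists [set` s N]; last by rewrite -fsbig_seq.
by split; [exact: finite_seq | move=> t /sD].
Qed.

End CountableSums.

Section Probability.
Variable R : realType.
Variables (q : R) (X Y : seq R) (t1 t2 r : R).
Hypotheses (t1_gt0 : 0 < t1) (t12 : t1 < t2) (r_gt0 : 0 < r) (rt2 : r * t2 < 1).
Hypothesis Yr : forall y, y \in Y -> 0 <= y < r.
Hypothesis Xt : forall a, a \in X -> 0 <= a < t1.
Hypothesis qXt : forall a, a \in scale_alphabet q X -> 0 <= a < t1.

Let rt1 : r * t1 < 1.
Proof. by apply: le_lt_trans rt2; rewrite ler_wpM2l // ltW. Qed.

Local Notation qX := (scale_alphabet q X).
Local Notation d0 := (delta R [::]).
Local Notation g := (Gammas Y d0).
Local Notation f1 := (Gammas qX d0).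
Local Notation Z := (Znorm q X Y).

(** The coordinate of Gamma_X at partitions that do not contain mu vanishes, so
    the condition mu <= lambda can be dropped. *)
Lemma pair_lawE M N mu lam : spart M mu -> spart N lam ->
  pair_law q X Y mu lam = Z^-1 * (2 ^- size lam * (g lam * (f1 mu * Gammas X (delta R mu) lam))).
Proof.
move=> spmu splam; rewrite /pair_law; case: asboolP => [sub|nsub]; last first.
  by rewrite (Gammas_delta_sub _ splam nsub) !mulr0.
rewrite (schurQ_Gammas _ (spart_strict spmu)) skewQ_Gammas ?(spart_strict spmu) ?(spart_strict splam) //.
rewrite /schurP (schurQ_Gammas _ (spart_strict splam)) [Hprod qX Y * _]mulrC -Znorm_Hprod.
by rewrite [RHS]mulrC; congr (_ / _); ring.
Qed.

Lemma Gaf_ge0 A m N l : (forall a, a \in A -> exists b, 0 <= a < b) -> spart N l ->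
  0 <= Gammas A (delta R m) l.
Proof.
move=> A0 spl; apply: Gammas_ge0 spl => [a /A0[b /andP[]]//|M m' _].
by rewrite /delta ler0n.
Qed.

Lemma pair_law_ge0 M N mu lam : spart M mu -> spart N lam -> 0 <= pair_law q X Y mu lam.
Proof.
move=> spmu splam; rewrite (pair_lawE spmu splam).
have Z0 := Znorm_gt0 t12 r_gt0 rt2 Yr Xt qXt.
have g0 : 0 <= g lam by apply: Gaf_ge0 splam => a /Yr; exists r.
have f0 : 0 <= f1 mu by apply: Gaf_ge0 spmu => a /qXt; exists t1.
have h0 : 0 <= Gammas X (delta R mu) lam by apply: Gaf_ge0 splam => a /Xt; exists t1.
by rewrite !mulr_ge0 ?invr_ge0 ?exprn_ge0 // ltW.
Qed.

Definition at_time (S : seq (nat * nat)) (t : nat) : seq nat :=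
  [seq p.1 | p <- S & p.2 == t].

Lemma config_all (S : seq (nat * nat)) mu lam :
  (forall p, p \in S -> p.2 = 1%N \/ p.2 = 2%N) ->
  [set` S] `<=` config mu lam <->
  all (fun k => k \in lam) (at_time S 2) && all (fun k => k \in mu) (at_time S 1).
Proof.
move=> htime; split=> [H|].
  apply/andP; split; apply/allP => k /mapP[[x t]]; rewrite mem_filter /= => /andP[/eqP -> pS] ->.
    by have [[j jm []//]|[j jl [<-]]] := H _ pS.
  by have [[j jm [<-]]|[j jl []//]] := H _ pS.
case/andP=> /allP H2 /allP H1 [x t] /= pS; have /= := htime _ pS; case=> tE.
  left; exists x; last by rewrite tE.
  by apply: H1; apply/mapP; exists (x, t) => //; rewrite mem_filter pS /= tE.
right; exists x; last by rewrite tE.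
by apply: H2; apply/mapP; exists (x, t) => //; rewrite mem_filter pS /= tE.
Qed.

(** The sum over mu is finite and is the expansion of Gamma_X; the sum over
    lambda is the pairing with Gamma_Y vac. *)
Lemma rho_pairing (S : seq (nat * nat)) : (forall p, p \in S -> p.2 = 1%N \/ p.2 = 2%N) ->
  rho q X Y S =
  (Z^-1 * pairing g (occupied (at_time S 2) (Gammas X (occupied (at_time S 1) f1))))%:E.
Proof.
move=> htime; set S2 := at_time S 2; set S1 := at_time S 1; set F := occupied S2 _.
pose ok (p : seq nat * seq nat) :=
  all (fun k => k \in p.2) S2 && all (fun k => k \in p.1) S1.
pose s N := [seq p <- [seq (mu, lam) | lam <- parts N, mu <- parts N] | ok p].
have mem_s N p : (p \in s N) = [&& ok p, spart N.+1 p.1 & spart N.+1 p.2].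
  rewrite mem_filter; congr (_ && _); apply/allpairsP/andP => [[[l m] /= []]|[]].
    by rewrite !mem_parts => ? ? ->.
  by move=> pm pl; exists (p.2, p.1); rewrite /= !mem_parts; split=> //; case: p {pm pl}.
have fcls : tame t1 f1 by apply: tame_Gammas => //; exact: tame_delta.
have Fcls : tame t1 F.
  by apply: tame_occupied => //; apply: tame_Gammas => //; exact: tame_occupied.
have gcls : tame r g by apply: tame_Gammas => //; exact: tame_delta.
rewrite /rho /pair_prob.
apply: (@esum_lim _ _ _ (fun p => pair_law q X Y p.1 p.2) s).
- by move=> [mu lam] [[/= /strict_spart spmu /strict_spart splam] _]; exact: pair_law_ge0 spmu splam.
- move=> N; rewrite filter_uniq // allpairs_uniq ?uniq_parts //.
  by move=> [a b] [c d] _ _ /= [-> ->].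
- move=> N [mu lam]; rewrite mem_s => /and3P[okp spmu splam]; split=> /=.
    by split; [exact: spart_strict spmu | exact: spart_strict splam].
  exact/(config_all _ _ htime).
- move=> N M NM p; rewrite !mem_s => /and3P[-> /= H1 H2].
  by rewrite (spart_le _ H1) // (spart_le _ H2).
- move=> [mu lam] [[/= /strict_spart spmu /strict_spart splam] /(config_all _ _ htime) okp].
  exists (maxn (head 0%N mu) (head 0%N lam)); rewrite mem_s; apply/and3P; split=> /=.
  - exact: okp.
  - by rewrite (spart_le _ spmu) // ltnS leq_maxl.
  - by rewrite (spart_le _ splam) // ltnS leq_maxr.
have -> : (fun N => \sum_(p <- s N) pair_law q X Y p.1 p.2) =
    (fun N => Z^-1 * psum N (pair_term g F)).
  apply: funext => N; rewrite big_filter big_mkcond big_allpairs_dep /= /psum mulr_sumr.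
  apply: eq_big_seq => lam; rewrite mem_parts => splam; rewrite /pair_term /F [occupied S2 _ _]/occupied.
  rewrite /ok /=; case: ifP => H2; last by rewrite !mulr0 big1.
  rewrite (Gammas_expand X (occupied S1 f1) splam) !mulr_sumr; apply: eq_big_seq => mu.
  rewrite mem_parts => spmu /=; rewrite (pair_lawE spmu splam).
  by rewrite /occupied; case: ifP => _ //; rewrite mul0r !mulr0.
apply: cvgMl_tmp; apply: cvg_psum_lim.
by apply: (wsummable_pair_term (ltW r_gt0) (ltW t1_gt0) rt1).
Qed.

Lemma rho_word (S : seq (nat * nat)) n : (forall p, p \in S -> p.2 = 1%N \/ p.2 = 2%N) ->
  uniq S -> (forall p, p \in S -> (0 < p.1)%N) ->
  size (at_time S 2 ++ at_time S 1) = n ->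
  rho q X Y S = ((\prod_(x <- at_time S 2 ++ at_time S 1) (2 * (-1) ^+ x))^-1 *
    pfl (@Kser R) n (map (pair (J2 q X Y)) (nested_ints (at_time S 2)) ++
                     map (pair (J1 q X Y)) (nested_ints (at_time S 1))))%:E.
Proof.
move=> htime us pos szS; rewrite (rho_pairing htime); congr (_%:E).
set S2 := at_time S 2 in szS *; set S1 := at_time S 1 in szS *.
have uS t : uniq (at_time S t).
  rewrite map_inj_in_uniq ?filter_uniq // => -[x i] [y j].
  by rewrite !mem_filter /= => /andP[/eqP -> _] /andP[/eqP -> _] ->.
have pS t : all (fun x => 0 < x)%N (at_time S t).
  by apply/allP => x /mapP[p]; rewrite mem_filter => /andP[_ /pos p0] ->.
have D0 s : \prod_(x <- s) (2 * (-1) ^+ x) != 0 :> R.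
  by rewrite prodf_seq_neq0; apply/allP => x _; rewrite /= mulf_neq0 ?pnatr_eq0 ?signr_eq0.
set D2 := \prod_(x <- S2) (2 * (-1) ^+ x : R).
set D1 := \prod_(x <- S1) (2 * (-1) ^+ x : R).
have fcls : tame t1 f1 by apply: tame_Gammas => //; exact: tame_delta.
have gcls : tame r g by apply: tame_Gammas => //; exact: tame_delta.
have Z0 := Znorm_gt0 t12 r_gt0 rt2 Yr Xt qXt.
have wE : pairing g (word (nested_ints S2) (Gammas X (word (nested_ints S1) f1))) =
    D2 * D1 * pairing g (occupied S2 (Gammas X (occupied S1 f1))).
  have c1 : tame t1 (occupied S2 (Gammas X (occupied S1 f1))).
    by apply: tame_occupied => //; apply: tame_Gammas => //; exact: tame_occupied.
  rewrite -[RHS]addr0 -[X in _ + X](mul0r (pairing g (occupied S2 (Gammas X (occupied S1 f1))))).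
  rewrite -(pairing_lin_r _ _ (ltW r_gt0) (ltW t1_gt0) rt1) //.
  apply: eq_pairing => // N l spl; rewrite (word_nested_ints _ (uS 2%N) (pS 2%N) spl) -/D2.
  rewrite mul0r addr0 -mulrA; congr (_ * _); rewrite /occupied; case: ifP => _; last by rewrite mulr0.
  have -> : D1 * Gammas X (occupied S1 f1) l =
      D1 * Gammas X (occupied S1 f1) l + 0 * Gammas X (occupied S1 f1) l by rewrite mul0r addr0.
  rewrite -(Gammas_lin _ _ _ _ _ spl); apply: eq_Gammas spl => M m spm _.
  by rewrite (word_nested_ints _ (uS 1%N) (pS 1%N) spm) mul0r addr0.
have szI : size (nested_ints S2 ++ nested_ints S1) = n.*2.
  by rewrite size_cat !size_nested_ints -doubleD -szS size_cat.
have := wick2 t1_gt0 t12 r_gt0 rt2 Yr Xt qXt szI; rewrite wE => W.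
have D20 : D2 != 0 by exact: D0.
have D10 : D1 != 0 by exact: D0.
rewrite big_cat -/D2 -/D1 /=.
apply: (canRL (mulKf (mulf_neq0 D20 D10))).
by rewrite mulrCA W mulKf // lt0r_neq0.
Qed.

End Probability.

(** * The matrix of the correlation kernel *)

Section PfaffianSide.
Variable R : realType.
Variables (q : R) (X Y : seq R) (t1 t2 r : R).
Hypotheses (t1_gt0 : 0 < t1) (t12 : t1 < t2) (r_gt0 : 0 < r) (rt2 : r * t2 < 1).
Hypothesis Yr : forall y, y \in Y -> 0 <= y < r.
Hypothesis Xt : forall a, a \in X -> 0 <= a < t1.
Hypothesis qXt : forall a, a \in scale_alphabet q X -> 0 <= a < t1.

Implicit Types (p : nat * nat) (x y : nat * int) (S : seq (nat * nat)).

Definition creator p : nat * int := (p.2, p.1%:Z).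
Definition annihilator p : nat * int := (p.2, - p.1%:Z).

Definition corr x y : R := corrK q X Y x.1 y.1 x.2 y.2.

(** The signs (-1)^x of M_S belong to its annihilating rows and columns. *)
Definition corr_sign x : R := if x.2 < 0 then (-1) ^+ `|x.2| else 1.

Lemma corr_anti x y : x.1 <> y.1 \/ x.2 + y.2 != 0 -> anti corr x y.
Proof.
rewrite /anti /corr; case: (ltngtP x.1 y.1) => [xy _|yx _|xy].
- exact: (corrK_lt t1_gt0 t12 r_gt0 rt2 Yr Xt qXt).
- by rewrite [in RHS](corrK_lt t1_gt0 t12 r_gt0 rt2 Yr Xt qXt) ?opprK.
case=> [//|uv]; rewrite -xy.
rewrite !(corrK_ge t1_gt0 t12 r_gt0 rt2 Yr Xt qXt) //.
by rewrite (Kser_anti t1_gt0 t12 r_gt0 rt2 Yr Xt qXt _ uv) mulrN.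
Qed.

Lemma corr_anti_pm p p' : p != p' ->
  forall x y, x = creator p \/ x = annihilator p -> y = creator p' \/ y = annihilator p' -> anti corr x y.
Proof.
case: p p' => [k t] [k' t'] /= pp' x y xE yE; apply: corr_anti.
have [tt|tt] := eqVneq t t'; last first.
  by left; case: xE yE => -> [] -> /=; apply/eqP.
right; have kk : k != k' by apply: contraNneq pp' => ->; rewrite tt.
by case: xE yE => -> [] -> /=; apply/eqP; move/eqP: kk; lia.
Qed.

(** The row index 2 n - 1 - i of M_S carries the annihilator of the point i. *)
Definition nested S : seq (nat * int) := map creator S ++ rev (map annihilator S).

Lemma size_nested S : size (nested S) = (size S).*2.
Proof. by rewrite size_cat size_rev !size_map addnn. Qed.

Lemma pfaffian_corr_mx n (S : n.-tuple (nat * nat)) :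
  pfaffian (corr_mx q X Y S) = pfl (fun x y => corr_sign x * corr_sign y * corr x y) n (nested S).
Proof.
set K := fun x y => _; pose d : nat * int := (0%N, 0).
have szL : size (nested S) = n.*2 by rewrite size_nested size_tuple.
rewrite -(pfaffian_pfl d K szL); congr pfaffian; apply/matrixP => i j; rewrite !mxE.
have L1 k : (k < n)%N -> nth d (nested S) k = creator (nth (0, 0)%N S k).
  by move=> kn; rewrite nth_cat size_map size_tuple kn (nth_map (0, 0)%N) ?size_tuple.
have L2 k : (n <= k < n.*2)%N -> nth d (nested S) k = annihilator (nth (0, 0)%N S (n.*2 - k - 1)).
  case/andP=> nk kn; rewrite nth_cat size_map size_tuple ltnNge nk /=.
  rewrite nth_rev size_map size_tuple; last by lia.
  rewrite (nth_map (0, 0)%N) ?size_tuple; last by lia.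
  by congr (annihilator (nth _ _ _)); lia.
have epsp p : corr_sign (creator p) = 1 by [].
have epsm p : corr_sign (annihilator p) = (-1) ^+ p.1.
  by case: p => [[|k] t]; rewrite /corr_sign /annihilator /= ?expr0 ?abszN.
have E (a b : 'I_n.*2) : (a < b)%N ->
  (if (b < n)%N then corrK q X Y (nth (0, 0)%N S a).2 (nth (0, 0)%N S b).2
      (nth (0, 0)%N S a).1%:Z (nth (0, 0)%N S b).1%:Z
   else if (a < n)%N then (-1) ^+ (nth (0, 0)%N S (n.*2 - b - 1)).1 *
      corrK q X Y (nth (0, 0)%N S a).2 (nth (0, 0)%N S (n.*2 - b - 1)).2
      (nth (0, 0)%N S a).1%:Z (- (nth (0, 0)%N S (n.*2 - b - 1)).1%:Z)
   else (-1) ^+ ((nth (0, 0)%N S (n.*2 - a - 1)).1 + (nth (0, 0)%N S (n.*2 - b - 1)).1) *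
      corrK q X Y (nth (0, 0)%N S (n.*2 - a - 1)).2 (nth (0, 0)%N S (n.*2 - b - 1)).2
      (- (nth (0, 0)%N S (n.*2 - a - 1)).1%:Z) (- (nth (0, 0)%N S (n.*2 - b - 1)).1%:Z)) =
  K (nth d (nested S) a) (nth d (nested S) b).
  move=> ab; have bn2 := ltn_ord b; rewrite /K; case: (ltnP b n) => bn.
    by rewrite !L1 ?(ltn_trans ab) // !epsp !mul1r.
  case: (ltnP a n) => an.
    by rewrite L1 // L2 ?bn // epsp epsm mul1r.
  by rewrite !L2 ?bn ?an ?(ltn_trans ab) // !epsm -exprD.
case: (ltngtP i j) => ij.
- exact: E.
- by congr (- _); exact: E.
- by [].
Qed.

Lemma prod_corr_sign S : \prod_(x <- nested S) corr_sign x = \prod_(p <- S) (-1) ^+ p.1.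
Proof.
rewrite big_cat /= big_map big1 ?mul1r; last by move=> p _.
rewrite (perm_big _ (permEl (perm_rev _))) big_map; apply: eq_bigr => -[[|k] t] _ //=.
Qed.

Lemma perm_times S : (forall p, p \in S -> p.2 = 1%N \/ p.2 = 2%N) ->
  perm_eq S ([seq p <- S | p.2 == 2] ++ [seq p <- S | p.2 == 1]).
Proof.
move=> htime; rewrite (@eq_in_filter _ (fun p => p.2 == 1) (predC (fun p => p.2 == 2))).
  by rewrite perm_sym (permEl (perm_filterC _ _)).
by move=> p /htime[] /= ->.
Qed.

(** A nested word can be unfolded into a product of pairs, which may be permuted,
    and folded again within each time. *)
Lemma nested_sort n S : uniq S ->
  (forall p, p \in S -> p.2 = 1%N \/ p.2 = 2%N) ->
  pfl corr n (nested S) =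
  pfl corr n (nested [seq p <- S | p.2 == 2] ++ nested [seq p <- S | p.2 == 1]).
Proof.
move=> uS htime.
have toP s c d : uniq s -> pfl corr n (c ++ nested s ++ d) = pfl corr n (c ++ pairs creator annihilator s ++ d).
  exact: pfl_nested corr_anti_pm _ _ _ _.
have perm12 := perm_times htime.
have := toP S [::] [::] uS; rewrite /= !cats0 => ->.
have := pfl_pairs_perm corr_anti_pm n [::] [::] uS perm12; rewrite /= !cats0 => ->.
rewrite /pairs map_cat flatten_cat -/(pairs creator annihilator _) -/(pairs creator annihilator [seq p <- S | p.2 == 1]).
have := toP [seq p <- S | p.2 == 2] [::] (pairs creator annihilator [seq p <- S | p.2 == 1]).
rewrite /= => <-; last exact: filter_uniq.
have := toP [seq p <- S | p.2 == 1] (nested [seq p <- S | p.2 == 2]) [::].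
by rewrite !cats0 => <- //; exact: filter_uniq.
Qed.

Lemma nested_at_time S t :
  nested [seq p <- S | p.2 == t] = map (pair t) (nested_ints (at_time S t)).
Proof.
rewrite /nested /nested_ints /at_time map_cat map_rev -!map_comp.
by congr (_ ++ rev _); apply/eq_in_map => -[k i]; rewrite mem_filter /= => /andP[/eqP/= -> _].
Qed.

(** With decreasing times only the expansion in |z| > |w| occurs. *)
Lemma pfl_corr_Kser n s2 s1 :
  pfl corr n (map (pair 2%N) s2 ++ map (pair 1%N) s1) =
  2^-1 ^+ n * pfl (@Kser R) n (map (pair (J2 q X Y)) s2 ++ map (pair (J1 q X Y)) s1).
Proof.
have -> : map (pair (J2 q X Y)) s2 ++ map (pair (J1 q X Y)) s1 =
    [seq (J q X Y x.1, x.2) | x <- map (pair 2%N) s2 ++ map (pair 1%N) s1].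
  by rewrite map_cat -!map_comp.
rewrite pfl_map -pfl_scale; apply: (@eq_pfl _ _ _ _ (fun x y => y.1 <= x.1)%N).
  by move=> [a u] [b v] /= ba; exact: (corrK_ge t1_gt0 t12 r_gt0 rt2 Yr Xt qXt).
have same t s : pairwise (fun x y : nat * int => (y.1 <= x.1)%N) (map (pair t) s).
  by rewrite pairwise_map; elim: s => //= u s ->; rewrite andbT; apply/allP => v _ /=.
rewrite pairwise_cat !same !andbT; apply/allrelP => _ _ /mapP[u _ ->] /mapP[v _ ->] //.
Qed.

(** The constants agree: each point contributes 2 (-1)^x to the word of fields,
    the sign (-1)^x to M_S, and one factor 1/2 of the kernel. *)
Lemma rho_pfaffian n (S : n.-tuple (nat * nat)) : uniq S ->
  (forall p, p \in S -> (0 < p.1)%N) ->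
  (forall p, p \in S -> p.2 = 1%N \/ p.2 = 2%N) ->
  rho q X Y S = (pfaffian (corr_mx q X Y S))%:E.
Proof.
move=> uS pos htime.
have perm12 : perm_eq (map fst S) (at_time S 2 ++ at_time S 1).
  by rewrite -map_cat; apply: perm_map; exact: perm_times.
have sz : size (at_time S 2 ++ at_time S 1) = n.
  by rewrite -(perm_size perm12) size_map size_tuple.
rewrite (rho_word t1_gt0 t12 r_gt0 rt2 Yr Xt qXt htime uS pos sz); congr (_%:E).
rewrite pfaffian_corr_mx pfl_conj prod_corr_sign nested_sort // !nested_at_time.
rewrite pfl_corr_Kser mulrA; congr (_ * _).
rewrite -(perm_big _ perm12) big_map -prodfV.
transitivity (\prod_(p <- S) (2^-1 * (-1) ^+ p.1 : R)).
  by apply: eq_bigr => p _; rewrite invfM invr_sign.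
rewrite big_split mulrC; congr (_ * _).
by rewrite big_const_seq count_predT size_tuple iter_mulr_1.
Qed.

End PfaffianSide.

Theorem theorem9p1 (R : realType) (q : R) (X Y : seq R)
    (hq : 0 <= q)
    (hX : forall x, x \in X -> 0 <= x)
    (hY : forall y, y \in Y -> 0 <= y)
    (hXY : forall x y, x \in X -> y \in Y -> Num.max 1 q * (x * y) < 1)
    (n : nat) (S : n.-tuple (nat * nat))
    (hS : uniq S)
    (hpos : forall p, p \in S -> (0 < p.1)%N)
    (htime : forall p, p \in S -> p.2 = 1%N \/ p.2 = 2%N) :
  rho q X Y S = (pfaffian (corr_mx q X Y S))%:E.
Proof.
(* The operators use the variables of X and of q X: this is the reason for the
   maximum of 1 and q in the hypothesis. *)
have [a|a y aA yY|t1 [t2 [r [t1_gt0 t12 r_gt0 rt2 [Yr At]]]]] :=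
    @exists_radii R (X ++ scale_alphabet q X) Y _ hY.
- by rewrite mem_cat => /orP[/hX//|/mapP[x /hX x0 ->]]; rewrite mulr_ge0.
- move: aA; rewrite mem_cat => /orP[aX|/mapP[x xX ->]].
    apply: le_lt_trans (hXY a y aX yY).
    by apply: ler_peMl; [apply: mulr_ge0; [exact: hX | exact: hY] | rewrite le_max lexx].
  apply: le_lt_trans (hXY x y xX yY).
  rewrite -mulrA; apply: ler_wpM2r; first by apply: mulr_ge0; [exact: hX | exact: hY].
  by rewrite le_max lexx orbT.
apply: (rho_pfaffian t1_gt0 t12 r_gt0 rt2 Yr) => // a aA; apply: At.
  by rewrite mem_cat aA.
by rewrite mem_cat aA orbT.
Qed.
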